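(* Let $W$ be a $3$-web with nonvanishing curvature such that $$J=\det\begin{pmatrix}\nabla_1(a_1)&\nabla_1(a_2)\\ \nabla_2(a_1)&\nabla_2(a_2)\end{pmatrix}=0,$$ and suppose that the invariants $a_1$ and $a_2$ satisfy the relations $$a_2(\nabla_1(a_2))^2+\nabla_1\nabla_2(a_2)\,\nabla_1(a_2)=a_1\nabla_1(a_2)\,\nabla_2(a_2)+\nabla_1^2(a_2)\,\nabla_2(a_2),$$ $$a_2\nabla_2(a_2)\nabla_1(a_2)+\nabla_2^2(a_2)\nabla_1(a_2)=a_1(\nabla_2(a_2))^2+\nabla_2\nabla_1(a_2)\,\nabla_2(a_2),$$ $$\nabla_2\nabla_1\nabla_2(a_2)+a_2\nabla_1\nabla_2(a_2)=a_1\nabla_2^2(a_2)+a_2\nabla_1(a_2)\nabla_2(a_2)+\nabla_1\nabla_2^2(a_2).$$ Then there is a (local) nontrivial infinitesimal automorphism of $W$, which is unique up to a factor and has the form $$X=s\left(\nabla_2(a_2)\,\nabla_1-\nabla_1(a_2)\,\nabla_2\right),$$ where the function $s$ is a solution of the system $$\nabla_1(s)=-\frac{a_2\nabla_1(a_2)+\nabla_1\nabla_2(a_2)}{\nabla_2(a_2)}\,s,\qquad \nabla_1(s)=-\frac{a_1\nabla_1(a_2)+\nabla_1^2(a_2)}{\nabla_1(a_2)}\,s,$$ $$\nabla_2(s)=-\frac{a_2\nabla_2(a_2)+\nabla_2^2(a_2)}{\nabla_2(a_2)}\,s,\qquad \nabla_2(s)=-\frac{a_1\nabla_2(a_2)+\nabla_2\nabla_1(a_2)}{\nabla_1(a_2)}\,s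 .$$
   Context: $M$ is a two-dimensional smooth manifold. A $3$-web $W$ on $M$ is given by three differential $1$-forms $\omega_1,\omega_2,\omega_3$, any two linearly independent at each point (the foliations of the web are $\{\omega_i=0\}$), normalized by $\omega_1+\omega_2+\omega_3=0$. There is a unique $1$-form $\gamma$ with $d\omega_1=\omega_1\wedge\gamma$, $d\omega_2=\omega_2\wedge\gamma$; the curvature $K$ is defined by $d\gamma=K\,\omega_1\wedge\omega_2$. It is assumed that $K$ is nowhere zero, and (changing the orientation if necessary) $K>0$, $K=k^2$ with $k>0$ smooth. Put $\theta_i=k\,\omega_i$ ($i=1,2$) and $\alpha=\gamma-dk/k$; then $d\theta_i=\theta_i\wedge\alpha$, $d\alpha=\theta_1\wedge\theta_2$. The vector fields $\nabla_1,\nabla_2$ form the basis dual to $\theta_1,\theta_2$, and the absolute invariants $a_1,a_2$ are the functions defined by $\alpha=a_1\theta_1+a_2\theta_2$. One has $[\nabla_1,\nabla_2]=-a_2\nabla_1+a_1\nabla_2$ and $\nabla_1(a_2)-\nabla_2(a_1)=1$. Products such as $\nabla_1\nabla_2(a_2)$ mean $\nabla_1(\nabla_2(a_2))$. The functions $\nabla_1(a_2)$ and $\nabla_2(a_2)$, which occur as denominators in the system for $s$, are understood to be nonvanishing. A vector field $X$ is an infinitesimal automorphism of $W$ if the (local) one-parameter group of shifts along $X$ consists of diffeomorphisms preserving $W$; it is nontrivial if $X\ne 0$. *)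

(* Defs.v *)
From HB Require Import structures.
From mathcomp Require Export all_boot all_order all_algebra.
From mathcomp Require Export all_classical all_reals all_analysis.
Export Order.TTheory GRing.Theory Num.Theory.
Export numFieldNormedType.Exports.

Set Implicit Arguments.
Unset Strict Implicit.
Unset Printing Implicit Defensive.

Local Open Scope classical_set_scope.
Local Open Scope ring_scope.

(* C^n and C^infinity for maps between normed spaces. They are used on open
   sets of finite-dimensional spaces only, where it is enough to ask that every
   x |-> 'd f x v be C^(n-1). *)
Fixpoint Cn (R : realType) (V W : normedModType R) (n : nat) (A : set V)
    (f : V -> W) : Prop :=
  match n with
  | 0%N => forall x, A x -> {for x, continuous f}
  | m.+1 => (forall x, A x -> differentiable f x) /\
            (forall v, Cn m A (fun x => 'd f x v))
  end.

Definition smooth_on (R : realType) (V W : normedModType R) (A : set V)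
    (f : V -> W) : Prop :=
  forall n, Cn n A f.

(* A smooth structure on a two-dimensional topological manifold M: an atlas of
   charts coord c : dom c -> R^2 with inverses param c. The functions coord c
   and param c are total, with irrelevant values outside dom c and its image.
   Every point p has a preferred chart chart_at p. *)
Record smooth_surface (R : realType) (M : topologicalType) := SmoothSurface {
  chart : Type ;
  dom : chart -> set M ;
  coord : chart -> M -> 'rV[R]_2 ;
  param : chart -> 'rV[R]_2 -> M ;
  chart_at : M -> chart ;
  dom_chart_at : forall p, dom (chart_at p) p ;
  open_dom : forall c, open (dom c) ;
  open_coord : forall c, open (coord c @` dom c) ;
  coordK : forall c p, dom c p -> param c (coord c p) = p ;
  coord_continuous : forall c p, dom c p -> {for p, continuous (coord c)} ;
  param_continuous : forall c x, (coord c @` dom c) x ->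
    {for x, continuous (param c)} ;
  transition_smooth : forall c c',
    smooth_on (coord c @` (dom c `&` dom c')) (coord c' \o param c) ;
  surface_hausdorff : hausdorff_space M ;
  surface_second_countable : @second_countable M }.

(* The tangent space at p is identified with R^2 (row vectors) by the preferred
   chart at p, and the cotangent space with column vectors. Vector fields and
   1-forms are therefore plain functions on M; their components in a chart c
   are given by vf_rep and form_rep. *)
Definition vector_field (R : realType) (M : topologicalType)
    (S : smooth_surface R M) := M -> 'rV[R]_2.
Definition one_form (R : realType) (M : topologicalType)
    (S : smooth_surface R M) := M -> 'cV[R]_2.

Section Surface.
Context {R : realType} {M : topologicalType} (S : smooth_surface R M).
Implicit Types (U V : set M) (f : M -> R) (p q : M) (c : chart S).

Definition at_coord p : 'rV[R]_2 := coord (chart_at S p) p.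

Definition pairing (w : 'cV[R]_2) (v : 'rV[R]_2) : R := (v *m w) 0 0.

Definition tangent_map (F : M -> M) p (v : 'rV[R]_2) : 'rV[R]_2 :=
  'd (coord (chart_at S (F p)) \o F \o param (chart_at S p)) (at_coord p) v.

Definition vf_rep c (X : vector_field S) (x : 'rV[R]_2) : 'rV[R]_2 :=
  let p := param c x in
  'd (coord c \o param (chart_at S p)) (at_coord p) (X p).

Definition form_rep c (w : one_form S) (x : 'rV[R]_2) : 'cV[R]_2 :=
  let p := param c x in
  \col_i pairing (w p)
    ('d (coord (chart_at S p) \o param c) x (delta_mx 0 i)).

Definition smooth_fun U f : Prop :=
  forall c, smooth_on (coord c @` (U `&` dom c)) (f \o param c).

Definition smooth_vf U (X : vector_field S) : Prop :=
  forall c, smooth_on (coord c @` (U `&` dom c)) (vf_rep c X).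

Definition smooth_form U (w : one_form S) : Prop :=
  forall c, smooth_on (coord c @` (U `&` dom c)) (form_rep c w).

Definition smooth_map U (F : M -> M) : Prop :=
  (forall p, U p -> {for p, continuous F}) /\
  (forall c c', smooth_on (coord c @` (U `&` dom c `&` F @^-1` dom c'))
                          (coord c' \o F \o param c)).

Definition diffeo_on U (F : M -> M) : Prop :=
  [/\ smooth_map U F, open (F @` U) &
      exists2 G : M -> M, smooth_map (F @` U) G & forall p, U p -> G (F p) = p].

Definition dfun f : one_form S := fun p =>
  \col_i 'd (f \o param (chart_at S p)) (at_coord p) (delta_mx 0 i).

(* der X f = X(f) *)
Definition der (X : vector_field S) f : M -> R := fun p => pairing (dfun f p) (X p).

(* Convention without the factor 1/2; u and v are extended as constant fields in
   the preferred chart at p, so that their bracket vanishes. *)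
Definition ext_d (w : one_form S) p (u v : 'rV[R]_2) : R :=
  let rep := form_rep (chart_at S p) w in
  'd (fun x => pairing (rep x) v) (at_coord p) u -
  'd (fun x => pairing (rep x) u) (at_coord p) v.

Definition wedge (w e : one_form S) p (u v : 'rV[R]_2) : R :=
  pairing (w p) u * pairing (e p) v - pairing (w p) v * pairing (e p) u.

Record web3 := Web3 {
  form1 : one_form S ;
  form2 : one_form S ;
  form3 : one_form S ;
  form1_smooth : smooth_form setT form1 ;
  form2_smooth : smooth_form setT form2 ;
  form3_smooth : smooth_form setT form3 ;
  form12_free : forall p, free [:: form1 p; form2 p] ;
  form13_free : forall p, free [:: form1 p; form3 p] ;
  form23_free : forall p, free [:: form2 p; form3 p] ;
  form_sum0 : forall p, form1 p + form2 p + form3 p = 0 }.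

Section Web.
Variable W : web3.

Definition is_connection (gamma : one_form S) : Prop :=
  [/\ smooth_form setT gamma,
      forall p u v, ext_d (form1 W) p u v = wedge (form1 W) gamma p u v &
      forall p u v, ext_d (form2 W) p u v = wedge (form2 W) gamma p u v].

Definition is_curvature (gamma : one_form S) (K : M -> R) : Prop :=
  forall p u v, ext_d gamma p u v = K p * wedge (form1 W) (form2 W) p u v.

Definition theta1 (k : M -> R) : one_form S := fun p => k p *: form1 W p.
Definition theta2 (k : M -> R) : one_form S := fun p => k p *: form2 W p.

Definition alpha (gamma : one_form S) (k : M -> R) : one_form S :=
  fun p => gamma p - (k p)^-1 *: dfun k p.

Definition is_dual_frame (k : M -> R) (N1 N2 : vector_field S) : Prop :=
  [/\ smooth_vf setT N1, smooth_vf setT N2 &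
      forall p, [/\ pairing (theta1 k p) (N1 p) = 1,
                    pairing (theta2 k p) (N1 p) = 0,
                    pairing (theta1 k p) (N2 p) = 0 &
                    pairing (theta2 k p) (N2 p) = 1]].

Definition are_absolute_invariants (gamma : one_form S) (k a1 a2 : M -> R) : Prop :=
  [/\ smooth_fun setT a1, smooth_fun setT a2 &
      forall p, alpha gamma k p = a1 p *: theta1 k p + a2 p *: theta2 k p].

(* phi t q, for |t| < eps and q in V, is the local one-parameter group of
   shifts along X, a vector field on U. *)
Record local_flow U (X : vector_field S) V (eps : R) (phi : R -> M -> M) : Prop :=
  LocalFlow {
  flow_in : forall t q, `|t| < eps -> V q -> U (phi t q) ;
  flow_continuous : forall t q, `|t| < eps -> V q ->
    {for (t, q), continuous (fun z : R * M => phi z.1 z.2)} ;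
  flow_smooth : forall c c',
    smooth_on [set z : R * 'rV[R]_2 |
                 [/\ `|z.1| < eps, (coord c @` (V `&` dom c)) z.2 &
                     dom c' (phi z.1 (param c z.2))]]
              (fun z => coord c' (phi z.1 (param c z.2))) ;
  flow0 : forall q, V q -> phi 0 q = q ;
  flowD : forall t t' q, `|t| < eps -> `|t'| < eps -> `|t + t'| < eps ->
    V q -> V (phi t' q) -> phi (t + t') q = phi t (phi t' q) ;
  flow_velocity : forall t q, `|t| < eps -> V q ->
    is_derive t (1 : R) (fun r => coord (chart_at S (phi t q)) (phi r q))
              (X (phi t q)) }.

(* F sends leaves of each of the three foliations {w = 0} to leaves of the same
   foliation: its differential maps the kernel of w at q to that at F q. *)
Definition preserves_web V (F : M -> M) : Prop :=
  forall w : one_form S, [\/ w = form1 W, w = form2 W | w = form3 W] ->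
  forall q v, V q -> pairing (w q) v = 0 ->
    pairing (w (F q)) (tangent_map F q v) = 0.

(* The local flow of a smooth vector field exists and is unique, so quantifying
   existentially over it is no restriction. *)
Definition inf_automorphism U (X : vector_field S) : Prop :=
  smooth_vf U X /\
  forall p, U p -> exists (V : set M) (eps : R) (phi : R -> M -> M),
    [/\ open V, V p, V `<=` U, 0 < eps & local_flow U X V eps phi] /\
    (forall t, `|t| < eps -> diffeo_on V (phi t) /\ preserves_web V (phi t)).

End Web.
End Surface.

(* Main.v *)
From HB Require Import structures.
Require Import Defs.
From mathcomp Require Import ring lra.

(** Write P = N2 a2, Q = N1 a2 and let X = s (P N1 - Q N2) be the field of the
   theorem. The structure equations of the web give
   [N1, N2] = - a2 N1 + a1 N2 (lie_frame) and N1 a2 - N2 a1 = 1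
   (invariant_structure); from there on the forms matter only through the dual
   frame N1, N2.

   Uniqueness. Let the flow of Y preserve the three foliations. Differentiating
   at time 0 shows that [Y, N1] and [Y, N2] are multiples of N1 and N2, with the
   same factor because the third foliation is preserved too (flow_lie_condition,
   automorphism_lie). For the components y1, y2 of Y these are four equations of
   first order. The commutator identity for y1 and y2 gives
   Ni mult = Y ai - ai mult for the factor mult, and then for mult itself it
   reads 2 mult = 0 (mult0). Hence Y commutes with the frame and Y a2 = 0
   (comp_tangent), which makes Y proportional to P N1 - Q N2. Since Y and X solve
   the same linear equations, the ratio of Y to X has vanishing derivatives
   (ratio_constant) and is constant on connected sets (frame_constant).

   Existence. That X commutes with N1 and N2 is the system for s: two formulas
   for each derivative of s, which agree by the first two relations between the
   invariants. The form with values N1 (ln s), N2 (ln s) on the frame is closed,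
   by the second relation and the commutator identity for P; so it has a local
   primitive (poincare, frame_primitive), and s is its exponential.

   The flow is found without solving a differential equation. The form
   theta2 / theta2(X) is closed, because X is a symmetry of theta2; a primitive y
   satisfies N1 y = 0 and X y = 1 (scaled_symmetry_exists). As X a2 = 0, the map
   (a2, y) is a local diffeomorphism (local_inverse) that turns X into the second
   coordinate field and its flow into a translation. The coefficients of the
   frame in these coordinates are functions of P, Q and s, which X annihilates
   (symmetry_invariants); so the flow carries the frame to the frame (phi_frame)
   and with it the three foliations (phi_preserves_web). *)

Set Implicit Arguments.
Unset Strict Implicit.
Unset Printing Implicit Defensive.
Local Open Scope classical_set_scope.
Local Open Scope ring_scope.

(** * The class C^n *)

Section Differentials.
Context {R : realType}.
Implicit Types U V W : normedModType R.

Lemma near_eq_is_diff V W (f g : V -> W) (x : V) (L : V -> W) :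
  (\forall y \near x, f y = g y) -> is_diff x f L -> is_diff x g L.
Proof.
move=> fg df; have dfE := @diff_val _ _ _ _ _ _ _ df.
have dfx : differentiable f x by exact: ex_diff.
have [cd df0] := iffLR (diff_locallyP _ _) dfx.
have dg : continuous ('d f x) /\ g \o shift x = cst (g x) + 'd f x +o_ 0 id.
  split=> //; rewrite -(nbhs_singleton fg); apply/eqaddoP => e e0.
  move/eqaddoP : df0 => /(_ e e0); apply: filter_app.
  have : \forall y \near (0 : V), f (y + x) = g (y + x).
    have := fg; rewrite (near_shift (0:V) x (fun y => f y = g y)).
    by rewrite /= subr0; apply.
  apply: filterS => y /= fgy.
  by rewrite !fctE /= fgy.
have gE := diff_unique dg.1 dg.2.
apply: DiffDef; last by rewrite gE dfE.
by apply/diff_locallyP; rewrite gE.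
Unshelve. all: by end_near.
Qed.

Lemma near_eq_diff V W (f g : V -> W) (x : V) :
  (\forall y \near x, f y = g y) -> differentiable f x ->
  'd g x = 'd f x :> (V -> W).
Proof.
by move=> fg /differentiableP df; case: (near_eq_is_diff fg df).
Qed.

Lemma eq_is_diff V W (f g : V -> W) (x : V) (L M : V -> W) :
  is_diff x f L -> f =1 g -> L =1 M -> is_diff x g M.
Proof. by move=> + /funext fg /funext LM; rewrite fg LM. Qed.

Lemma is_diff_Zvec V W (f : V -> R) (g : V -> W) x df dg :
  is_diff x f df -> is_diff x g dg ->
  is_diff x (fun y => f y *: g y) (fun v => f x *: dg v + df v *: g x).
Proof.
move=> hf hg.
pose sc (a : R) (w : W) : W := a *: w.
have scb : bilinear_for (GRing.Scale.Law.clone _ _ *:%R _)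
    (GRing.Scale.Law.clone _ _ *:%R _) sc.
  split=> [u'|u] a z y /=; rewrite /sc.
  - by rewrite scalerDl scalerA.
  - by rewrite scalerDr !scalerA mulrC.
pose scM := bilinear_isBilinear.Build R R W W _ _ sc scb.
pose scB : {bilinear R -> W -> W} := HB.pack sc scM.
have cs : continuous (fun p : R * W => scB p.1 p.2).
  exact: scale_continuous.
have hsc (p : R * W) : is_diff p (fun q : R * W => scB q.1 q.2)
    (fun q => p.1 *: q.2 + q.1 *: p.2).
  by apply: DiffDef; [exact: differentiable_bilin | rewrite diff_bilin].
exact: eq_is_diff (@is_diff_comp _ _ _ _ (fun y => (f y, g y)) _ _ _ x
  (is_diff_pair hf hg) (hsc (f x, g x))) _ _.
Qed.

Lemma is_diff_linear V W (L : V -> W) x :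
  linear L -> continuous L -> is_diff x L L.
Proof.
move=> linL cL.
pose LM := GRing.isLinear.Build _ _ _ _ _ linL.
pose LL : {linear V -> W} := HB.pack L LM.
apply: DiffDef; first exact: (@linear_differentiable _ _ _ LL).
exact: (@diff_lin _ _ _ LL).
Qed.

Lemma linear_coord m n i j : linear (fun A : 'M[R]_(m, n) => A i j : R).
Proof. by move=> a u v; rewrite !mxE. Qed.

Lemma continuous_coord m n i j : continuous (fun A : 'M[R]_(m, n) => A i j : R).
Proof. exact: matrix_normedtype.coord_continuous. Qed.

Lemma diff_sum_delta V n (f : 'rV[R]_n -> V) x v :
  'd f x v = \sum_(j < n) v 0 j *: 'd f x (delta_mx 0 j).
Proof.
rewrite [in LHS](row_sum_delta v) linear_sum; apply: eq_bigr => j _.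
exact: linearZ.
Qed.

End Differentials.

Section Cn_theory.
Context {R : realType}.
Implicit Types V W : normedModType R.

Lemma Cn_sub V W n (A B : set V) (f : V -> W) :
  A `<=` B -> Cn n B f -> Cn n A f.
Proof.
move=> AB; elim: n f => [|n IH] f /=; first by move=> h x /AB /h.
by move=> [h1 h2]; split=> [x /AB /h1//|v]; apply: IH.
Qed.

Lemma Cn_pred V W n (A : set V) (f : V -> W) : Cn n.+1 A f -> Cn n A f.
Proof.
elim: n f => [|n IH] f [h1 h2]; first by move=> x /h1 /differentiable_continuous.
by split=> // v; apply: IH.
Qed.

Lemma Cn_ext V W n (A : set V) (f g : V -> W) : open A ->
  (forall x, A x -> f x = g x) -> Cn n A f -> Cn n A g.
Proof.
move=> oA; elim: n f g => [|n IH] f g fg.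
  move=> /= h x Ax; have nfg : \forall y \near x, f y = g y.
    by apply: filterS fg _; exact: open_nbhs_nbhs.
  have := h x Ax; rewrite /prop_for /continuous_at (fg x Ax).
  by apply: cvg_trans; apply: near_eq_cvg; apply: filterS nfg => y /esym.
move=> [h1 h2]; have nfg x : A x -> \forall y \near x, f y = g y.
  by move=> Ax; apply: filterS fg _; exact: open_nbhs_nbhs.
split=> [x Ax|v].
  have := near_eq_is_diff (nfg x Ax) (differentiableP (h1 x Ax)).
  by move=> ?; exact: ex_diff.
apply: IH (h2 v) => x Ax; rewrite (near_eq_diff (nfg x Ax)) //; exact: h1.
Qed.

(** Every closure property of the class is an induction on n: a formula for the
   differential, valid on the whole open set and made of functions already known
   to be of class C^n, gains one order. *)
Lemma Cn_is_diff V W n (A : set V) (f : V -> W) (df : V -> V -> W) : open A ->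
  (forall x, A x -> is_diff x f (df x)) ->
  (forall v, Cn n A (fun x => df x v)) -> Cn n.+1 A f.
Proof.
move=> oA h1 h2; split=> [x Ax|v].
  by have := h1 x Ax => ?; exact: ex_diff.
apply: Cn_ext (h2 v) => // x Ax.
by have := h1 x Ax => ?; rewrite diff_val.
Qed.

Lemma Cn_diff V W n (A : set V) (f : V -> W) x :
  Cn n.+1 A f -> A x -> is_diff x f ('d f x).
Proof. by move=> [h _] Ax; apply: differentiableP; exact: h. Qed.

Lemma Cn_cst V W n (A : set V) (w : W) : Cn n A (cst w).
Proof.
elim: n w => [|n IH] w /=; first by move=> x _; exact: cst_continuous.
split=> [x _|v]; first exact: differentiable_cst.
have -> : (fun x => 'd (cst w : V -> W) x v) = cst 0.
  by apply/funext => x; rewrite diff_cst.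
exact: IH.
Qed.

Lemma CnD V W n (A : set V) (f g : V -> W) : open A ->
  Cn n A f -> Cn n A g -> Cn n A (fun x => f x + g x).
Proof.
move=> oA; elim: n f g => [|n IH] f g hf hg.
  by move=> x Ax; apply: continuousD; [exact: hf|exact: hg].
apply: (@Cn_is_diff _ _ _ _ _ (fun x v => 'd f x v + 'd g x v)) => //.
  by move=> x Ax; apply: is_diffD; apply: Cn_diff Ax; [exact: hf|exact: hg].
by move=> v; apply: IH; [exact: hf.2 | exact: hg.2].
Qed.

Lemma CnZ V W n (A : set V) (f : V -> R) (g : V -> W) : open A ->
  Cn n A f -> Cn n A g -> Cn n A (fun x => f x *: g x).
Proof.
move=> oA; elim: n f g => [|n IH] f g hf hg.
  by move=> x Ax; apply: continuousZ; [exact: hf|exact: hg].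
apply: (@Cn_is_diff _ _ _ _ _ (fun x v => f x *: 'd g x v + 'd f x v *: g x)) => //.
  by move=> x Ax; apply: is_diff_Zvec; apply: Cn_diff Ax; [exact: hf|exact: hg].
move=> v; apply: CnD => //; apply: IH => //.
- exact: Cn_pred.
- exact: hg.2.
- exact: hf.2.
- exact: Cn_pred.
Qed.

Lemma CnM V n (A : set V) (f g : V -> R) : open A ->
  Cn n A f -> Cn n A g -> Cn n A (fun x => f x * g x).
Proof. exact: CnZ. Qed.

Lemma CnN V W n (A : set V) (f : V -> W) : open A ->
  Cn n A f -> Cn n A (fun x => - f x).
Proof.
move=> oA hf; apply: (@Cn_ext _ _ _ _ (fun x => (cst (-1) x : R) *: f x)) => //.
  by move=> x _; rewrite scaleN1r.
by apply: CnZ => //; exact: Cn_cst.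
Qed.

Lemma CnB V W n (A : set V) (f g : V -> W) : open A ->
  Cn n A f -> Cn n A g -> Cn n A (fun x => f x - g x).
Proof. by move=> oA hf hg; apply: CnD => //; exact: CnN. Qed.

Lemma Cn_sum V W n m (A : set V) (f : 'I_m -> V -> W) : open A ->
  (forall i, Cn n A (f i)) -> Cn n A (fun x => \sum_(i < m) f i x).
Proof.
move=> oA; elim: m f => [|m IH] f h.
  by apply: (Cn_ext oA _ (Cn_cst n A 0)) => x _; rewrite big_ord0.
apply: (Cn_ext oA _ (CnD oA (IH _ (fun i => h (widen_ord (leqnSn m) i)))
  (h ord_max))) => x _.
by rewrite big_ord_recr.
Qed.

Lemma CnV V n (A : set V) (f : V -> R) : open A ->
  (forall x, A x -> f x != 0) -> Cn n A f -> Cn n A (fun x => (f x)^-1).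
Proof.
move=> oA f0; elim: n f f0 => [|n IH] f f0 hf.
  by move=> x Ax; apply: continuousV; [exact: f0|exact: hf].
apply: (@Cn_is_diff _ _ _ _ _ (fun x v => - ((f x)^-1 * (f x)^-1) * 'd f x v)) => //.
  move=> x Ax; have dfx := hf.1 x Ax; apply: DiffDef.
    by apply: differentiableV => //; exact: f0.
  rewrite diffV ?f0 //; apply/funext => v /=.
  by rewrite -[LHS]/(- (f x ^+ 2)^-1 * 'd f x v) expr2 invfM.
have hV : Cn n A (fun x => (f x)^-1) by apply: IH => //; exact: Cn_pred.
move=> v; apply: CnM => //; last exact: hf.2.
by apply: CnN => //; apply: CnM.
Qed.

Lemma is_diff_expR V (f : V -> R) (df : V -> R) x : is_diff x f df ->
  is_diff x (fun y => expR (f y)) (fun v => expR (f x) * df v).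
Proof.
move=> h; have de : is_diff (f x) expR (fun v : R => v *: expR (f x)).
  have dex : differentiable expR (f x) by apply/derivable1_diffP.
  apply: DiffDef => //; rewrite diff1E // derive1E.
  by apply/funext => v; rewrite derive_val.
by apply: eq_is_diff (is_diff_comp h de) _ _ => // v; rewrite /= mulrC.
Qed.

Lemma Cn_expR V n (A : set V) (f : V -> R) : open A ->
  Cn n A f -> Cn n A (fun x => expR (f x)).
Proof.
move=> oA; elim: n f => [|n IH] f hf.
  move=> x Ax; apply: (@continuous_comp _ _ _ f expR); first exact: hf.
  exact: continuous_expR.
apply: (@Cn_is_diff _ _ _ _ _ (fun x v => expR (f x) * 'd f x v)) => //.
  by move=> x Ax; apply: is_diff_expR; exact: Cn_diff hf Ax.
by move=> v; apply: CnM => //; [apply: IH; exact: Cn_pred | exact: hf.2].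
Qed.

Lemma Cn_linear V W W' n (A : set V) (f : V -> W) (L : W -> W') : open A ->
  linear L -> continuous L -> Cn n A f -> Cn n A (fun x => L (f x)).
Proof.
move=> oA linL cL; elim: n f => [|n IH] f hf.
  by move=> x Ax; apply: (@continuous_comp _ _ _ f L); [exact: hf|exact: cL].
apply: (@Cn_is_diff _ _ _ _ _ (fun x v => L ('d f x v))) => //.
  move=> x Ax; exact: is_diff_comp (Cn_diff hf Ax) (is_diff_linear _ linL cL).
by move=> v; apply: IH; exact: hf.2.
Qed.

Lemma Cn_coord V n k l (A : set V) (f : V -> 'M[R]_(k, l)) i j : open A ->
  Cn n A f -> Cn n A (fun x => f x i j : R).
Proof.
move=> oA; apply: (@Cn_linear V _ _ n A f (fun M => M i j)) => //.
  exact: linear_coord.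
exact: continuous_coord.
Qed.

(** The middle space has coordinates, so the differential of the composite is a
   finite sum of products of functions of class C^n, to which the induction
   hypothesis applies with 'd g (delta_mx 0 j) in the role of g. *)
Lemma Cn_comp V W n m (A : set V) (B : set 'rV[R]_m)
    (f : V -> 'rV[R]_m) (g : 'rV[R]_m -> W) : open A ->
  (forall x, A x -> B (f x)) -> Cn n A f -> Cn n B g ->
  Cn n A (fun x => g (f x)).
Proof.
move=> oA fAB; elim: n f g fAB => [|n IH] f g fAB hf hg.
  by move=> x Ax; apply: (@continuous_comp _ _ _ f g); [exact: hf|exact/hg/fAB].
apply: (@Cn_is_diff _ _ _ _ _ (fun x v =>
   \sum_(j < m) 'd f x v 0 j *: 'd g (f x) (delta_mx 0 j))) => //.
  move=> x Ax; apply: eq_is_diff (is_diff_comp (Cn_diff hf Ax)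
     (Cn_diff hg (fAB x Ax))) _ _ => // v.
  by rewrite /= diff_sum_delta.
move=> v; apply: Cn_sum => // i; apply: CnZ => //.
  by apply: (@Cn_coord _ _ _ _ _ (fun x => 'd f x v)) => //; exact: hf.2.
by apply: (IH f (fun y => 'd g y (delta_mx 0 i))) => //;
  [exact: Cn_pred | exact: hg.2].
Qed.

Lemma open_setI_preimage (T T' : topologicalType) (A : set T) (B : set T')
    (f : T -> T') :
  open A -> open B -> (forall x, A x -> {for x, continuous f}) ->
  open (A `&` f @^-1` B).
Proof.
rewrite !openE => oA oB cf x [Ax Bfx]; apply: filterI; first exact: oA.
by apply: cf => //; exact: oB.
Qed.

End Cn_theory.

Section Smooth_theory.
Context {R : realType}.
Implicit Types V W : normedModType R.

Lemma smooth_sub V W (A B : set V) (f : V -> W) :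
  A `<=` B -> smooth_on B f -> smooth_on A f.
Proof. by move=> AB h n; apply: Cn_sub AB _. Qed.

Lemma smooth_ext V W (A : set V) (f g : V -> W) : open A ->
  (forall x, A x -> f x = g x) -> smooth_on A f -> smooth_on A g.
Proof. by move=> oA fg h n; apply: Cn_ext fg _. Qed.

Lemma smooth_is_diff V W (A : set V) (f : V -> W) x :
  smooth_on A f -> A x -> is_diff x f ('d f x).
Proof. by move=> /(_ 1%N); exact: Cn_diff. Qed.

Lemma smooth_differentiable V W (A : set V) (f : V -> W) x :
  smooth_on A f -> A x -> differentiable f x.
Proof. by move=> /(_ 1%N) [h _] Ax; exact: h. Qed.

Lemma smooth_continuous V W (A : set V) (f : V -> W) x :
  smooth_on A f -> A x -> {for x, continuous f}.
Proof. by move=> /(_ 0%N); apply. Qed.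

Lemma smooth_diff V W (A : set V) (f : V -> W) v :
  smooth_on A f -> smooth_on A (fun x => 'd f x v).
Proof. by move=> h n; exact: (h n.+1).2. Qed.

Lemma smooth_cst V W (A : set V) (w : W) : smooth_on A (cst w).
Proof. move=> n; exact: Cn_cst. Qed.

Lemma smoothD V W (A : set V) (f g : V -> W) : open A ->
  smooth_on A f -> smooth_on A g -> smooth_on A (fun x => f x + g x).
Proof. by move=> oA hf hg n; apply: CnD. Qed.

Lemma smoothB V W (A : set V) (f g : V -> W) : open A ->
  smooth_on A f -> smooth_on A g -> smooth_on A (fun x => f x - g x).
Proof. by move=> oA hf hg n; apply: CnB. Qed.

Lemma smoothN V W (A : set V) (f : V -> W) : open A ->
  smooth_on A f -> smooth_on A (fun x => - f x).
Proof. by move=> oA hf n; apply: CnN. Qed.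

Lemma smoothZ V W (A : set V) (f : V -> R) (g : V -> W) : open A ->
  smooth_on A f -> smooth_on A g -> smooth_on A (fun x => f x *: g x).
Proof. by move=> oA hf hg n; apply: CnZ. Qed.

Lemma smoothM V (A : set V) (f g : V -> R) : open A ->
  smooth_on A f -> smooth_on A g -> smooth_on A (fun x => f x * g x).
Proof. exact: smoothZ. Qed.

Lemma smoothV V (A : set V) (f : V -> R) : open A ->
  (forall x, A x -> f x != 0) -> smooth_on A f ->
  smooth_on A (fun x => (f x)^-1).
Proof. by move=> oA f0 hf n; apply: CnV. Qed.

Lemma smooth_expR V (A : set V) (f : V -> R) : open A ->
  smooth_on A f -> smooth_on A (fun x => expR (f x)).
Proof. by move=> oA hf n; apply: Cn_expR. Qed.

Lemma smooth_coord V k l (A : set V) (f : V -> 'M[R]_(k, l)) i j : open A ->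
  smooth_on A f -> smooth_on A (fun x => f x i j : R).
Proof. by move=> oA hf n; apply: Cn_coord. Qed.

Lemma smooth_comp V W m (A : set V) (B : set 'rV[R]_m)
    (f : V -> 'rV[R]_m) (g : 'rV[R]_m -> W) : open A ->
  (forall x, A x -> B (f x)) -> smooth_on A f -> smooth_on B g ->
  smooth_on A (fun x => g (f x)).
Proof. by move=> oA fAB hf hg n; exact: Cn_comp oA fAB (hf n) (hg n). Qed.

Lemma smooth_linear V W (A : set V) (L : V -> W) :
  linear L -> continuous L -> smooth_on A L.
Proof.
move=> lL cL n; apply: (@Cn_sub _ _ _ _ A setT) => //.
apply: Cn_pred; apply: (@Cn_is_diff _ _ _ _ _ _ (fun x v => L v)) => //.
- exact: openT.
- by move=> x _; exact: is_diff_linear.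
- by move=> v; exact: Cn_cst.
Qed.

Lemma smooth_id V (A : set V) : smooth_on A id.
Proof. by apply: (@smooth_linear V V A (fun x => x)) => // x; exact: cvg_id. Qed.

Lemma smooth_diff_dir W m (A : set 'rV[R]_m) (f : 'rV[R]_m -> W)
    (v : 'rV[R]_m -> 'rV[R]_m) : open A ->
  smooth_on A f -> smooth_on A v -> smooth_on A (fun x => 'd f x (v x)).
Proof.
move=> oA hf hv n.
apply: (@Cn_ext _ _ _ _ _ (fun x => \sum_(j < m) v x 0 j *: 'd f x (delta_mx 0 j))) => //.
  by move=> x _; rewrite -diff_sum_delta.
apply: Cn_sum => // i; apply: CnZ => //; first by apply: Cn_coord.
exact: smooth_diff.
Qed.

Lemma smooth_open_preimage V W (A : set V) (B : set W) (f : V -> W) :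
  open A -> open B -> smooth_on A f -> open (A `&` f @^-1` B).
Proof.
move=> oA oB sf; apply: open_setI_preimage => // x; exact: smooth_continuous.
Qed.

End Smooth_theory.

(** * Mean values and second derivatives *)

Section MeanValue.
Context {R : realType}.
Implicit Types V W : normedModType R.

Lemma is_diff_is_derive V W (f : V -> W) x v L :
  is_diff x f L -> is_derive x v f (L v).
Proof.
move=> h; have dfx : differentiable f x by exact: ex_diff.
apply: DeriveDef; first exact: diff_derivable.
by rewrite deriveE // diff_val.
Qed.

Lemma is_derive_is_diff W (f : R -> W) (t : R) l :
  is_derive t 1 f l -> is_diff t f (fun s => s *: l).
Proof.
move=> h; have df : derivable f t 1 by exact: ex_derive.
apply: DiffDef; first by apply/derivable1_diffP.
by rewrite deriv1E // derive1E; apply/funext => s; rewrite derive_val.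
Qed.

Lemma is_derive_line V W (f : V -> W) x v (t : R) l :
  is_derive (x + t *: v) v f l -> is_derive t 1 (fun r => f (x + r *: v)) l.
Proof.
move=> h.
have E : (fun h : R => h^-1 *: ((((fun r => f (x + r *: v)) \o shift t) (h *: 1)
     - f (x + t *: v)))) =
    (fun h : R => h^-1 *: ((f \o shift (x + t *: v)) (h *: v) - f (x + t *: v))).
  apply/funext => h'; congr (_ *: (f _ - _)).
  by rewrite /= scalerDl [_%:A]mulr1 addrCA.
apply: DeriveDef; first by rewrite /derivable E; exact: ex_derive.
by rewrite /derive E; exact: derive_val.
Qed.

Lemma mean_value_0 (g dg : R -> R) (h : R) :
  (forall t : R, `|t| <= `|h| -> is_derive t 1 g (dg t)) ->
  exists2 t : R, `|t| <= `|h| & g h - g 0 = h * dg t.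
Proof.
move=> H; have cg t : `|t| <= `|h| -> {for t, continuous g}.
  move=> /H Ht; apply: differentiable_continuous; apply/derivable1_diffP.
  exact: ex_derive.
have [h0|h0] := leP 0 h.
  have [|||c] := @MVT_segment R g dg 0 h => //.
  - move=> t; rewrite in_itv /= => /andP[t0 th]; apply: H.
    by rewrite !ger0_norm // ltW.
  - apply: continuous_in_subspaceT => t; rewrite inE /= in_itv /= => /andP[t0 th].
    by apply: cg; rewrite !ger0_norm.
  rewrite in_itv /= => /andP[c0 ch] E; exists c; first by rewrite !ger0_norm.
  by rewrite E subr0 mulrC.
have [|||c] := @MVT_segment R g dg h 0 => //; first exact: ltW.
- move=> t; rewrite in_itv /= => /andP[t0 th]; apply: H.
  by rewrite !ltr0_norm // lerN2 ltW.
- apply: continuous_in_subspaceT => t; rewrite inE /= in_itv /= => /andP[t0 th].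
  by apply: cg; rewrite (ltr0_norm h0) ler0_norm // lerN2.
rewrite in_itv /= => /andP[c0 ch] E; exists c.
  by rewrite (ltr0_norm h0) ler0_norm // lerN2.
by rewrite -opprB E sub0r mulrN opprK mulrC.
Qed.

Lemma mean_value_line V (f : V -> R) x v (df : R -> R) (h : R) :
  (forall t : R, `|t| <= `|h| -> is_derive (x + t *: v) v f (df t)) ->
  exists2 t : R, `|t| <= `|h| & f (x + h *: v) - f x = h * df t.
Proof.
move=> H; have [t th E] := @mean_value_0 (fun r => f (x + r *: v)) df h
  (fun t th => is_derive_line (H t th)).
by exists t => //; rewrite -E scale0r addr0.
Qed.

(** The double difference of f along u and v is, by two mean value steps, the
   value of the mixed second derivative at a nearby point. *)
Lemma second_difference V (A : set V) (f : V -> R) x u v (h : R) : open A ->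
  Cn 2 A f ->
  (forall s t : R, `|s| <= `|h| -> `|t| <= `|h| -> A (x + s *: u + t *: v)) ->
  exists s t : R, [/\ `|s| <= `|h|, `|t| <= `|h| &
    f (x + h *: u + h *: v) - f (x + h *: u) - (f (x + h *: v) - f x) =
    h * (h * 'd (fun y => 'd f y u) (x + s *: u + t *: v) v)].
Proof.
move=> oA cf Axst.
have h0 : `|0 : R| <= `|h| by rewrite normr0.
have A1 s : `|s| <= `|h| -> A (x + s *: u).
  by move=> sh; have := Axst s 0 sh h0; rewrite scale0r addr0.
have A2 s : `|s| <= `|h| -> A (x + h *: v + s *: u).
  by move=> sh; have := Axst s h sh (lexx _); rewrite addrAC.
pose phi y := f (y + h *: v) - f y.
have dphi s : `|s| <= `|h| -> is_derive (x + s *: u) u phi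
   ('d f (x + s *: u + h *: v) u - 'd f (x + s *: u) u).
  move=> sh; have d1 := differentiableP (cf.1 _ (A1 s sh)).
  have d2 : is_diff (x + s *: u + h *: v) f ('d f (x + s *: u + h *: v)).
    by apply: differentiableP; apply: cf.1; rewrite addrAC; exact: A2.
  have d3 : is_diff (x + s *: u) (fun y => y + h *: v) (fun w => w).
    apply: eq_is_diff (is_diffD (is_diff_id _) (is_diff_cst (h *: v) _)) _ _ => //.
    by move=> w; rewrite fctE addr0.
  exact: is_diff_is_derive (is_diffB (is_diff_comp d3 d2) d1).
have [s sh Es] := mean_value_line dphi.
have dg t : `|t| <= `|h| -> is_derive (x + s *: u + t *: v) v (fun y => 'd f y u)
    ('d (fun y => 'd f y u) (x + s *: u + t *: v) v).
  move=> th; apply: is_diff_is_derive; apply: differentiableP.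
  by apply: (cf.2 u).1; exact: Axst.
have [t th Et] := mean_value_line dg.
by exists s, t; split=> //; rewrite -Et -Es /phi addrAC.
Qed.

(** Schwarz: the double difference of second_difference is symmetric in u and v,
   so the two mixed derivatives agree at points arbitrarily close to x, and they
   are continuous. *)
Lemma diff_sym V (A : set V) (f : V -> R) x u v : open A -> Cn 2 A f -> A x ->
  'd (fun y => 'd f y u) x v = 'd (fun y => 'd f y v) x u.
Proof.
move=> oA cf Ax; apply/eqP; rewrite -subr_eq0 -normr_le0.
apply/ler_addgt0Pl => e e0; rewrite addr0.
have cuv w1 w2 : {for x, continuous (fun y => 'd (fun z => 'd f z w1) y w2)}.
  exact: (cf.2 w1).2.
have near_uv w1 w2 : \forall y \near x,
   A y /\ `|'d (fun z => 'd f z w1) x w2 - 'd (fun z => 'd f z w1) y w2| < e / 2.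
  apply: filterI; first exact: open_nbhs_nbhs.
  by have /cvgrPdist_lt /(_ (e / 2)) := cuv w1 w2; apply; rewrite divr_gt0.
have /nbhs_ballP [r /= r0 Hr] : nbhs x (fun y =>
   (A y /\ `|'d (fun z => 'd f z u) x v - 'd (fun z => 'd f z u) y v| < e / 2) /\
   (A y /\ `|'d (fun z => 'd f z v) x u - 'd (fun z => 'd f z v) y u| < e / 2)).
  exact: filterI (near_uv u v) (near_uv v u).
pose h := r / (2 * (`|u| + `|v| + 1)).
have D0 : 0 < 2 * (`|u| + `|v| + 1).
  by rewrite mulr_gt0 // ltr_wpDl // addr_ge0.
have h0 : 0 < h by rewrite divr_gt0.
have B s t : `|s| <= `|h| -> `|t| <= `|h| -> ball x r (x + s *: u + t *: v).
  rewrite (gtr0_norm h0) => sh th; rewrite -ball_normE /= -addrA opprD addNKr.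
  rewrite normrN (le_lt_trans (ler_normD _ _)) // !normrZ.
  apply: (@le_lt_trans _ _ (h * (`|u| + `|v|))).
    by rewrite mulrDr lerD // ler_wpM2r.
  have : h * (2 * (`|u| + `|v| + 1)) = r by rewrite /h divfK // gt_eqF.
  have : 0 <= `|u| by []. have : 0 <= `|v| by []. nra.
have [s [t [sh th E1]]] := second_difference oA cf
  (fun s t hs ht => (Hr _ (B s t hs ht)).1.1).
have B' s' t' : `|s'| <= `|h| -> `|t'| <= `|h| -> A (x + s' *: v + t' *: u).
  by move=> hs ht; have := (Hr _ (B t' s' ht hs)).1.1; rewrite addrAC.
have [s' [t' [sh' th' E2]]] := second_difference oA cf B'.
have E : 'd (fun y => 'd f y u) (x + s *: u + t *: v) v =
         'd (fun y => 'd f y v) (x + s' *: v + t' *: u) u.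
  have hn : h != 0 by rewrite gt_eqF.
  apply: (mulfI hn); apply: (mulfI hn); rewrite -E1 -E2.
  by rewrite [x + h *: v + _]addrAC; ring.
have [[_ b1] _] := Hr _ (B s t sh th).
have [_ [_ b2]] := Hr _ (B t' s' th' sh').
rewrite [x + _ + _]addrAC in b2; rewrite E in b1.
move: b1 b2; set a := 'd _ x v; set b := 'd _ x u; set c := 'd _ _ _.
rewrite !ltr_norml ler_norml => /andP[? ?] /andP[? ?].
by apply/andP; split; lra.
Qed.

End MeanValue.

(** * Closed 1-forms on a square *)

Section RowNorm.
Context {R : realType}.

Lemma norm_coord_le n (v : 'rV[R]_n) j : `|v 0 j| <= `|v|.
Proof.
rewrite [X in _ <= X]mx_normrE.
exact: (le_bigmax_cond 0 (fun ij : 'I_1 * 'I_n => `|v ij.1 ij.2|) (erefl true : xpredT (0, j))).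
Qed.

Lemma norm_row_le n (v : 'rV[R]_n) e : 0 <= e -> (forall j, `|v 0 j| <= e) -> `|v| <= e.
Proof.
move=> e0 H; rewrite [X in X <= _]mx_normrE; apply/bigmax_leP; split=> // [[i j]] _.
by rewrite /= (ord1 i).
Qed.

Lemma norm_row_lt n (v : 'rV[R]_n) e : 0 < e -> (forall j, `|v 0 j| < e) -> `|v| < e.
Proof.
move=> e0 H; rewrite [X in X < _]mx_normrE; apply/bigmax_ltP; split=> // [[i j]] _.
by rewrite /= (ord1 i).
Qed.

End RowNorm.

Section EpsilonDifferential.
Context {R : realType}.

Lemma is_diff_eps (V W : normedModType R) (f : V -> W) x (L : V -> W) :
  linear L -> continuous L ->
  (forall e, 0 < e ->
    \forall h \near (0 : V), `|f (h + x) - (f x + L h)| <= e * `|h|) ->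
  is_diff x f L.
Proof.
move=> linL cL H.
pose LM := GRing.isLinear.Build _ _ _ _ _ linL.
pose LL : {linear V -> W} := HB.pack L LM.
have D : f \o shift x = cst (f x) + LL +o_ 0 id.
  by apply/eqaddoP => e e0; exact: H.
have gE := diff_unique (cL : continuous LL) D.
by apply: DiffDef; [apply/diff_locallyP; rewrite gE | rewrite gE].
Qed.

Lemma is_diff_near (V W : normedModType R) (f : V -> W) x (L : V -> W) e :
  is_diff x f L -> 0 < e ->
  \forall h \near (0 : V), `|f (h + x) - (f x + L h)| <= e * `|h|.
Proof.
move=> [/diff_locallyP [_ D] DE] e0.
by move/eqaddoP : D => /(_ _ e0); apply: filterS => h; rewrite !fctE /= DE.
Qed.

End EpsilonDifferential.

Section Plane.
Context {R : realType}.
Local Notation E := 'rV[R]_2.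

Definition e0 : E := delta_mx 0 0.
Definition e1 : E := delta_mx 0 1.
Definition pt (a b : R) : E := a *: e0 + b *: e1.

Lemma pt0 a b : pt a b 0 0 = a.
Proof. by rewrite !mxE /= mulr1 mulr0 addr0. Qed.

Lemma pt1 a b : pt a b 0 1 = b.
Proof. by rewrite !mxE /= mulr1 mulr0 add0r. Qed.

Lemma ord2_cases (i : 'I_2) : i = 0 \/ i = 1.
Proof. by case: i => [[|[|m]] lt] //; [left|right]; exact: val_inj. Qed.

Lemma row2P (u v : E) : u 0 0 = v 0 0 -> u 0 1 = v 0 1 -> u = v.
Proof.
move=> h0 h1; apply/rowP => i.
by case: (ord2_cases i) => ->.
Qed.

Lemma ptE (v : E) : v = pt (v 0 0) (v 0 1).
Proof. by apply: row2P; rewrite ?pt0 ?pt1. Qed.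

Lemma ball_ptP (x y : E) r : 0 < r ->
  ball x r y <-> `|x 0 0 - y 0 0| < r /\ `|x 0 1 - y 0 1| < r.
Proof.
move=> r0; rewrite -ball_normE /=; split=> [h|[h0 h1]].
  by split; apply: le_lt_trans h; [have := norm_coord_le (x - y) 0
    | have := norm_coord_le (x - y) 1]; rewrite !mxE.
apply: norm_row_lt => // j; rewrite !mxE.
by case: (ord2_cases j) => ->.
Qed.

Lemma diff_pt (W : normedModType R) (f : E -> W) x v :
  'd f x v = v 0 0 *: 'd f x e0 + v 0 1 *: 'd f x e1.
Proof.
rewrite diff_sum_delta big_ord_recl big_ord1.
by have -> : lift ord0 ord0 = 1 :> 'I_2 by exact: val_inj.
Qed.

(** One partial derivative may be merely pointwise when the other one is
   continuous: move first along e0 and then, by the mean value theorem, along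
   e1. *)
Lemma is_diff_partials (f : E -> R) x (b0 : R) (b1 : E -> R) :
  is_derive x e0 f b0 ->
  (\forall y \near x, is_derive y e1 f (b1 y)) ->
  {for x, continuous b1} ->
  is_diff x f (fun v => v 0 0 * b0 + v 0 1 * b1 x).
Proof.
move=> d0 d1 c1.
pose L (v : E) := v 0 0 * b0 + v 0 1 * b1 x.
have linL : linear L.
  by move=> a u v; rewrite /L !mxE /GRing.scale /=; ring.
have cL : continuous L.
  move=> y; apply: (@continuousD _ _ _ (fun v : E => v 0 0 * b0)
    (fun v : E => v 0 1 * b1 x)); apply: continuousM;
    by [exact: continuous_coord | exact: cst_continuous].
apply: is_diff_eps => // e epos.
have e20 : 0 < e / 2 by rewrite divr_gt0.
have H0 : \forall h \near (0:R), `|f (x + h *: e0) - f x - h * b0| <= e / 2 * `|h|.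
  have d0' : is_derive (x + 0 *: e0) e0 f b0 by rewrite scale0r addr0.
  have := is_derive_is_diff (is_derive_line d0') => dd.
  apply: filterS (is_diff_near dd e20) => h.
  by rewrite addr0 scale0r addr0 opprD addrA.
have H1 : \forall y \near x, is_derive y e1 f (b1 y) /\ `|b1 x - b1 y| < e / 2.
  by apply: filterI => //; move/cvgrPdist_lt : c1 => /(_ _ e20).
move/nbhs_ballP : H1 => [r /= r0 Hr].
move/nbhs_ballP : H0 => [r' /= r'0 Hr'].
apply/nbhs_ballP; exists (Num.min r r'); first by rewrite /= lt_min r0.
move=> v; rewrite -ball_normE /= sub0r normrN lt_min => /andP[vr vr'].
have v0 : `|v 0 0| <= `|v| by exact: norm_coord_le.
have v1 : `|v 0 1| <= `|v| by exact: norm_coord_le.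
have B t : `|t| <= `|v 0 1| -> ball x r (x + v 0 0 *: e0 + t *: e1).
  move=> tv; apply/ball_ptP => //; rewrite !mxE /= !mulr0 !mulr1 !addr0.
  by rewrite !opprD !addNKr !normrN; split;
    [exact: le_lt_trans vr | apply: le_lt_trans vr; exact: le_trans v1].
have [t tv Et] := mean_value_line (fun t tv => (Hr _ (B t tv)).1).
have [_ bt] := Hr _ (B t tv).
have ht : `|f (x + v 0 0 *: e0) - f x - v 0 0 * b0| <= e / 2 * `|v 0 0|.
  by apply: Hr'; rewrite -ball_normE /= sub0r normrN (le_lt_trans v0).
have -> : v + x = x + v 0 0 *: e0 + v 0 1 *: e1.
  by rewrite {1}(ptE v) addrC addrA.
have -> : f (x + v 0 0 *: e0 + v 0 1 *: e1) - (f x + L v) =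
  (f (x + v 0 0 *: e0) - f x - v 0 0 * b0) +
  v 0 1 * (b1 (x + v 0 0 *: e0 + t *: e1) - b1 x).
  by rewrite mulrBr -Et /L; ring.
apply: (le_trans (ler_normD _ _)); rewrite normrM.
have P1 : `|v 0 1| * `|b1 (x + v 0 0 *: e0 + t *: e1) - b1 x| <= `|v| * (e / 2).
  by apply: ler_pM => //; rewrite distrC; exact: ltW.
have P2 : e / 2 * `|v 0 0| <= e / 2 * `|v| by rewrite ler_wpM2l // ltW.
lra.
Qed.

End Plane.

Section Poincare.
Context {R : realType}.
Local Notation E := 'rV[R]_2.

Lemma is_derive_of_line (V W : normedModType R) (f : V -> W) x v l :
  is_derive (0 : R) 1 (fun r : R => f (x + r *: v)) l -> is_derive x v f l.
Proof.
move=> h.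
have EE : (fun h : R => h^-1 *: (((fun r : R => f (x + r *: v)) \o shift 0) (h *: 1)
     - f (x + 0 *: v))) =
    (fun h : R => h^-1 *: ((f \o shift x) (h *: v) - f x)).
  apply/funext => h'; congr (_ *: (f _ - f _)); last by rewrite scale0r addr0.
  by rewrite /= addr0 [_%:A]mulr1 addrC.
have [d1 d2] := h; apply: DeriveDef; first by rewrite /derivable -EE.
by rewrite /derive -EE.
Qed.

Lemma is_derive_eps (g : R -> R) (l : R) :
  (forall e, 0 < e -> \forall h \near (0:R), `|g h - g 0 - h * l| <= e * `|h|) ->
  is_derive (0 : R) 1 g l.
Proof.
move=> H; have : is_diff (0:R) g (fun h => h * l).
  apply: is_diff_eps.
  - by move=> a u v; rewrite /GRing.scale /=; ring.
  - by move=> x; apply: continuousM; [exact: cvg_id | exact: cst_continuous].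
  - by move=> e /H; apply: filterS => h; rewrite addr0 opprD addrA.
by move=> D; have := @is_diff_is_derive _ _ _ _ _ (1 : R) _ D; rewrite mul1r.
Qed.

Lemma antiderivative (h : R -> R) (a b : R) :
  (forall t, a <= t <= b -> {for t, continuous h}) ->
  exists H : R -> R, forall t, a < t < b -> is_derive t 1 H (h t).
Proof.
move=> ch.
exists (fun x => \int[lebesgue_measure]_(t in [set` `[a, x]]) (h t))%R => t /andP[at_ tb].
have int : lebesgue_measure.-integrable `[a, b] (EFin \o h).
  apply: continuous_compact_integrable; first exact: segment_compact.
  by apply: continuous_in_subspaceT => x; rewrite inE /= in_itv /=; exact: ch.
have ct : {for t, continuous h} by apply: ch; rewrite !ltW.
have [d1 d2] := continuous_FTC1_closed tb int at_ ct.
by split; [exact: d1 | rewrite -derive1E; exact: d2].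
Qed.

(** The primitive is obtained by integrating along e0 through the centre and
   then along e1; its e0-derivative is found by comparing increments with the
   mean value theorem, closedness turning d b1 / d e0 into d b0 / d e1. *)
Lemma poincare (x0 : E) (r : R) (b0 b1 : E -> R) : 0 < r ->
  smooth_on (ball x0 r) b0 -> smooth_on (ball x0 r) b1 ->
  (forall x, ball x0 r x -> 'd b1 x e0 = 'd b0 x e1) ->
  exists2 f : E -> R, smooth_on (ball x0 (r / 2)) f &
    forall x, ball x0 (r / 2) x -> is_diff x f (fun v => v 0 0 * b0 x + v 0 1 * b1 x).
Proof.
move=> r0 sb0 sb1 closedb.
set c0 := x0 0 0; set c1 := x0 0 1; set d := r / 2.
have d0 : 0 < d by rewrite divr_gt0.
have dr : d < r by rewrite /d; lra.
have inB u t : `|c0 - u| <= d -> `|c1 - t| <= d -> ball x0 r (pt u t).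
  by move=> hu ht; apply/ball_ptP => //; rewrite pt0 pt1; split;
    exact: le_lt_trans dr.
have inBc u : `|c0 - u| <= d -> ball x0 r (pt u c1).
  by move=> hu; apply: inB => //; rewrite subrr normr0 ltW.
have ptS (u t h : R) : pt u t + h *: e1 = pt u (t + h).
  by rewrite /pt -addrA -scalerDl.
have ptS0 (u t h : R) : pt u t + h *: e0 = pt (u + h) t.
  by rewrite /pt addrAC -scalerDl.
have cpt1 u t (b : E -> R) : {for pt u t, continuous b} ->
    {for t, continuous (fun t => b (pt u t))}.
  move=> cb; apply: (@continuous_comp _ _ _ (fun t => pt u t) b) => //.
  apply: (@continuousD _ _ _ (fun t : R => u *: e0) (fun t : R => t *: e1)).
    exact: cst_continuous.
  exact: scalel_continuous.
have cpt0 u t (b : E -> R) : {for pt u t, continuous b} ->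
    {for u, continuous (fun u => b (pt u t))}.
  move=> cb; apply: (@continuous_comp _ _ _ (fun u => pt u t) b) => //.
  apply: (@continuousD _ _ _ (fun u : R => u *: e0) (fun u : R => t *: e1)).
    exact: scalel_continuous.
  exact: cst_continuous.
have near_d (c t : R) : (c - d <= t <= c + d) -> `|c - t| <= d.
  by move=> /andP[? ?]; rewrite ler_norml; apply/andP; split; lra.
have [A dA] : exists A : R -> R, forall u, c0 - d < u < c0 + d ->
    is_derive u 1 A (b0 (pt u c1)).
  apply: (@antiderivative (fun u => b0 (pt u c1))) => t /near_d ht.
  by apply: cpt0; apply: smooth_continuous sb0 _; exact: inBc.
have /choice[B dB] : forall u, exists B : R -> R, `|c0 - u| <= d ->
    forall t, c1 - d < t < c1 + d -> is_derive t 1 B (b1 (pt u t)).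
  move=> u; have [hu|hu] := leP `|c0 - u| d; last first.
    by exists id.
  have [B HB] := @antiderivative (fun t => b1 (pt u t)) (c1 - d) (c1 + d)
    (fun t ht => cpt1 _ _ _ (smooth_continuous sb1 (inB u t hu (near_d _ _ ht)))).
  by exists B.
pose F u t := B u t - B u c1.
pose f (y : E) := A (y 0 0) + F (y 0 0) (y 0 1).
have absP (c t : R) : `|c - t| < d -> c - d < t < c + d.
  by rewrite ltr_norml => /andP[? ?]; apply/andP; split; lra.
have line1 y : ball x0 d y -> is_derive y e1 f (b1 y).
  move=> /(ball_ptP _ _ d0) [y0 y1]; apply: is_derive_of_line.
  have -> : (fun t : R => f (y + t *: e1)) =
      (fun t : R => (A (y 0 0) - B (y 0 0) c1) + B (y 0 0) (y 0 1 + t *: 1)).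
    apply/funext => t; rewrite /f /F !mxE /= mulr0 mulr1 addr0.
    by rewrite [t *: 1]mulr1; ring.
  have D : is_derive (0:R) 1 (fun t : R => B (y 0 0) (y 0 1 + t *: 1)) (b1 y).
    apply: is_derive_line; rewrite scale0r addr0 {3}(ptE y).
    by apply: dB; [exact: ltW | exact: absP].
  have := is_deriveD (is_derive_cst (A (y 0 0) - B (y 0 0) c1) _ _) D.
  by rewrite add0r.
have line0 y : ball x0 d y -> is_derive y e0 f (b0 y).
  move=> /[dup] By /(ball_ptP _ _ d0) [y0 y1]; apply: is_derive_of_line.
  set u := y 0 0 in y0; set t1 := y 0 1 in y1.
  have -> : (fun h : R => f (y + h *: e0)) =
      (fun h : R => A (u + h *: 1) + F (u + h) t1).
    apply/funext => h; rewrite /f /F !mxE /= mulr0 mulr1 addr0.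
    by rewrite [h *: 1]mulr1.
  have DA : is_derive (0:R) 1 (fun h : R => A (u + h *: 1)) (b0 (pt u c1)).
    by apply: is_derive_line; rewrite scale0r addr0; apply: dA; exact: absP.
  suff DF : is_derive (0:R) 1 (fun h : R => F (u + h) t1) (b0 y - b0 (pt u c1)).
    by have := is_deriveD DA DF; rewrite [b0 (pt u c1) + _]addrC subrK.
  apply: is_derive_eps => e epos.
  pose D z := 'd b1 z e0.
  have sD : smooth_on (ball x0 r) D by exact: smooth_diff.
  have ed : 0 < e / d by rewrite divr_gt0.
  (* by compactness of the segment one neighbourhood of u serves all t *)
  have K : compact `[c1 - d, c1 + d] by exact: segment_compact.
  have unif : \forall xi \near u, `[c1 - d, c1 + d] `<=`
      (fun t => `|D (pt xi t) - D (pt u t)| < e / d).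
    pose Pu xi t := `|D (pt xi t) - D (pt u t)| < e / d.
    have := iffLR (compact_near_coveringP _) K R (nbhs u) (fun xi t => Pu xi t)
      (nbhs_filter u).
    apply => t /=.
    rewrite in_itv /= => /near_d ht.
    have cD : {for pt u t, continuous D}.
      by apply: smooth_continuous sD _; apply: inB => //; exact: ltW.
    have : \forall z \near pt u t, `|D (pt u t) - D z| < e / d / 2.
      by move/cvgrPdist_lt : cD; apply; rewrite divr_gt0.
    move=> /nbhs_ballP [s /= s0 Hs].
    exists (ball t s, ball u s).
      by split; apply: nbhsx_ballx.
    move=> [t' xi] /= []; rewrite -!ball_normE /= => ht' hxi.
    have n1 : `|D (pt u t) - D (pt xi t')| < e / d / 2.
      by apply: Hs; apply/ball_ptP => //; rewrite !pt0 !pt1.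
    have n2 : `|D (pt u t) - D (pt u t')| < e / d / 2.
      by apply: Hs; apply/ball_ptP => //; rewrite !pt0 !pt1 subrr normr0.
    move: n1 n2; rewrite /Pu.
    move: (D (pt u t)) (D (pt xi t')) (D (pt u t')) => p q s'.
    rewrite !ltr_norml => /andP[? ?] /andP[? ?].
    by apply/andP; split; lra.
  have nball : \forall h \near (0:R), `|h| < d - `|c0 - u|.
    apply/nbhs_ballP; exists (d - `|c0 - u|); first by rewrite /= subr_gt0.
    by move=> h; rewrite -ball_normE /= sub0r normrN.
  have [s /= s0 Hs] := iffLR (nbhs_ballP _ _) unif.
  have near_s : \forall h \near (0:R), `|h| < s.
    apply/nbhs_ballP; exists s => //.
    by move=> h; rewrite -ball_normE /= sub0r normrN.
  near=> h.
  have hs : `|h| < s by near: h.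
  have hd : `|h| < d - `|c0 - u| by near: h.
  have ud k : `|k| <= `|h| -> `|c0 - (u + k)| <= d.
    move=> kh; rewrite opprD addrA; apply: (le_trans (ler_normB _ _)).
    by have := le_lt_trans kh hd; lra.
  pose phi t := F (u + h) t - F u t - h * (b0 (pt u t) - b0 (pt u c1)).
  have dphi (t : R) : c1 - d < t < c1 + d -> is_derive t 1 phi
     (b1 (pt (u + h) t) - b1 (pt u t) - h * 'd b0 (pt u t) e1).
    move=> ht.
    have p1 := dB (u + h) (ud h (lexx _)) t ht.
    have p2 := dB u (ltW y0) t ht.
    have htd : `|c1 - t| <= d by apply: near_d; move: ht => /andP[? ?]; rewrite !ltW.
    have p3 : is_derive t 1 (fun t : R => b0 (pt u t)) ('d b0 (pt u t) e1).
      have -> : (fun t : R => b0 (pt u t)) = (fun t : R => b0 (pt u 0 + t *: e1)).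
        by apply/funext => t'; rewrite ptS add0r.
      apply: is_derive_line; rewrite ptS add0r; apply: is_diff_is_derive.
      by apply: smooth_is_diff sb0 _; apply: inB => //; exact: ltW.
    have q1 := is_deriveB (is_deriveB p1 (is_derive_cst (B (u + h) c1) t 1))
                          (is_deriveB p2 (is_derive_cst (B u c1) t 1)).
    have q2 := is_deriveZ h (is_deriveB p3 (is_derive_cst (b0 (pt u c1)) t 1)).
    by have := is_deriveB q1 q2; rewrite !subr0.
  have dphi' (k : R) : `|k| <= `|t1 - c1| -> is_derive (c1 + k *: 1) 1 phi
     ((fun k => b1 (pt (u + h) (c1 + k)) - b1 (pt u (c1 + k))
       - h * 'd b0 (pt u (c1 + k)) e1) k).
    move=> hk; rewrite [k *: 1]mulr1; apply: dphi; apply: absP.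
    by rewrite opprD addNKr normrN (le_lt_trans hk) // distrC.
  have [k hk Ek] := mean_value_line dphi'.
  have hk' : `|c1 - (c1 + k)| <= d.
    by rewrite opprD addNKr normrN (le_trans hk) // distrC ltW.
  have phi0 : phi c1 = 0 by rewrite /phi /F !subrr mulr0 !subr0.
  have phi1 : phi t1 = F (u + h) t1 - F u t1 - h * (b0 y - b0 (pt u c1)).
    by rewrite /phi -(ptE y).
  rewrite phi0 subr0 [(t1 - c1) *: 1]mulr1 [c1 + (t1 - c1)]addrC subrK phi1 in Ek.
  rewrite addr0 Ek.
  have db1 (v : R) : `|v| <= `|h| -> is_derive (pt u (c1 + k) + v *: e0) e0 b1
      ((fun v => D (pt (u + v) (c1 + k))) v).
    move=> hv; rewrite ptS0; apply: is_diff_is_derive; apply: smooth_is_diff sb1 _.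
    by apply: inB => //; exact: ud.
  have [v hv Ev] := mean_value_line db1.
  rewrite ptS0 in Ev; rewrite Ev -closedb; last by apply: inB => //; exact: ltW.
  rewrite -mulrBr !normrM.
  have Hv : `|D (pt (u + v) (c1 + k)) - D (pt u (c1 + k))| < e / d.
    apply: Hs; first by rewrite -ball_normE /= opprD addNKr normrN (le_lt_trans hv).
    rewrite /= in_itv /=; move: hk'; rewrite ler_norml => /andP[? ?].
    by apply/andP; split; lra.
  have le1 : `|h| * `|D (pt (u + v) (c1 + k)) - D (pt u (c1 + k))| <= `|h| * (e / d).
    by rewrite ler_wpM2l // ltW.
  apply: (@le_trans _ _ (d * (`|h| * (e / d)))).
    apply: ler_pM => //; by rewrite distrC ltW.
  by rewrite mulrCA [d * _]mulrC divfK ?gt_eqF // mulrC.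
have df y : ball x0 d y -> is_diff y f (fun v => v 0 0 * b0 y + v 0 1 * b1 y).
  move=> By; apply: is_diff_partials.
  - exact: line0.
  - apply: filterS line1 _; apply: open_nbhs_nbhs; split=> //; exact: ball_open.
  - apply: smooth_continuous sb1 _; exact: le_ball (ltW dr) _ By.
exists f => // n; have oB : open (ball x0 d) by exact: ball_open.
have sub : ball x0 d `<=` ball x0 r by exact: le_ball (ltW dr).
have cdf (v : E) : Cn n (ball x0 d) (fun y : E => v 0 0 * b0 y + v 0 1 * b1 y : R).
  by apply: CnD => //; apply: CnM => //; try exact: Cn_cst; apply: Cn_sub sub _;
    [exact: sb0 | exact: sb1].
apply: Cn_pred; exact: (@Cn_is_diff R E R n (ball x0 d) f
  (fun y v : E => v 0 0 * b0 y + v 0 1 * b1 y : R) oB df cdf).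
Unshelve. all: by end_near. Qed.

End Poincare.

(** * Local inversion *)

Section Inversion.
Context {R : realType}.
Local Notation E := 'rV[R]_2.

Lemma fixed_point_ball (f : E -> E) (x0 : E) (rho : R) : 0 < rho ->
  (forall x, `|x - x0| <= rho -> `|f x - x0| <= rho) ->
  (forall x y, `|x - x0| <= rho -> `|y - x0| <= rho ->
     `|f x - f y| <= 1 / 2 * `|x - y|) ->
  exists2 x, `|x - x0| <= rho & x = f x.
Proof.
move=> rho0 fC fL.
pose C : set E := closed_ball x0 rho.
have CE x : C x <-> `|x - x0| <= rho.
  by rewrite /C closed_ballE // /closed_ball_ /= distrC.
have fU : set_fun C C f by move=> x /CE h; apply/CE; exact: fC.
pose F : {fun C >-> C} := HB.pack f (isFun.Build _ _ C C f fU).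
pose X : completeNormedModType R := HB.pack E (NormedModule.on E) (Complete.on E).
have half0 : 0 <= 1 / 2 :> R by lra.
have ctr : @is_contraction R X X C C F.
  exists (NngNum half0); split; first by rewrite /=; lra.
  by move=> [x y] [/CE hx /CE hy]; exact: fL.
have Cx0 : C !=set0 by exists x0; apply/CE; rewrite subrr normr0 ltW.
have clC : closed C by exact: closed_ball_closed.
have [p /CE Cp Ep] := @banach_fixed_point R X C F ctr clC Cx0.
by exists p.
Qed.

(** The linear map with columns u and w: the inverse of a differential is known
   through the two vectors that it sends e0 and e1 to. *)
Definition comb (u w v : E) : E := v 0 0 *: u + v 0 1 *: w.

Lemma comb_pt u w a b : comb u w (pt a b) = a *: u + b *: w.
Proof. by rewrite /comb pt0 pt1. Qed.

Lemma comb_linear u w : linear (comb u w).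
Proof.
move=> a x y; rewrite /comb !mxE !scalerDl !scalerDr !scalerA.
by rewrite addrACA.
Qed.

Lemma comb_le u w v : `|comb u w v| <= (`|u| + `|w|) * `|v|.
Proof.
rewrite (le_trans (ler_normD _ _)) // !normrZ mulrDl.
by rewrite lerD // mulrC ler_wpM2l // norm_coord_le.
Qed.

Lemma comb_continuous u w : continuous (comb u w).
Proof.
move=> v; apply: (@continuousD _ _ _ (fun v : E => v 0 0 *: u)
  (fun v : E => v 0 1 *: w)); apply: continuousZ;
  by [exact: continuous_coord | exact: cst_continuous].
Qed.

Lemma comb_inverse (f : {linear E -> E}) u w : f u = e0 -> f w = e1 ->
  (forall v, f (comb u w v) = v) /\ (forall v, comb u w (f v) = v).
Proof.
move=> fu fw.
have r v : f (comb u w v) = v.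
  by rewrite linearD !linearZ /= fu fw; exact/esym/ptE.
split=> // v.
pose LM := GRing.isLinear.Build _ _ _ _ _ (comb_linear u w).
pose LL : {linear E -> E} := HB.pack (comb u w) LM.
have N1 : lin1_mx LL *m lin1_mx f = 1%:M.
  apply/row_matrixP => i.
  by rewrite rowE mulmxA !mul_rV_lin1 /= r row1.
have := mulmx1C N1 => N2.
by rewrite -[LHS]/(LL (f v)) -(mul_rV_lin1 LL) -(mul_rV_lin1 f) -mulmxA N2 mulmx1.
Qed.

(** Newton's map x |-> x - L (G x), with L inverse to the differential of G at
   x0, is a contraction near x0; its fixed points after translation are the
   preimages under G.  The fields T0 and T1 give the inverse differential
   everywhere, so smoothness of the inverse propagates by induction. *)
Lemma local_inverse (Om : set E) (G T0 T1 : E -> E) (x0 : E) : open Om ->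
  Om x0 -> smooth_on Om G -> smooth_on Om T0 -> smooth_on Om T1 ->
  (forall x, Om x -> 'd G x (T0 x) = e0 /\ 'd G x (T1 x) = e1) ->
  exists (B : set E) (r : R) (Psi : E -> E),
    [/\ [/\ 0 < r, open B, B x0 & B `<=` Om],
        forall x, B x -> ball (G x0) r (G x) /\ Psi (G x) = x,
        forall y, ball (G x0) r y -> B (Psi y) /\ G (Psi y) = y,
        smooth_on (ball (G x0) r) Psi &
        forall y, ball (G x0) r y ->
          is_diff y Psi (comb (T0 (Psi y)) (T1 (Psi y)))].
Proof.
move=> oOm Omx0 sG sT0 sT1 GT.
pose L := comb (T0 x0) (T1 x0).
have linL : linear L by exact: comb_linear.
have cL : continuous L by exact: comb_continuous.
have LD (u v : E) : L (u - v) = L u - L v.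
  by rewrite /L /comb !mxE !scalerDl !scaleNr addrACA opprD.
pose k := `|T0 x0| + `|T1 x0| + 1.
have k0 : 0 < k by rewrite /k ltr_wpDl // addr_ge0.
have Lk v : `|L v| <= k * `|v|.
  by rewrite (le_trans (comb_le _ _ _)) // ler_wpM2r // /k lerDl.
have [GL LG] := comb_inverse (GT _ Omx0).1 (GT _ Omx0).2.
pose h x := x - L (G x).
have dG x : Om x -> is_diff x G ('d G x) by exact: smooth_is_diff.
pose dh x v : E := v - L ('d G x v).
have dhE x : Om x -> is_diff x h (dh x).
  move=> Omx; apply: eq_is_diff (is_diffB (is_diff_id x)
    (is_diff_comp (dG x Omx) (is_diff_linear _ linL cL))) _ _ => //.
have dhC j i : {for x0, continuous (fun x => dh x (delta_mx 0 i) 0 j)}.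
  have sdh : smooth_on Om (fun x => dh x (delta_mx 0 i)).
    apply: smoothB => //; first exact: smooth_cst.
    move=> n; apply: Cn_linear => //; exact: (smooth_diff _ sG).
  apply: (@smooth_continuous _ _ _ Om (fun x => dh x (delta_mx 0 i) 0 j)) => //.
  by move=> n; apply: Cn_coord => //; exact: sdh.
have dh0 v : dh x0 v = 0 by rewrite /dh /L LG subrr.
(* each of the two columns contributes a quarter, so h halves distances *)
have near_dh : \forall x \near x0, Om x /\
   (forall j i : 'I_2, `|dh x (delta_mx 0 i) 0 j| < 1 / 4).
  apply: filterI; first exact: open_nbhs_nbhs.
  have q0 : 0 < 1 / 4 :> R by lra.
  have H j i : \forall x \near x0, `|dh x (delta_mx 0 i) 0 j| < 1 / 4.
    move/cvgrPdist_lt : (dhC j i) => /(_ _ q0); apply: filterS => x.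
    by rewrite dh0 mxE sub0r normrN.
  apply: filterS (filterI (filterI (H 0 0) (H 0 1)) (filterI (H 1 0) (H 1 1))).
  move=> x [[h00 h01] [h10 h11]] j i.
  by case: (ord2_cases j) => ->; case: (ord2_cases i) => ->.
have [r1 /= r10 Hr1] := iffLR (nbhs_ballP _ _) near_dh.
pose r2 := r1 / 3.
have r20 : 0 < r2 by rewrite divr_gt0.
have r2E : r1 = r2 + r2 + r2 by rewrite /r2; lra.
have ballE x r : ball x0 r x <-> `|x - x0| < r.
  by rewrite -ball_normE /= distrC.
have hlip x y : `|x - x0| < r2 -> `|y - x0| < r2 -> `|h x - h y| <= 1 / 2 * `|x - y|.
  move=> Bx By; apply: norm_row_le; first by rewrite mulr_ge0 //; lra.
  move=> j.
  have xy : `|x - y| <= r2 + r2.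
    have -> : x - y = (x - x0) - (y - x0) by rewrite opprB addrA subrK.
    by rewrite (le_trans (ler_normB _ _)) // lerD // ltW.
  have seg (t : R) : `|t| <= `|1 : R| -> ball x0 r1 (y + t *: (x - y)).
    rewrite normr1 => t1; apply/ballE; rewrite addrAC r2E.
    rewrite (le_lt_trans (ler_normD _ _)) // normrZ.
    have : `|t| * `|x - y| <= `|x - y| by rewrite ler_piMl.
    lra.
  have dseg (t : R) : `|t| <= `|1 : R| -> is_derive (y + t *: (x - y)) (x - y)
      (fun z => h z 0 j) (dh (y + t *: (x - y)) (x - y) 0 j).
    move=> /seg /Hr1 [Omt _].
    have D := is_diff_comp (dhE _ Omt)
      (is_diff_linear _ (@linear_coord R 1 2 0 j) (@continuous_coord R 1 2 0 j)).
    exact: is_diff_is_derive D.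
  have [t t1 Et] := mean_value_line dseg.
  have E1 : y + 1 *: (x - y) = x by rewrite scale1r addrC subrK.
  have -> : (h x - h y) 0 j = h x 0 j - h y 0 j by rewrite mxE [in X in _ + X]mxE.
  rewrite E1 mul1r in Et; rewrite Et; have [Omt Ht] := Hr1 _ (seg t t1).
  move: (y + t *: (x - y)) Omt Ht => z Omz Hz.
  have -> : dh z (x - y) = (x - y) 0 0 *: dh z e0 + (x - y) 0 1 *: dh z e1.
    have [_ <-] := dhE z Omz; exact: diff_pt.
  rewrite mxE [X in X + _]mxE [X in _ + X]mxE.
  rewrite (le_trans (ler_normD _ _)) // !normrM.
  have b0 : `|(x - y) 0 0| * `|dh z e0 0 j| <= `|x - y| * (1 / 4).
    by apply: ler_pM => //; [exact: norm_coord_le | exact: ltW (Hz j 0)].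
  have b1 : `|(x - y) 0 1| * `|dh z e1 0 j| <= `|x - y| * (1 / 4).
    by apply: ler_pM => //; [exact: norm_coord_le | exact: ltW (Hz j 1)].
  by lra.
have GE x y : x - y = (h x - h y) + L (G x - G y).
  rewrite /h LD; move: (L (G x)) (L (G y)) => a b.
  by apply/rowP => i; rewrite !mxE; ring.
have Glip x y : `|x - x0| < r2 -> `|y - x0| < r2 -> `|x - y| <= 2 * k * `|G x - G y|.
  move=> Bx By; have := hlip x y Bx By.
  have : `|x - y| <= `|h x - h y| + k * `|G x - G y|.
    by rewrite {1}(GE x y) (le_trans (ler_normD _ _)) // lerD2l.
  by lra.
pose rho := r2 / 2.
have rho0 : 0 < rho by rewrite divr_gt0.
have rhor : rho < r2 by rewrite /rho; lra.
(* L stretches by at most k and h halves distances, so for y within r of G x0 the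
   map x |-> h x + L y sends the closed ball of radius rho to itself *)
pose r := rho / (4 * k).
have rr0 : 0 < r by rewrite divr_gt0 // mulr_gt0.
have kr : k * r = rho / 4.
  by rewrite /r; field; rewrite gt_eqF.
have surj y : ball (G x0) r y -> exists x, `|x - x0| < r2 /\ G x = y.
  move=> By.
  have Ly : `|L y - L (G x0)| <= rho / 4.
    rewrite -LD (le_trans (Lk _)) // -kr ler_wpM2l ?ltW //.
    by move: By; rewrite -ball_normE /= distrC.
  have in2 x : `|x - x0| <= rho -> `|x - x0| < r2 by move=> hx; exact: le_lt_trans rhor.
  have x0in : `|x0 - x0| <= rho by rewrite subrr normr0 ltW.
  have fC x : `|x - x0| <= rho -> `|h x + L y - x0| <= rho.
    move=> hx; have -> : h x + L y - x0 = (h x - h x0) + (L y - L (G x0)).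
      rewrite /h; move: (L (G x)) (L (G x0)) (L y) => a b c.
      by apply/rowP => i; rewrite !mxE; ring.
    rewrite (le_trans (ler_normD _ _)) //.
    have := hlip x x0 (in2 _ hx) (in2 _ x0in); lra.
  have fL x z : `|x - x0| <= rho -> `|z - x0| <= rho ->
      `|h x + L y - (h z + L y)| <= 1 / 2 * `|x - z|.
    move=> hx hz; rewrite opprD addrACA subrr addr0.
    exact: hlip (in2 _ hx) (in2 _ hz).
  have [x hx Ex] := fixed_point_ball rho0 fC fL.
  exists x; split; first exact: in2.
  have : L (G x) = L y.
    move: Ex; rewrite /h; move: (L (G x)) (L y) => a b /rowP Eab.
    by apply/rowP => i; move: (Eab i); rewrite !mxE; lra.
  by move/(congr1 ('d G x0)); rewrite !GL.
have /choice[Psi HPsi] : forall y, exists x, ball (G x0) r y ->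
    `|x - x0| < r2 /\ G x = y.
  move=> y; have [By|nBy] := pselect (ball (G x0) r y); last by exists x0.
  by have [x Hx] := surj y By; exists x.
have oball := @ball_open R E.
have inOm x : `|x - x0| < r2 -> Om x.
  by move=> hx; apply: (Hr1 x _).1; apply/ballE; rewrite r2E; lra.
pose B := ball x0 r2 `&` G @^-1` ball (G x0) r.
have PsiB y : ball (G x0) r y -> B (Psi y) /\ G (Psi y) = y.
  move=> By; have [h1 h2] := HPsi y By; split=> //; split; first exact/ballE.
  by rewrite /= h2.
have sub2 : ball x0 r2 `<=` Om by move=> x /ballE /inOm.
have dPsi y : ball (G x0) r y -> is_diff y Psi (comb (T0 (Psi y)) (T1 (Psi y))).
  move=> By; have [Px Ex] := HPsi y By; set x := Psi y in Px Ex *.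
  have Omx := inOm _ Px.
  have [GL' LG'] := comb_inverse (GT _ Omx).1 (GT _ Omx).2.
  set Lx := comb (T0 x) (T1 x) in GL' LG' *.
  have linLx : linear Lx by exact: comb_linear.
  have LxD (u v : E) : Lx (u - v) = Lx u - Lx v.
    by rewrite /Lx /comb !mxE !scalerDl !scaleNr addrACA opprD.
  apply: is_diff_eps => //; first exact: comb_continuous.
  move=> e e0.
  pose kx := `|T0 x| + `|T1 x| + 1.
  have kx0 : 0 < kx by rewrite /kx ltr_wpDl // addr_ge0.
  have Lxk v : `|Lx v| <= kx * `|v|.
    by rewrite (le_trans (comb_le _ _ _)) // ler_wpM2r // /kx lerDl.
  pose e' := e / (kx * (2 * k)).
  have e'0 : 0 < e' by rewrite divr_gt0 // !mulr_gt0.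
  have [s /= s0 Hs] := iffLR (nbhs_ballP _ _) (is_diff_near (dG x Omx) e'0).
  have near_y : \forall v \near (0 : E), ball (G x0) r (v + y) /\ `|v| < s / (2 * k).
    apply: filterI; last first.
      apply/nbhs_ballP; exists (s / (2 * k)); first by rewrite /= divr_gt0 // mulr_gt0.
      by move=> v; rewrite -ball_normE /= sub0r normrN.
    have : \forall z \near y, ball (G x0) r z by exact: open_nbhs_nbhs.
    by rewrite (near_shift (0:E) y) /= subr0.
  apply: filterS near_y => v [Bv vs].
  have [Px' Ex'] := HPsi _ Bv; set x' := Psi (v + y) in Px' Ex' *.
  have lv : `|x' - x| <= 2 * k * `|v|.
    by have := Glip x' x Px' Px; rewrite Ex Ex' addrK.
  have k20 : 0 < 2 * k by rewrite mulr_gt0.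
  have := Hs (x' - x); rewrite -ball_normE /= sub0r normrN subrK Ex' Ex.
  have -> : `|x' - x| < s.
    by rewrite (le_lt_trans lv) // mulrC -ltr_pdivlMr.
  move=> /(_ isT) Hl.
  have -> : x' - (x + Lx v) = - Lx (v + y - (y + 'd G x (x' - x))).
    have -> : v + y - (y + 'd G x (x' - x)) = v - 'd G x (x' - x).
      move: ('d G x _) => w; by apply/rowP => i; rewrite !mxE; ring.
    rewrite LxD LG'; move: (Lx v) => a.
    by apply/rowP => i; rewrite !mxE; ring.
  rewrite normrN (le_trans (Lxk _)) //.
  apply: (@le_trans _ _ (kx * (e' * (2 * k * `|v|)))).
    apply: ler_wpM2l; first exact: ltW.
    by apply: (le_trans Hl); apply: ler_wpM2l => //; exact: ltW.
  rewrite le_eqVlt; apply/orP; left; apply/eqP.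
  by rewrite /e'; field; rewrite !gt_eqF.
exists B, r, Psi; split=> //.
- split=> //.
  + apply: smooth_open_preimage => //; exact: smooth_sub sub2 _.
  + by split; [exact: ballxx | exact: ballxx].
  + by move=> x [/sub2].
- move=> x [/ballE Bx BGx]; split=> //; have [h1 h2] := HPsi _ BGx.
  by apply/eqP; rewrite -subr_eq0 -normr_le0 (le_trans (Glip _ _ h1 Bx)) // h2
    subrr normr0 mulr0.
- elim=> [|n IH].
    by move=> y By; apply: differentiable_continuous; have := dPsi y By => ?;
      exact: ex_diff.
  apply: (@Cn_is_diff _ _ _ _ _ _ (fun y => comb (T0 (Psi y)) (T1 (Psi y)))) => //.
  have inP y : ball (G x0) r y -> Om (Psi y) by move=> By; exact: inOm (HPsi y By).1.
  move=> v; apply: CnD => //; apply: CnZ => //; try exact: Cn_cst.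
  + by apply: Cn_comp inP IH _ => //; exact: sT0.
  + by apply: Cn_comp inP IH _ => //; exact: sT1.
Qed.

End Inversion.

(** * Tensors in charts *)

(* This keeps unification from unfolding differentials. *)
Local Opaque derive.diff.

Section Charts.
Context {R : realType} {M : topologicalType} (S : smooth_surface R M).
Local Notation E := 'rV[R]_2.
Implicit Types (U V : set M) (f g : M -> R) (p q : M) (c : chart S).

(** tr is the change of charts and img c U the part of U seen in the chart c.
   Tangent vectors at p live in the preferred chart of p, which changes with p;
   the lemmas of this part move statements to one fixed chart, where calculus in
   the plane applies. *)
Definition tr c c' : E -> E := coord c' \o param c.
Definition img c U : set E := coord c @` (U `&` dom c).

Lemma imgP c U x : img c U x <->
  [/\ U (param c x), dom c (param c x) & coord c (param c x) = x].
Proof.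
split=> [[p [Up cp] <-]|[h1 h2 h3]]; first by rewrite coordK.
by exists (param c x).
Qed.

Lemma img_coord c U p : U p -> dom c p -> img c U (coord c p).
Proof. by move=> Up cp; exists p. Qed.

Lemma img_sub c U V : U `<=` V -> img c U `<=` img c V.
Proof. by move=> UV x [p [Up cp] <-]; exists p => //; split=> //; exact: UV. Qed.

Lemma open_img c U : open U -> open (img c U).
Proof.
move=> oU; have -> : img c U = coord c @` dom c `&` param c @^-1` U.
  apply/seteqP; split=> x.
    by move=> /imgP [h1 h2 h3]; split=> //; exists (param c x).
  by move=> [[p cp <-]]; rewrite /= coordK // => Up; exact: img_coord.
apply: open_setI_preimage => //; first exact: open_coord.
by move=> x; exact: param_continuous.
Qed.

Lemma img_continuous c U x : img c U x -> {for x, continuous (param c)}.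
Proof.
move=> /imgP [_ h2 h3]; apply: param_continuous.
by exists (param c x).
Qed.

Lemma tr_smooth c c' : smooth_on (img c (dom c')) (tr c c').
Proof. by rewrite /img setIC; exact: transition_smooth. Qed.

Lemma tr_is_diff c c' x : img c (dom c') x -> is_diff x (tr c c') ('d (tr c c') x).
Proof. by apply: smooth_is_diff; exact: tr_smooth. Qed.

Lemma param_tr c c' x : img c (dom c') x -> param c' (tr c c' x) = param c x.
Proof. by move=> /imgP [h1 h2 h3]; rewrite /tr /= coordK. Qed.

Lemma tr_comp c c' c'' x : img c (dom c') x -> tr c' c'' (tr c c' x) = tr c c'' x.
Proof. by move=> h; rewrite {1}/tr /= param_tr. Qed.

Lemma tr_diff_comp c c' c'' x v : img c (dom c') x -> img c (dom c'') x ->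
  'd (tr c' c'') (tr c c' x) ('d (tr c c') x v) = 'd (tr c c'') x v.
Proof.
move=> h1 h2; have [a1 a2 a3] := iffLR (imgP _ _ _) h1.
have [b1 _ _] := iffLR (imgP _ _ _) h2.
have h3 : img c' (dom c'') (tr c c' x) by exact: img_coord.
have D := is_diff_comp (tr_is_diff h1) (tr_is_diff h3).
have near_x : \forall y \near x, (tr c' c'' \o tr c c') y = tr c c'' y.
  have : \forall y \near x, img c (dom c') y.
    by apply: open_nbhs_nbhs; split=> //; apply: open_img; exact: open_dom.
  by apply: filterS => y; exact: tr_comp.
have [_ HE] := near_eq_is_diff near_x D.
exact: esym (congr1 (fun L : E -> E => L v) HE).
Qed.

Lemma tr_diff_id c x v : img c setT x -> 'd (tr c c) x v = v.
Proof.
move=> h.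
have near_x : \forall y \near x, id y = tr c c y.
  have : \forall y \near x, img c setT y.
    by apply: open_nbhs_nbhs; split=> //; apply: open_img; exact: openT.
  by apply: filterS => y /imgP [_ _ h3]; rewrite /tr /= h3.
have [_ HE] := near_eq_is_diff near_x (is_diff_id x).
have := congr1 (fun L : E -> E => L v) HE; exact.
Qed.

Lemma img_dom c c' x : img c (dom c') x -> img c setT x.
Proof. exact: img_sub. Qed.

Lemma tr_diffK c c' x v : img c (dom c') x ->
  'd (tr c' c) (tr c c' x) ('d (tr c c') x v) = v.
Proof.
move=> h; rewrite tr_diff_comp //; first by rewrite tr_diff_id //; exact: img_dom h.
by apply/imgP; have [_ h2 h3] := iffLR (imgP _ _ _) h.
Qed.

Lemma img_at p c : dom c p -> img c (dom (chart_at S p)) (coord c p).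
Proof. by move=> cp; apply: img_coord => //; exact: dom_chart_at. Qed.

Lemma at_img p c : dom c p -> img (chart_at S p) (dom c) (at_coord S p).
Proof. by move=> cp; apply: img_coord => //; exact: dom_chart_at. Qed.

Lemma tr_at p c : tr (chart_at S p) c (at_coord S p) = coord c p.
Proof. by rewrite /tr /at_coord /= coordK //; exact: dom_chart_at. Qed.

Lemma vf_repE c (X : vector_field S) p : dom c p ->
  vf_rep c X (coord c p) = 'd (tr (chart_at S p) c) (at_coord S p) (X p).
Proof. by move=> cp; rewrite /vf_rep coordK. Qed.

Lemma vf_rep_at (X : vector_field S) p : vf_rep (chart_at S p) X (at_coord S p) = X p.
Proof.
rewrite vf_repE ?tr_diff_id //; last exact: dom_chart_at.
by apply: img_coord => //; exact: dom_chart_at.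
Qed.

Lemma vf_rep_tr c c' (X : vector_field S) p : dom c p -> dom c' p ->
  'd (tr c c') (coord c p) (vf_rep c X (coord c p)) = vf_rep c' X (coord c' p).
Proof.
move=> cp c'p; rewrite (vf_repE X cp) (vf_repE X c'p).
by have := tr_diff_comp (X p) (at_img cp) (at_img c'p); rewrite tr_at.
Qed.

Lemma vf_repK c (X : vector_field S) p : dom c p ->
  'd (tr c (chart_at S p)) (coord c p) (vf_rep c X (coord c p)) = X p.
Proof.
move=> cp; rewrite (vf_rep_tr X cp (dom_chart_at S p)).
exact: vf_rep_at.
Qed.

Lemma pairingE (w : 'cV[R]_2) (v : E) : pairing w v = v 0 0 * w 0 0 + v 0 1 * w 1 0.
Proof.
rewrite /pairing mxE big_ord_recl big_ord1.
by have -> : lift ord0 ord0 = 1 :> 'I_2 by exact: val_inj.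
Qed.

Lemma pairing_comb (w : 'cV[R]_2) a b u v :
  pairing w (a *: u + b *: v) = a * pairing w u + b * pairing w v.
Proof. by rewrite !pairingE !mxE; ring. Qed.

Lemma pairing_combl (w t : 'cV[R]_2) a b u :
  pairing (a *: w + b *: t) u = a * pairing w u + b * pairing t u.
Proof. by rewrite !pairingE !mxE; ring. Qed.

Lemma pairingZl (w : 'cV[R]_2) a u : pairing (a *: w) u = a * pairing w u.
Proof. by rewrite !pairingE !mxE; ring. Qed.

Lemma pairingD (w t : 'cV[R]_2) u : pairing (w + t) u = pairing w u + pairing t u.
Proof. by rewrite !pairingE !mxE; ring. Qed.

Lemma pairingN (w : 'cV[R]_2) u : pairing (- w) u = - pairing w u.
Proof. by rewrite !pairingE !mxE; ring. Qed.

Lemma pairingB (w : 'cV[R]_2) u v : pairing w (u - v) = pairing w u - pairing w v.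
Proof. by rewrite !pairingE !mxE; ring. Qed.

Lemma form_rep_pairing c (w : one_form S) p u : dom c p ->
  pairing (form_rep c w (coord c p)) u =
  pairing (w p) ('d (tr c (chart_at S p)) (coord c p) u).
Proof.
move=> cp; rewrite [in RHS](diff_pt _ _ u) pairing_comb pairingE !mxE.
by rewrite coordK.
Qed.

Lemma form_rep_at (w : one_form S) p u :
  pairing (form_rep (chart_at S p) w (at_coord S p)) u = pairing (w p) u.
Proof.
have cp := dom_chart_at S p.
apply: (etrans (form_rep_pairing w u cp)); congr (pairing _ _).
by apply: tr_diff_id; exact: img_coord.
Qed.

Lemma form_vf_rep c (w : one_form S) (X : vector_field S) p : dom c p ->
  pairing (form_rep c w (coord c p)) (vf_rep c X (coord c p)) = pairing (w p) (X p).
Proof. by move=> cp; rewrite form_rep_pairing // vf_repK. Qed.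

Lemma dfun_pairing f p v :
  pairing (dfun S f p) v = 'd (f \o param (chart_at S p)) (at_coord S p) v.
Proof. by rewrite [RHS]diff_pt pairingE !mxE. Qed.

(** The derivation defined in the preferred chart of each point is, by the chain
   rule for the change of charts, the derivative along vf_rep in any chart. *)
Lemma der_rep U c (X : vector_field S) f p : open U -> smooth_fun S U f -> U p ->
  dom c p ->
  der X f p = 'd (f \o param c) (coord c p) (vf_rep c X (coord c p)).
Proof.
move=> oU sf Up cp; rewrite /der dfun_pairing vf_repE //.
have h1 := at_img cp.
have D1 := tr_is_diff h1.
have D2 : is_diff (tr (chart_at S p) c (at_coord S p)) (f \o param c)
   ('d (f \o param c) (coord c p)).
  by rewrite tr_at; apply: smooth_is_diff (sf c) _; exact: img_coord.
have near_p : \forall y \near at_coord S p,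
  ((f \o param c) \o tr (chart_at S p) c) y = (f \o param (chart_at S p)) y.
  have : \forall y \near at_coord S p, img (chart_at S p) (dom c) y.
    by apply: open_nbhs_nbhs; split=> //; apply: open_img; exact: open_dom.
  by apply: filterS => y hy; rewrite /= param_tr.
have [_ HE] := near_eq_is_diff near_p (is_diff_comp D1 D2).
have := congr1 (fun L : E -> R => L (X p)) HE; exact.
Qed.

Lemma der_comb (X Y : vector_field S) f (a b : R) p u :
  u = a *: X p + b *: Y p ->
  pairing (dfun S f p) u = a * der X f p + b * der Y f p.
Proof. by move=> ->; rewrite pairing_comb. Qed.

Lemma smooth_fun_sub U V f : U `<=` V -> smooth_fun S V f -> smooth_fun S U f.
Proof. by move=> UV sf c; apply: smooth_sub (sf c); exact: img_sub. Qed.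

Lemma smooth_vf_sub U V (X : vector_field S) :
  U `<=` V -> smooth_vf V X -> smooth_vf U X.
Proof. by move=> UV sf c; apply: smooth_sub (sf c); exact: img_sub. Qed.

Lemma smooth_form_sub U V (w : one_form S) :
  U `<=` V -> smooth_form V w -> smooth_form U w.
Proof. by move=> UV sf c; apply: smooth_sub (sf c); exact: img_sub. Qed.

Lemma smooth_fun_of_chart U c f : open U -> U `<=` dom c ->
  smooth_on (img c U) (f \o param c) -> smooth_fun S U f.
Proof.
move=> oU Uc sf c'; have oI : open (img c' U) by exact: open_img.
have h x : img c' U x -> img c' (dom c) x by exact: img_sub.
apply: (@smooth_ext _ _ _ _ (fun x => (f \o param c) (tr c' c x))) => //.
  by move=> x /h hx; rewrite /= param_tr.
apply: smooth_comp sf => //.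
  move=> x hx; have [h1 h2 h3] := iffLR (imgP _ _ _) hx.
  by apply: img_coord => //; exact: Uc.
by apply: smooth_sub (@tr_smooth c' c).
Qed.

Lemma smooth_fun_cst U a : smooth_fun S U (cst a).
Proof. by move=> c; exact: smooth_cst. Qed.

Lemma smooth_funD U f g : open U -> smooth_fun S U f -> smooth_fun S U g ->
  smooth_fun S U (fun p => f p + g p).
Proof. by move=> oU sf sg c; apply: smoothD; [exact: open_img|exact: sf|exact: sg]. Qed.

Lemma smooth_funB U f g : open U -> smooth_fun S U f -> smooth_fun S U g ->
  smooth_fun S U (fun p => f p - g p).
Proof. by move=> oU sf sg c; apply: smoothB; [exact: open_img|exact: sf|exact: sg]. Qed.

Lemma smooth_funN U f : open U -> smooth_fun S U f -> smooth_fun S U (fun p => - f p).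
Proof. by move=> oU sf c; apply: smoothN; [exact: open_img|exact: sf]. Qed.

Lemma smooth_funM U f g : open U -> smooth_fun S U f -> smooth_fun S U g ->
  smooth_fun S U (fun p => f p * g p).
Proof. by move=> oU sf sg c; apply: smoothM; [exact: open_img|exact: sf|exact: sg]. Qed.

Lemma smooth_funV U f : open U -> (forall p, U p -> f p != 0) ->
  smooth_fun S U f -> smooth_fun S U (fun p => (f p)^-1).
Proof.
move=> oU f0 sf c; apply: smoothV; [exact: open_img| |exact: sf].
by move=> x /imgP [h _ _]; exact: f0.
Qed.

Lemma smooth_fun_expR U f : open U ->
  smooth_fun S U f -> smooth_fun S U (fun p => expR (f p)).
Proof. by move=> oU sf c; apply: smooth_expR; [exact: open_img|exact: sf]. Qed.

Lemma smooth_der U (X : vector_field S) f : open U -> smooth_vf U X ->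
  smooth_fun S U f -> smooth_fun S U (der X f).
Proof.
move=> oU sX sf c; have oI : open (img c U) by exact: open_img.
apply: (@smooth_ext _ _ _ _ (fun x => 'd (f \o param c) x (vf_rep c X x))) => //.
  move=> x /imgP [h1 h2 h3].
  by rewrite /= (der_rep X oU sf h1 h2) h3.
by apply: smooth_diff_dir.
Qed.

Lemma smooth_pairing U (w : one_form S) (X : vector_field S) : open U ->
  smooth_form U w -> smooth_vf U X -> smooth_fun S U (fun p => pairing (w p) (X p)).
Proof.
move=> oU sw sX c; have oI : open (img c U) by exact: open_img.
apply: (@smooth_ext _ _ _ _ (fun x =>
   vf_rep c X x 0 0 * form_rep c w x 0 0 + vf_rep c X x 0 1 * form_rep c w x 1 0)) => //.
  move=> x /imgP [h1 h2 h3]; rewrite -pairingE -{1 2}h3.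
  exact: form_vf_rep.
by apply: smoothD => //; apply: smoothM => //; apply: smooth_coord.
Qed.

Lemma smooth_vf_comb U (X Y : vector_field S) f g : open U ->
  smooth_vf U X -> smooth_vf U Y -> smooth_fun S U f -> smooth_fun S U g ->
  smooth_vf U ((fun p => f p *: X p + g p *: Y p) : vector_field S).
Proof.
move=> oU sX sY sf sg c; have oI : open (img c U) by exact: open_img.
apply: (@smooth_ext _ _ _ _ (fun x =>
   (f \o param c) x *: vf_rep c X x + (g \o param c) x *: vf_rep c Y x)) => //.
  by move=> x _; rewrite /vf_rep linearD !linearZ.
by apply: smoothD => //; apply: smoothZ.
Qed.

Section Rules.
Variables (U : set M) (X : vector_field S).
Hypothesis oU : open U.

Let c0 p : dom (chart_at S p) p. Proof. exact: dom_chart_at. Qed.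

Lemma smooth_fun_is_diff f c p : smooth_fun S U f -> U p -> dom c p ->
  is_diff (coord c p) (f \o param c) ('d (f \o param c) (coord c p)).
Proof. by move=> sf Up cp; apply: smooth_is_diff (sf c) _; exact: img_coord. Qed.

Lemma der_of_is_diff f p L : smooth_fun S U f -> U p ->
  is_diff (coord (chart_at S p) p) (f \o param (chart_at S p)) L ->
  der X f p = L (X p).
Proof.
move=> sf Up [_ D]; rewrite (der_rep X oU sf Up (c0 p)) D.
by congr (L _); exact: vf_rep_at.
Qed.

Lemma derE f p : smooth_fun S U f -> U p ->
  der X f p = 'd (f \o param (chart_at S p)) (coord (chart_at S p) p) (X p).
Proof. by move=> sf Up; apply: der_of_is_diff => //; exact: smooth_fun_is_diff. Qed.

Lemma derD f g p : smooth_fun S U f -> smooth_fun S U g -> U p ->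
  der X (fun q => f q + g q) p = der X f p + der X g p.
Proof.
move=> sf sg Up; rewrite (derE sf) // (derE sg) //.
rewrite (der_of_is_diff (smooth_funD oU sf sg) Up (is_diffD
  (smooth_fun_is_diff sf Up (c0 p)) (smooth_fun_is_diff sg Up (c0 p)))).
by [].
Qed.

Lemma derB f g p : smooth_fun S U f -> smooth_fun S U g -> U p ->
  der X (fun q => f q - g q) p = der X f p - der X g p.
Proof.
move=> sf sg Up; rewrite (derE sf) // (derE sg) //.
rewrite (der_of_is_diff (smooth_funB oU sf sg) Up (is_diffB
  (smooth_fun_is_diff sf Up (c0 p)) (smooth_fun_is_diff sg Up (c0 p)))).
by [].
Qed.

Lemma derN f p : smooth_fun S U f -> U p ->
  der X (fun q => - f q) p = - der X f p.
Proof.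
move=> sf Up; rewrite (derE sf) //.
rewrite (der_of_is_diff (smooth_funN oU sf) Up (is_diffN
  (smooth_fun_is_diff sf Up (c0 p)))).
by [].
Qed.

Lemma der_cst a p : U p -> der X (cst a) p = 0.
Proof.
move=> Up; rewrite (der_of_is_diff (@smooth_fun_cst U a) Up (is_diff_cst a _)).
by [].
Qed.

Lemma derM f g p : smooth_fun S U f -> smooth_fun S U g -> U p ->
  der X (fun q => f q * g q) p = f p * der X g p + der X f p * g p.
Proof.
move=> sf sg Up; rewrite (derE sf) // (derE sg) //.
rewrite (der_of_is_diff (smooth_funM oU sf sg) Up (is_diff_Zvec
  (smooth_fun_is_diff sf Up (c0 p)) (smooth_fun_is_diff sg Up (c0 p)))).
by rewrite /= coordK.
Qed.

(** A derivative depends on the function near the point only; functions known by a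
   formula on U only are differentiated through this lemma. *)
Lemma eq_der f g p : (forall q, U q -> f q = g q) -> smooth_fun S U f -> U p ->
  der X g p = der X f p.
Proof.
move=> fg sf Up; rewrite /der !dfun_pairing.
suff HE : 'd (g \o param (chart_at S p)) (at_coord S p) =
    'd (f \o param (chart_at S p)) (at_coord S p) :> (E -> R).
  exact: (congr1 (fun L : E -> R => L (X p)) HE).
apply: near_eq_diff; last first.
  by apply: smooth_differentiable (sf (chart_at S p)) _; exact: img_coord.
have : \forall y \near at_coord S p, img (chart_at S p) U y.
  by apply: open_nbhs_nbhs; split; [exact: open_img | exact: img_coord].
by apply: filterS => y /imgP [h _ _] /=; exact: fg.
Qed.

Lemma derV f p : (forall q, U q -> f q != 0) -> smooth_fun S U f -> U p ->
  der X (fun q => (f q)^-1) p = - der X f p / (f p ^+ 2).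
Proof.
move=> f0 sf Up; have sV := smooth_funV oU f0 sf.
have f0p := f0 p Up.
have H : der X (fun q => f q * (f q)^-1) p = 0.
  rewrite (@eq_der (cst 1)) ?der_cst //; last exact: smooth_fun_cst.
  by move=> q Uq; rewrite divff // f0.
move: H; rewrite derM // => H.
have -> : der X (fun q => (f q)^-1) p = (f p)^-1 * (f p * der X (fun q => (f q)^-1) p).
  by rewrite mulKf.
have -> : f p * der X (fun q => (f q)^-1) p = - (der X f p / f p).
  by apply/eqP; rewrite -addr_eq0 H.
by field.
Qed.

Lemma der_expR f p : smooth_fun S U f -> U p ->
  der X (fun q => expR (f q)) p = expR (f p) * der X f p.
Proof.
move=> sf Up; rewrite (derE sf) //.
rewrite (der_of_is_diff (smooth_fun_expR oU sf) Up (is_diff_expR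
  (smooth_fun_is_diff sf Up (c0 p)))).
by rewrite /= coordK.
Qed.

End Rules.
End Charts.

(** * The structure equations of a web *)

Section Bracket.
Context {R : realType}.
Local Notation E := 'rV[R]_2.

Lemma is_diff_coord (V : normedModType R) k l (f L : V -> 'M[R]_(k, l)) x i j :
  is_diff x f L -> is_diff x (fun z => f z i j : R) (fun v => L v i j).
Proof.
move=> h.
exact: is_diff_comp h (is_diff_linear _ (@linear_coord R k l i j)
  (@continuous_coord R k l i j)).
Qed.

Lemma is_diff_lincomb (V : normedModType R) (Y LY : V -> E) (b0 b1 L0 L1 : V -> R) x :
  is_diff x Y LY -> is_diff x b0 L0 -> is_diff x b1 L1 ->
  is_diff x (fun z => Y z 0 0 * b0 z + Y z 0 1 * b1 z)
   (fun u => (Y x 0 0 * L0 u + Y x 0 1 * L1 u) +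
             (LY u 0 0 * b0 x + LY u 0 1 * b1 x)).
Proof.
move=> hY h0 h1.
have D := is_diffD (is_diff_Zvec (is_diff_coord 0 0 hY) h0)
                   (is_diff_Zvec (is_diff_coord 0 1 hY) h1).
by apply: eq_is_diff D _ _ => // u; rewrite !fctE /GRing.scale /=; ring.
Qed.

Lemma is_diff_dir (A : set E) (F : E -> R) (Y : E -> E) x :
  smooth_on A F -> smooth_on A Y -> A x ->
  is_diff x (fun z => 'd F z (Y z))
    (fun u => 'd (fun z => 'd F z (Y x)) x u + 'd F x ('d Y x u)).
Proof.
move=> sF sY Ax.
have d0 := smooth_is_diff (smooth_diff e0 sF) Ax.
have d1 := smooth_is_diff (smooth_diff e1 sF) Ax.
have dY := smooth_is_diff sY Ax.
apply: eq_is_diff (is_diff_lincomb dY d0 d1) _ _ => [z|u].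
  by rewrite [RHS]diff_pt.
rewrite [X in _ = _ + X]diff_pt; congr (_ + _).
have D := is_diff_lincomb (is_diff_cst (Y x) x) d0 d1.
have [_ HE] := eq_is_diff D (fun z => esym (diff_pt F z (Y x))) (fun=> erefl).
apply/esym; apply: (etrans (congr1 (fun L : E -> R => L u) HE)).
have -> : (0 : E -> E) u = 0 by [].
by rewrite ![(0 : E) _ _]mxE !mul0r !addr0.
Qed.

Lemma is_diff_pairing (A : set E) (w : E -> 'cV[R]_2) (Y : E -> E) x :
  smooth_on A w -> smooth_on A Y -> A x ->
  is_diff x (fun z => pairing (w z) (Y z))
    (fun u => 'd (fun z => pairing (w z) (Y x)) x u + pairing (w x) ('d Y x u)).
Proof.
move=> sw sY Ax.
have dw := smooth_is_diff sw Ax.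
have d0 := is_diff_coord 0 0 dw.
have d1 := is_diff_coord 1 0 dw.
have dY := smooth_is_diff sY Ax.
apply: eq_is_diff (is_diff_lincomb dY d0 d1) _ _ => [z|u].
  by rewrite pairingE.
rewrite [X in _ = _ + X]pairingE; congr (_ + _).
have D := is_diff_lincomb (is_diff_cst (Y x) x) d0 d1.
have [_ HE] := eq_is_diff D (fun z => esym (pairingE (w z) (Y x))) (fun=> erefl).
apply/esym; apply: (etrans (congr1 (fun L : E -> R => L u) HE)).
have -> : (0 : E -> E) u = 0 by [].
by rewrite ![(0 : E) _ _]mxE !mul0r !addr0.
Qed.

Context {M : topologicalType} (S : smooth_surface R M).
Implicit Types (X Y : vector_field S) (w : one_form S) (p : M).

(** The bracket [X, Y] at p, computed in the preferred chart of p. *)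
Definition lie X Y p : E :=
  'd (vf_rep (chart_at S p) Y) (at_coord S p) (X p)
  - 'd (vf_rep (chart_at S p) X) (at_coord S p) (Y p).

Let at_img0 (U : set M) p : U p -> img (chart_at S p) U (at_coord S p).
Proof. by move=> Up; apply: img_coord => //; exact: dom_chart_at. Qed.

Lemma der_pairing U w X Y p : open U -> U p ->
  smooth_form U w -> smooth_vf U Y ->
  der X (fun q => pairing (w q) (Y q)) p =
  'd (fun z => pairing (form_rep (chart_at S p) w z) (Y p)) (at_coord S p) (X p)
  + pairing (w p) ('d (vf_rep (chart_at S p) Y) (at_coord S p) (X p)).
Proof.
move=> oU Up sw sY.
have cp := dom_chart_at S p.
rewrite (derE X oU (smooth_pairing oU sw sY) Up).
have Ax := at_img0 Up.
have D := is_diff_pairing (sw _) (sY _) Ax.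
have near_p : \forall y \near at_coord S p,
   pairing (form_rep (chart_at S p) w y) (vf_rep (chart_at S p) Y y) =
   ((fun q => pairing (w q) (Y q)) \o param (chart_at S p)) y.
  have : \forall y \near at_coord S p, img (chart_at S p) U y.
    by apply: open_nbhs_nbhs; split=> //; exact: open_img.
  by apply: filterS => y /imgP [h1 h2 h3]; rewrite -{1 2}h3 form_vf_rep.
have [_ HE] := near_eq_is_diff near_p D.
apply: (etrans (congr1 (fun L : E -> R => L (X p)) HE)).
by rewrite vf_rep_at; congr (_ + _); exact: form_rep_at.
Qed.

(** In der_pairing the derivative of a pairing splits into that of the form, with
   the field frozen at p, and that of the field; antisymmetrized in X and Y, the
   first parts make ext_d and the second ones the bracket. *)
Lemma cartan U w X Y p : open U -> U p ->
  smooth_form U w -> smooth_vf U X -> smooth_vf U Y ->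
  ext_d w p (X p) (Y p) =
  der X (fun q => pairing (w q) (Y q)) p - der Y (fun q => pairing (w q) (X q)) p
  - pairing (w p) (lie X Y p).
Proof.
move=> oU Up sw sX sY.
rewrite (der_pairing _ oU Up sw sY) (der_pairing _ oU Up sw sX) /ext_d /lie.
by rewrite pairingB; ring.
Qed.

Lemma der_der U X Y (f : M -> R) p : open U -> U p ->
  smooth_fun S U f -> smooth_vf U Y ->
  der X (der Y f) p =
  'd (fun z => 'd (f \o param (chart_at S p)) z (Y p)) (at_coord S p) (X p)
  + pairing (dfun S f p) ('d (vf_rep (chart_at S p) Y) (at_coord S p) (X p)).
Proof.
move=> oU Up sf sY.
have cp := dom_chart_at S p.
rewrite (derE X oU (smooth_der oU sY sf) Up).
have Ax := at_img0 Up.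
have D := is_diff_dir (sf _) (sY _) Ax.
have near_p : \forall y \near at_coord S p,
   'd (f \o param (chart_at S p)) y (vf_rep (chart_at S p) Y y) =
   (der Y f \o param (chart_at S p)) y.
  have : \forall y \near at_coord S p, img (chart_at S p) U y.
    by apply: open_nbhs_nbhs; split=> //; exact: open_img.
  apply: filterS => y /imgP [h1 h2 h3]; rewrite /= (der_rep Y oU sf h1 h2).
  by rewrite h3.
have [_ HE] := near_eq_is_diff near_p D.
apply: (etrans (congr1 (fun L : E -> R => L (X p)) HE)).
by rewrite vf_rep_at dfun_pairing.
Qed.

(** The second derivatives of f cancel because they are symmetric. *)
Lemma lie_der U X Y (f : M -> R) p : open U -> U p ->
  smooth_fun S U f -> smooth_vf U X -> smooth_vf U Y ->
  der X (der Y f) p - der Y (der X f) p = pairing (dfun S f p) (lie X Y p).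
Proof.
move=> oU Up sf sX sY.
rewrite (der_der _ oU Up sf sY) (der_der _ oU Up sf sX) /lie.
have oI : open (img (chart_at S p) U) by exact: open_img.
have HS := diff_sym (Y p) (X p) oI (sf (chart_at S p) 2%N) (at_img0 Up).
apply: (etrans (congr1 (fun z : R => z + _ - _) HS)).
by rewrite pairingB; ring.
Qed.

End Bracket.

Section Algebra.
Variable R : realType.
Implicit Types l k d a z : R.

Fact lie_coeff1 l k d a z : k != 0 ->
  k^-1 * (a + d / k) - 0 * z = 0 - (- d / k ^+ 2) - l -> k * l = - a.
Proof.
move=> k0 H; have -> : l = d / k ^+ 2 - k^-1 * (a + d / k) by lra.
by field.
Qed.

Fact lie_coeff2 l k d a z : k != 0 ->
  0 * z - k^-1 * (a + d / k) = - d / k ^+ 2 - 0 - l -> k * l = a.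
Proof.
move=> k0 H; have -> : l = k^-1 * (a + d / k) - d / k ^+ 2 by lra.
by field.
Qed.

Fact structure_alg0 (x y z k : R) : x * (- y / k ^+ 2) + z * k^-1 = z / k - x * y / k ^+ 2.
Proof. by ring. Qed.

Fact structure_alg (k d1 d2 d12 d21 a1 a2 n12 n21 : R) : k != 0 ->
  d12 - d21 = - a2 * d1 + a1 * d2 ->
  k ^+ 2 * (k^-1 * k^-1 - 0 * 0) =
  n12 + (d12 / k - d2 * d1 / k ^+ 2) - (n21 + (d21 / k - d1 * d2 / k ^+ 2)) -
  (- a2 * (a1 + d1 / k) + a1 * (a2 + d2 / k)) ->
  n12 - n21 = 1.
Proof.
move=> k0 C H.
have E12 : d12 = d21 + (- a2 * d1 + a1 * d2) by rewrite -C addrC subrK.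
have -> : n12 - n21 =
  (n12 + (d12 / k - d2 * d1 / k ^+ 2) - (n21 + (d21 / k - d1 * d2 / k ^+ 2))
   - (- a2 * (a1 + d1 / k) + a1 * (a2 + d2 / k))).
  by rewrite E12; field.
by rewrite -H; field.
Qed.

End Algebra.

Section Structure.
Context {R : realType} {M : topologicalType} (S : smooth_surface R M) (W : web3 S).
Variables (gamma : one_form S) (K k : M -> R) (N1 N2 : vector_field S) (a1 a2 : M -> R).
Hypotheses (gammaP : is_connection W gamma) (KP : is_curvature W gamma K)
  (k_smooth : smooth_fun S setT k) (k_gt0 : forall p, 0 < k p)
  (kP : forall p, K p = k p ^+ 2) (NP : is_dual_frame W k N1 N2)
  (aP : are_absolute_invariants W gamma k a1 a2).
Local Notation E := 'rV[R]_2.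
Implicit Types (p : M) (f : M -> R).

Let oT : open [set: M]. Proof. exact: openT. Qed.
Let k0 p : k p != 0. Proof. by rewrite gt_eqF. Qed.

Let sN1 : smooth_vf setT N1. Proof. by case: NP. Qed.
Let sN2 : smooth_vf setT N2. Proof. by case: NP. Qed.
Let sa1 : smooth_fun S setT a1. Proof. by case: aP. Qed.
Let sa2 : smooth_fun S setT a2. Proof. by case: aP. Qed.

Lemma web_form3 p (u : E) : pairing (form3 W p) u =
  - (pairing (form1 W p) u + pairing (form2 W p) u).
Proof.
have /eqP := form_sum0 W p; rewrite addr_eq0 => /eqP E12.
by rewrite -pairingD E12 pairingN opprK.
Qed.

Lemma web_form_frame p :
  [/\ pairing (form1 W p) (N1 p) = (k p)^-1, pairing (form2 W p) (N1 p) = 0,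
      pairing (form1 W p) (N2 p) = 0 & pairing (form2 W p) (N2 p) = (k p)^-1].
Proof.
have [_ _ /(_ p) []] := NP; rewrite !pairingZl => h11 h21 h12 h22.
by split; apply: (mulfI (k0 p)); rewrite ?h11 ?h21 ?h12 ?h22 ?divff ?mulr0.
Qed.

Lemma frame_expand p (v : E) :
  v = pairing (theta1 W k p) v *: N1 p + pairing (theta2 W k p) v *: N2 p.
Proof.
have [_ _ /(_ p) [h11 h21 h12 h22]] := NP.
pose f (v : E) : E := pt (pairing (theta1 W k p) v) (pairing (theta2 W k p) v).
have linf : linear f.
  move=> a u w; apply: row2P; rewrite !mxE ?pt0 ?pt1 !pairingE !mxE /=; ring.
pose LM := GRing.isLinear.Build _ _ _ _ _ linf.
pose fl : {linear E -> E} := HB.pack f LM.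
have f1 : fl (N1 p) = e0 by apply: row2P; rewrite ?pt0 ?pt1 ?h11 ?h21 mxE.
have f2 : fl (N2 p) = e1 by apply: row2P; rewrite ?pt0 ?pt1 ?h12 ?h22 mxE.
have [_ /(_ v)] := comb_inverse f1 f2.
by rewrite /comb /= pt0 pt1.
Qed.

Lemma connection_frame p :
  pairing (gamma p) (N1 p) = a1 p + der N1 k p / k p /\
  pairing (gamma p) (N2 p) = a2 p + der N2 k p / k p.
Proof.
have [_ _ /(_ p) [h11 h21 h12 h22]] := NP.
have [_ _ /(_ p) ha] := aP.
have E1 v : pairing (gamma p) v =
   a1 p * pairing (theta1 W k p) v + a2 p * pairing (theta2 W k p) v +
   (k p)^-1 * pairing (dfun S k p) v.
  rewrite -pairing_combl -ha /alpha -pairingZl.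
  by rewrite !pairingE !mxE; ring.
by rewrite !E1 h11 h21 h12 h22 /der; split; ring.
Qed.

Let der_zero (X : vector_field S) f p : (forall q, f q = 0) -> der X f p = 0.
Proof.
move=> f0; rewrite (@eq_der _ _ _ setT X oT (cst 0)) //.
- by rewrite (der_cst X oT).
- exact: smooth_fun_cst.
Qed.

Let der_kV (X : vector_field S) f p : (forall q, f q = (k q)^-1) ->
  der X f p = - der X k p / k p ^+ 2.
Proof.
move=> fE; apply: etrans (derV X oT (fun q _ => k0 q) k_smooth I).
apply: (@eq_der _ _ _ setT X oT (fun q => (k q)^-1)) => //.
exact: smooth_funV.
Qed.

(** The structure equations for form1 and form2, evaluated on (N1, N2), give the
   two components of the bracket: there form1 and form2 take only the values 0
   and 1/k, and the derivatives of 1/k cancel the part dk/k of gamma. *)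
Lemma lie_frame p : lie N1 N2 p = - a2 p *: N1 p + a1 p *: N2 p.
Proof.
have [sg dw1 dw2] := gammaP.
have ff q := web_form_frame q.
have [h11 h21 h12 h22] := ff p.
have [g1 g2] := connection_frame p.
rewrite [LHS](frame_expand p); congr (_ *: _ + _ *: _); rewrite pairingZl.
- have := cartan oT I (form1_smooth W) sN1 sN2 (p := p).
  have Z : der N1 (fun q => pairing (form1 W q) (N2 q)) p = 0.
    by apply: der_zero => q; case: (ff q).
  have V : der N2 (fun q => pairing (form1 W q) (N1 q)) p = - der N2 k p / k p ^+ 2.
    by apply: der_kV => q; case: (ff q).
  rewrite dw1 /wedge h11 h12 g2 Z V.
  by move=> H; exact: lie_coeff1 (k0 p) H.
- have := cartan oT I (form2_smooth W) sN1 sN2 (p := p).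
  have Z : der N2 (fun q => pairing (form2 W q) (N1 q)) p = 0.
    by apply: der_zero => q; case: (ff q).
  have V : der N1 (fun q => pairing (form2 W q) (N2 q)) p = - der N1 k p / k p ^+ 2.
    by apply: der_kV => q; case: (ff q).
  rewrite dw2 /wedge h22 h21 g1 Z V.
  by move=> H; exact: lie_coeff2 (k0 p) H.
Qed.

Lemma commutator U f p : open U -> U p -> smooth_fun S U f ->
  der N1 (der N2 f) p - der N2 (der N1 f) p =
  - a2 p * der N1 f p + a1 p * der N2 f p.
Proof.
move=> oU Up sf.
have sub : U `<=` setT by [].
rewrite (lie_der oU Up sf (smooth_vf_sub sub sN1) (smooth_vf_sub sub sN2)).
by apply: der_comb; exact: lie_frame.
Qed.

(** Evaluating d gamma = K w1 /\ w2 on the frame: the exact part dk / k of gamma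
   drops out. *)
Lemma invariant_structure p : der N1 a2 p - der N2 a1 p = 1.
Proof.
have [sg _ _] := gammaP.
have [h11 h21 h12 h22] := web_form_frame p.
have [g1 g2] := connection_frame p.
have skV : smooth_fun S setT (fun q => (k q)^-1) by exact: smooth_funV.
have sNk (X : vector_field S) : smooth_vf setT X -> smooth_fun S setT (fun q => der X k q / k q).
  by move=> sX; exact: (smooth_funM oT (smooth_der oT sX k_smooth) skV).
have dg (X Y : vector_field S) (a : M -> R) : smooth_vf setT X -> smooth_fun S setT a ->
    (forall q, pairing (gamma q) (X q) = a q + der X k q / k q) ->
    der Y (fun q => pairing (gamma q) (X q)) p =
    der Y a p + (der Y (der X k) p / k p - der X k p * der Y k p / k p ^+ 2).
  move=> sX sa E1.
  rewrite (eq_der Y oT (fun q _ => esym (E1 q)) (smooth_funD oT sa (sNk X sX)) I).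
  rewrite (derD Y oT sa (sNk X sX) I); congr (_ + _).
  rewrite (derM Y oT (smooth_der oT sX k_smooth) skV I).
  rewrite (derV Y oT (fun q _ => k0 q) k_smooth I).
  exact: structure_alg0.
have := cartan oT I sg sN1 sN2 (p := p).
rewrite (KP p) /wedge h11 h21 h12 h22 kP lie_frame.
rewrite (dg N2 N1 a2 sN2 sa2 (fun q => (connection_frame q).2)).
rewrite (dg N1 N2 a1 sN1 sa1 (fun q => (connection_frame q).1)).
rewrite pairing_comb g1 g2.
have := commutator oT I k_smooth (p := p).
have := k0 p.
exact: structure_alg.
Qed.

End Structure.

(** * Primitives of closed forms given in the frame *)

(** The existence and the uniqueness of the automorphism both follow from these
   facts on the dual frame: gamma and the curvature enter only through the
   commutator of the frame and the relation between the invariants. *)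
Record web_frame (R : realType) (M : topologicalType) (S : smooth_surface R M)
    (W : web3 S) (k : M -> R) (N1 N2 : vector_field S) (a1 a2 : M -> R) : Prop :=
  WebFrame {
  wf_k : smooth_fun S setT k ;
  wf_k0 : forall p, k p != 0 ;
  wf_N1 : smooth_vf setT N1 ;
  wf_N2 : smooth_vf setT N2 ;
  wf_a1 : smooth_fun S setT a1 ;
  wf_a2 : smooth_fun S setT a2 ;
  wf_dual : forall p,
    [/\ pairing (form1 W p) (N1 p) = (k p)^-1, pairing (form2 W p) (N1 p) = 0,
        pairing (form1 W p) (N2 p) = 0 & pairing (form2 W p) (N2 p) = (k p)^-1] ;
  wf_expand : forall p v,
    v = pairing (theta1 W k p) v *: N1 p + pairing (theta2 W k p) v *: N2 p ;
  wf_comm : forall U (f : M -> R) p, open U -> U p -> smooth_fun S U f ->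
    der N1 (der N2 f) p - der N2 (der N1 f) p =
    - a2 p * der N1 f p + a1 p * der N2 f p ;
  wf_structure : forall p, der N1 a2 p - der N2 a1 p = 1 }.

Section Algebra.
Variable R : realType.

(* (u0, u1) and (v0, v1) are the components of N1 and N2 in a chart, duj and dvj the
   derivatives of uj along N2 and of vj along N1, (B0, B1) a 1-form with partial
   derivatives bij, and c1, c2 its values on N1 and N2. *)
Fact closed_in_frame_alg (u0 u1 v0 v1 A1 A2 du0 du1 dv0 dv1 b00 b01 b10 b11 B0 B1 c1 c2
    d0u d0v d1u d1v : R) :
  u0 * v1 - u1 * v0 != 0 ->
  d0u = u0 * b00 + u1 * b01 -> d0v = v0 * b00 + v1 * b01 ->
  d1u = u0 * b10 + u1 * b11 -> d1v = v0 * b10 + v1 * b11 ->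
  dv0 - du0 = - A2 * u0 + A1 * v0 -> dv1 - du1 = - A2 * u1 + A1 * v1 ->
  u0 * B0 + u1 * B1 = c1 -> v0 * B0 + v1 * B1 = c2 ->
  (v0 * d0u + v1 * d1u + (dv0 * B0 + dv1 * B1)) -
  (u0 * d0v + u1 * d1v + (du0 * B0 + du1 * B1)) = - A2 * c1 + A1 * c2 ->
  b10 = b01.
Proof.
move=> det0 -> -> -> -> E0 E1 <- <- H.
apply/eqP; rewrite -subr_eq0; apply/eqP; apply: (mulfI det0); rewrite mulr0.
transitivity ((v0 * (u0 * b00 + u1 * b01) + v1 * (u0 * b10 + u1 * b11) +
   (dv0 * B0 + dv1 * B1)) -
  (u0 * (v0 * b00 + v1 * b01) + u1 * (v0 * b10 + v1 * b11) + (du0 * B0 + du1 * B1))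
  - (- A2 * (u0 * B0 + u1 * B1) + A1 * (v0 * B0 + v1 * B1))
  - ((dv0 - du0) - (- A2 * u0 + A1 * v0)) * B0
  - ((dv1 - du1) - (- A2 * u1 + A1 * v1)) * B1); first by ring.
by rewrite H E0 E1 !subrr !mul0r !subr0.
Qed.

Fact frame_det_alg (u0 u1 v0 v1 w0 w1 z0 z1 k : R) : k != 0 ->
  u0 * w0 + u1 * w1 = k^-1 -> u0 * z0 + u1 * z1 = 0 ->
  v0 * w0 + v1 * w1 = 0 -> v0 * z0 + v1 * z1 = k^-1 ->
  u0 * v1 - u1 * v0 != 0.
Proof.
move=> k0 h1 h2 h3 h4; apply/eqP => D.
have : (u0 * w0 + u1 * w1) * (v0 * z0 + v1 * z1) -
   (u0 * z0 + u1 * z1) * (v0 * w0 + v1 * w1) = 0.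
  have -> : (u0 * w0 + u1 * w1) * (v0 * z0 + v1 * z1) -
   (u0 * z0 + u1 * z1) * (v0 * w0 + v1 * w1) =
   (u0 * v1 - u1 * v0) * (w0 * z1 - w1 * z0) by ring.
  by rewrite D mul0r.
rewrite h1 h2 h3 h4 mul0r subr0 => /eqP.
by rewrite mulf_eq0 invr_eq0 (negPf k0).
Qed.

End Algebra.

Section Primitive.
Context {R : realType} {M : topologicalType} (S : smooth_surface R M) (W : web3 S).
Variables (k : M -> R) (N1 N2 : vector_field S) (a1 a2 : M -> R).
Hypothesis WF : web_frame W k N1 N2 a1 a2.
Local Notation E := 'rV[R]_2.
Implicit Types (p : M) (f : M -> R).

Let oT : open [set: M]. Proof. exact: openT. Qed.

(** The components of a field are its derivatives of the coordinate functions;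
   this turns the commutator identity for functions into one for components. *)
Lemma vf_rep_coord c (X : vector_field S) p j : dom c p ->
  der X (fun q => coord c q 0 j) p = vf_rep c X (coord c p) 0 j /\
  smooth_fun S (dom c) (fun q => coord c q 0 j).
Proof.
move=> cp; have oc := @open_dom _ _ S c.
have oI : open (img c (dom c)) by exact: open_img.
have sc : smooth_fun S (dom c) (fun q => coord c q 0 j).
  apply: (smooth_fun_of_chart oc (@subset_refl _ _)).
  apply: (@smooth_ext _ _ _ _ (fun x : E => x 0 j)) => //.
    by move=> x /imgP [_ _ h] /=; rewrite h.
  by apply: smooth_coord => //; exact: smooth_id.
split=> //; rewrite (der_rep X oc sc cp cp).
have near_p : \forall y \near coord c p, (y : E) 0 j = ((fun q => coord c q 0 j) \o param c) y.
  have : \forall y \near coord c p, img c (dom c) y.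
    by apply: open_nbhs_nbhs; split=> //; exact: img_coord.
  by apply: filterS => y /imgP [_ _ h] /=; rewrite h.
have [_ HE] := near_eq_is_diff near_p (is_diff_coord 0 j (is_diff_id (coord c p))).
exact: (congr1 (fun L : E -> R => L (vf_rep c X (coord c p))) HE).
Qed.

Lemma der_vf_rep c (X Y : vector_field S) p j : dom c p -> smooth_vf setT Y ->
  der X (der Y (fun q => coord c q 0 j)) p =
  'd (vf_rep c Y) (coord c p) (vf_rep c X (coord c p)) 0 j.
Proof.
move=> cp sY; have oc := @open_dom _ _ S c.
have oI : open (img c (dom c)) by exact: open_img.
have [_ sc] := vf_rep_coord Y j cp.
have sY' : smooth_vf (dom c) Y by apply: smooth_vf_sub sY.
rewrite (der_rep X oc (smooth_der oc sY' sc) cp cp).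
have near_p : \forall y \near coord c p, vf_rep c Y y 0 j =
   (der Y (fun q => coord c q 0 j) \o param c) y.
  have : \forall y \near coord c p, img c (dom c) y.
    by apply: open_nbhs_nbhs; split=> //; exact: img_coord.
  apply: filterS => y /imgP [_ h1 h2] /=; have [-> _] := vf_rep_coord Y j h1.
  by rewrite h2.
have dY : is_diff (coord c p) (vf_rep c Y) ('d (vf_rep c Y) (coord c p)).
  by apply: smooth_is_diff (sY' c) _; exact: img_coord.
have [_ HE] := near_eq_is_diff near_p (is_diff_coord 0 j dY).
exact: (congr1 (fun L : E -> R => L (vf_rep c X (coord c p))) HE).
Qed.

Lemma bracket_chart c p j : dom c p ->
  'd (vf_rep c N2) (coord c p) (vf_rep c N1 (coord c p)) 0 j -
  'd (vf_rep c N1) (coord c p) (vf_rep c N2 (coord c p)) 0 j =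
  - a2 p * vf_rep c N1 (coord c p) 0 j + a1 p * vf_rep c N2 (coord c p) 0 j.
Proof.
move=> cp; have oc := @open_dom _ _ S c.
have [h1 sc] := vf_rep_coord N1 j cp; have [h2 _] := vf_rep_coord N2 j cp.
rewrite -(der_vf_rep N1 j cp (wf_N2 WF)) -(der_vf_rep N2 j cp (wf_N1 WF)) -h1 -h2.
exact: (wf_comm WF oc cp sc).
Qed.

Lemma frame_det c p : dom c p ->
  vf_rep c N1 (coord c p) 0 0 * vf_rep c N2 (coord c p) 0 1 -
  vf_rep c N1 (coord c p) 0 1 * vf_rep c N2 (coord c p) 0 0 != 0.
Proof.
move=> cp; have [h1 h2 h3 h4] := wf_dual WF p.
move: h1 h2 h3 h4; rewrite -!(form_vf_rep _ _ cp) !pairingE => h1 h2 h3 h4.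
exact: frame_det_alg (wf_k0 WF p) h1 h2 h3 h4.
Qed.

(** A 1-form is determined by its values b1, b2 on the frame; the hypothesis is
   d beta (N1, N2) = 0 written with the commutator of the frame. *)
Lemma frame_primitive U p0 (b1 b2 : M -> R) : open U -> U p0 ->
  smooth_fun S U b1 -> smooth_fun S U b2 ->
  (forall p, U p -> der N1 b2 p - der N2 b1 p = - a2 p * b1 p + a1 p * b2 p) ->
  exists (V : set M) (f : M -> R), [/\ open V, V p0, V `<=` U,
    smooth_fun S V f &
    forall p, V p -> der N1 f p = b1 p /\ der N2 f p = b2 p].
Proof.
move=> oU Up0 sb1 sb2 closedb.
pose c := chart_at S p0; have cp0 : dom c p0 by exact: dom_chart_at.
pose U' := U `&` dom c.
have oU' : open U' by apply: openI => //; exact: open_dom.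
have subU : U' `<=` U by move=> ? [].
have subc : U' `<=` dom c by move=> ? [].
have oI : open (img c U') by exact: open_img.
pose be j (x : E) : R :=
  (b1 \o param c) x * (k \o param c) x * form_rep c (form1 W) x j 0 +
  (b2 \o param c) x * (k \o param c) x * form_rep c (form2 W) x j 0.
have sbe j : smooth_on (img c U') (be j).
  have s1 := smooth_fun_sub subU sb1 c.
  have s2 := smooth_fun_sub subU sb2 c.
  have sk := smooth_fun_sub (@subsetT _ U') (wf_k WF) c.
  have f1 := smooth_form_sub (@subsetT _ U') (form1_smooth W) c.
  have f2 := smooth_form_sub (@subsetT _ U') (form2_smooth W) c.
  have t1 := smoothM oI (smoothM oI s1 sk) (smooth_coord j 0 oI f1).
  have t2 := smoothM oI (smoothM oI s2 sk) (smooth_coord j 0 oI f2).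
  exact: smoothD oI t1 t2.
have beE (X : vector_field S) p : dom c p ->
    vf_rep c X (coord c p) 0 0 * be 0 (coord c p) +
    vf_rep c X (coord c p) 0 1 * be 1 (coord c p) =
    b1 p * (k p * pairing (form1 W p) (X p)) + b2 p * (k p * pairing (form2 W p) (X p)).
  move=> cp; rewrite -!(form_vf_rep _ _ cp) !pairingE /be /= coordK //.
  by ring.
have be1 p : dom c p -> vf_rep c N1 (coord c p) 0 0 * be 0 (coord c p) +
    vf_rep c N1 (coord c p) 0 1 * be 1 (coord c p) = b1 p.
  move=> cp; rewrite beE //; have [-> -> _ _] := wf_dual WF p.
  by rewrite divff ?mulr0 ?mulr1 ?addr0 // (wf_k0 WF).
have be2 p : dom c p -> vf_rep c N2 (coord c p) 0 0 * be 0 (coord c p) +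
    vf_rep c N2 (coord c p) 0 1 * be 1 (coord c p) = b2 p.
  move=> cp; rewrite beE //; have [_ _ -> ->] := wf_dual WF p.
  by rewrite divff ?mulr0 ?mulr1 ?add0r // (wf_k0 WF).
have derb (X Y : vector_field S) (b : M -> R) p : smooth_vf setT Y -> smooth_fun S U b ->
    (forall q, dom c q -> vf_rep c Y (coord c q) 0 0 * be 0 (coord c q) +
      vf_rep c Y (coord c q) 0 1 * be 1 (coord c q) = b q) -> U' p ->
    der X b p =
    (vf_rep c Y (coord c p) 0 0 * 'd (be 0) (coord c p) (vf_rep c X (coord c p)) +
     vf_rep c Y (coord c p) 0 1 * 'd (be 1) (coord c p) (vf_rep c X (coord c p))) +
    ('d (vf_rep c Y) (coord c p) (vf_rep c X (coord c p)) 0 0 * be 0 (coord c p) +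
     'd (vf_rep c Y) (coord c p) (vf_rep c X (coord c p)) 0 1 * be 1 (coord c p)).
  move=> sY sb hb U'p; have cp := subc _ U'p.
  rewrite (der_rep X oU sb (subU _ U'p) cp).
  have Ip : img c U' (coord c p) by exact: img_coord.
  have dY := smooth_is_diff (smooth_vf_sub (@subsetT _ U') sY c) Ip.
  have D := is_diff_lincomb dY (smooth_is_diff (sbe 0) Ip) (smooth_is_diff (sbe 1) Ip).
  have near_p : \forall y \near coord c p,
      vf_rep c Y y 0 0 * be 0 y + vf_rep c Y y 0 1 * be 1 y = (b \o param c) y.
    have : \forall y \near coord c p, img c U' y by exact: open_nbhs_nbhs.
    by apply: filterS => y /imgP [_ h1 h2] /=; rewrite -[in LHS]h2 hb // subc.
  have [_ HE] := near_eq_is_diff near_p D.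
  exact: (congr1 (fun L : E -> R => L (vf_rep c X (coord c p))) HE).
have [r /= r0 Hr] := iffLR (nbhs_ballP _ _)
  (open_nbhs_nbhs (conj oI (img_coord (conj Up0 cp0) cp0))).
have cl x : ball (coord c p0) r x -> 'd (be 1) x e0 = 'd (be 0) x e1.
  move=> /Hr /imgP [U'p cp xE]; rewrite -xE; move: (param c x) U'p cp => p U'p cp.
  have := closedb p (subU _ U'p).
  rewrite (derb N1 N2 b2 p (wf_N2 WF) sb2 be2 U'p) (derb N2 N1 b1 p (wf_N1 WF) sb1 be1 U'p).
  move=> H; exact: (closed_in_frame_alg (frame_det cp)
    (diff_pt (be 0) _ _) (diff_pt (be 0) _ _) (diff_pt (be 1) _ _) (diff_pt (be 1) _ _)
    (bracket_chart 0 cp) (bracket_chart 1 cp) (be1 p cp) (be2 p cp) H).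
have [F sF dF] := poincare r0 (smooth_sub Hr (sbe 0)) (smooth_sub Hr (sbe 1)) cl.
pose V := U' `&` coord c @^-1` ball (coord c p0) (r / 2).
have oV : open V.
  apply: open_setI_preimage => //; first exact: ball_open.
  by move=> p /subc cp; exact: coord_continuous.
have subV : V `<=` U' by move=> ? [].
have sV : smooth_fun S V (F \o coord c).
  apply: (smooth_fun_of_chart oV (subset_trans subV subc)).
  have oIV : open (img c V) by exact: open_img.
  apply: (@smooth_ext _ _ _ _ F) => //.
    by move=> x /imgP [_ _ h] /=; rewrite h.
  by apply: smooth_sub sF => x /imgP [[_ h] _ h3]; move: h; rewrite /= h3.
have r20 : 0 < r / 2 by rewrite divr_gt0.
exists V, (F \o coord c); split=> //.
- by split; [split | exact: ballxx].
- exact: subset_trans subV subU.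
have derF (X : vector_field S) p : V p -> der X (F \o coord c) p =
    vf_rep c X (coord c p) 0 0 * be 0 (coord c p) +
    vf_rep c X (coord c p) 0 1 * be 1 (coord c p).
  move=> Vp; have cp := subc _ (subV _ Vp).
  rewrite (der_rep X oV sV Vp cp).
  have near_p : \forall y \near coord c p, F y = ((F \o coord c) \o param c) y.
    have : \forall y \near coord c p, img c V y.
      by apply: open_nbhs_nbhs; split; [exact: open_img | exact: img_coord].
    by apply: filterS => y /imgP [_ _ h] /=; rewrite h.
  have [_ HE] := near_eq_is_diff near_p (dF _ Vp.2).
  exact: (congr1 (fun L : E -> R => L (vf_rep c X (coord c p))) HE).
move=> p Vp; have cp := subc _ (subV _ Vp).
by rewrite (derF N1 p Vp) (derF N2 p Vp) be1 // be2.
Qed.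

End Primitive.

(** * The factor s and the flow parameter y *)

Section Algebra.
Variable R : realType.

(* P = N2 a2, Q = N1 a2, Pi = Ni P, Qi = Ni Q, P12 = N1 N2 P, P21 = N2 N1 P. The
   form with the values prescribed for N1 (ln s) and N2 (ln s) is closed. *)
Fact log_closed_alg (P Q A1 A2 P1 P2 Q2 P12 P21 : R) : P != 0 ->
  A2 * P * Q + P2 * Q = A1 * P ^+ 2 + Q2 * P ->
  P12 - P21 = - A2 * P1 + A1 * P2 ->
  - ((A2 * P1 + Q * P + P12) * P^-1 + (A2 * P + P2) * (- P1 / P ^+ 2))
  - - ((A2 * Q2 + P * Q + P21) * P^-1 + (A2 * Q + P1) * (- P2 / P ^+ 2)) =
  - A2 * - ((A2 * Q + P1) * P^-1) + A1 * - ((A2 * P + P2) * P^-1).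
Proof.
move=> P0 rel C.
have -> : P12 = P21 + (- A2 * P1 + A1 * P2) by rewrite -C addrC subrK.
have -> : Q2 = (A2 * P * Q + P2 * Q - A1 * P ^+ 2) / P.
  by rewrite rel addrC addKr mulfK.
by field.
Qed.

Fact eq_ratio_alg (P Q x y : R) : P != 0 -> Q != 0 -> x * Q = y * P -> x / P = y / Q.
Proof. by move=> P0 Q0 H; apply/eqP; rewrite eqr_div // H. Qed.

Fact rel1_alg (P Q A1 A2 P1 Q1 : R) : A2 * Q ^+ 2 + P1 * Q = A1 * Q * P + Q1 * P ->
  (A2 * Q + P1) * Q = (A1 * Q + Q1) * P.
Proof.
move=> H; transitivity (A2 * Q ^+ 2 + P1 * Q); first by ring.
by rewrite H; ring.
Qed.

Fact rel2_alg (P Q A1 A2 P2 Q2 : R) : A2 * P * Q + P2 * Q = A1 * P ^+ 2 + Q2 * P ->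
  (A2 * P + P2) * Q = (A1 * P + Q2) * P.
Proof.
move=> H; transitivity (A2 * P * Q + P2 * Q); first by ring.
by rewrite H; ring.
Qed.

Fact symmetry_invariants_alg (P Q A1 A2 P1 P2 Q1 Q2 : R) : P != 0 -> Q != 0 ->
  (A2 * Q + P1) * Q = (A1 * Q + Q1) * P ->
  (A2 * P + P2) * Q = (A1 * P + Q2) * P ->
  P1 - Q2 = - A2 * Q + A1 * P ->
  [/\ P * Q1 - Q * Q2 = 0, P * P1 - Q * P2 = 0 &
      forall s, P * (- ((A2 * Q + P1) / P) * s) - Q * (- ((A2 * P + P2) / P) * s) = 0].
Proof.
move=> P0 Q0 r1 r2 C.
have E1 : P1 = Q2 + (- A2 * Q + A1 * P) by rewrite -C addrC subrK.
have EQ1 : Q1 * P = (A2 * Q + P1) * Q - A1 * Q * P by rewrite r1; ring.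
have EP2 : P2 * Q = (A1 * P + Q2) * P - A2 * P * Q by rewrite -r2; ring.
have H2 : P * P1 - Q * P2 = 0.
  by rewrite [Q * P2]mulrC EP2 E1; ring.
split=> //.
- by rewrite [P * Q1]mulrC EQ1 E1; ring.
- move=> s.
  have -> : P * (- ((A2 * Q + P1) / P) * s) - Q * (- ((A2 * P + P2) / P) * s) =
    s / P * (- (P * P1 - Q * P2)) by field.
  by rewrite H2 oppr0 mulr0.
Qed.

(* The form equal to 0 on N1 and to -1/(s Q) on N2 is closed. *)
Fact parameter_closed_alg (A1 A2 Q Q1 s : R) : s != 0 -> Q != 0 ->
  - (- (s * Q1 + - ((A1 * Q + Q1) / Q) * s * Q) / (s * Q) ^+ 2) - 0 =
  - A2 * 0 + A1 * - (s * Q)^-1.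
Proof. by move=> s0 Q0; field; rewrite s0 Q0. Qed.

End Algebra.

Section Solution.
Context {R : realType} {M : topologicalType} (S : smooth_surface R M) (W : web3 S).
Variables (k : M -> R) (N1 N2 : vector_field S) (a1 a2 : M -> R).
Hypothesis WF : web_frame W k N1 N2 a1 a2.
Hypotheses (N1a2_neq0 : forall p, der N1 a2 p != 0)
  (N2a2_neq0 : forall p, der N2 a2 p != 0)
  (rel1 : forall p,
     a2 p * der N1 a2 p ^+ 2 + der N1 (der N2 a2) p * der N1 a2 p =
     a1 p * der N1 a2 p * der N2 a2 p + der N1 (der N1 a2) p * der N2 a2 p)
  (rel2 : forall p,
     a2 p * der N2 a2 p * der N1 a2 p + der N2 (der N2 a2) p * der N1 a2 p =
     a1 p * der N2 a2 p ^+ 2 + der N2 (der N1 a2) p * der N2 a2 p).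
Implicit Types (p : M) (f : M -> R).

Local Notation P := (der N2 a2).
Local Notation Q := (der N1 a2).

Let oT : open [set: M]. Proof. exact: openT. Qed.
Let sN1 := wf_N1 WF.
Let sN2 := wf_N2 WF.
Let sa1 := wf_a1 WF.
Let sa2 := wf_a2 WF.
Let sP : smooth_fun S setT P. Proof. exact: smooth_der. Qed.
Let sQ : smooth_fun S setT Q. Proof. exact: smooth_der. Qed.
Let sP1 : smooth_fun S setT (der N1 P). Proof. exact: smooth_der. Qed.
Let sP2 : smooth_fun S setT (der N2 P). Proof. exact: smooth_der. Qed.

(** The equations for s say that X = s (P N1 - Q N2) commutes with N1 and N2, each
   giving two components. The function y is a primitive of theta2 / theta2(X),
   so that X y = 1: dividing a form by its value on a symmetry closes it. *)
Record scaled_symmetry (U : set M) (s y : M -> R) : Prop := ScaledSymmetry {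
  ss_open : open U ;
  ss_s : smooth_fun S U s ;
  ss_y : smooth_fun S U y ;
  ss_s0 : forall p, s p != 0 ;
  ss_N1s : forall p, U p ->
    der N1 s p = - ((a2 p * Q p + der N1 P p) / P p) * s p ;
  ss_N1s' : forall p, U p ->
    der N1 s p = - ((a1 p * Q p + der N1 Q p) / Q p) * s p ;
  ss_N2s : forall p, U p ->
    der N2 s p = - ((a2 p * P p + der N2 P p) / P p) * s p ;
  ss_N2s' : forall p, U p ->
    der N2 s p = - ((a1 p * P p + der N2 Q p) / Q p) * s p ;
  ss_N1y : forall p, U p -> der N1 y p = 0 ;
  ss_N2y : forall p, U p -> der N2 y p = - (s p * Q p)^-1 }.

Let sPV : smooth_fun S setT (fun q => (P q)^-1).
Proof. exact: (smooth_funV oT (fun q _ => N2a2_neq0 q) sP). Qed.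

Let der_quot (X Y : vector_field S) h g p : smooth_fun S setT h -> smooth_fun S setT g ->
  der X (fun q => - ((a2 q * h q + g q) * (P q)^-1)) p =
  - ((a2 p * der X h p + der X a2 p * h p + der X g p) * (P p)^-1 +
     (a2 p * h p + g p) * (- der X P p / P p ^+ 2)).
Proof.
move=> sh sg.
have sah := smooth_funM oT sa2 sh.
have sn := smooth_funD oT sah sg.
rewrite (derN X oT (smooth_funM oT sn sPV) I) (derM X oT sn sPV I).
rewrite (derV X oT (fun q _ => N2a2_neq0 q) sP I) (derD X oT sah sg I).
by rewrite (derM X oT sa2 sh I) addrC.
Qed.

(** Two applications of frame_primitive: to the values of N1 (ln s) and N2 (ln s)
   prescribed by the formulas with denominator P, then to 0 and -1/(s Q). The
   first two relations between the invariants say that the formulas with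
   denominator Q prescribe the same values. *)
Lemma scaled_symmetry_exists p0 : exists (U : set M) (s y : M -> R),
  U p0 /\ scaled_symmetry U s y.
Proof.
pose b1 q := - ((a2 q * Q q + der N1 P q) * (P q)^-1).
pose b2 q := - ((a2 q * P q + der N2 P q) * (P q)^-1).
have sb1 : smooth_fun S setT b1.
  exact: smooth_funN oT (smooth_funM oT (smooth_funD oT (smooth_funM oT sa2 sQ) sP1) sPV).
have sb2 : smooth_fun S setT b2.
  exact: smooth_funN oT (smooth_funM oT (smooth_funD oT (smooth_funM oT sa2 sP) sP2) sPV).
have cl p : [set: M] p -> der N1 b2 p - der N2 b1 p = - a2 p * b1 p + a1 p * b2 p.
  move=> _; rewrite (der_quot N1 N1 p sP sP2) (der_quot N2 N2 p sQ sP1).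
  exact: (log_closed_alg (N2a2_neq0 p) (rel2 p) (wf_comm WF oT (I : [set: M] p) sP)).
have [U1 [u [oU1 U1p0 _ su du]]] := frame_primitive WF oT (I : [set: M] p0) sb1 sb2 cl.
pose s q := expR (u q).
have ss : smooth_fun S U1 s by exact: smooth_fun_expR.
have s0 q : s q != 0 by rewrite gt_eqF // expR_gt0.
have N1s p : U1 p -> der N1 s p = - ((a2 p * Q p + der N1 P p) / P p) * s p.
  move=> Up; apply: (etrans (der_expR N1 oU1 su Up)).
  by have [-> _] := du p Up; rewrite mulrC.
have N2s p : U1 p -> der N2 s p = - ((a2 p * P p + der N2 P p) / P p) * s p.
  move=> Up; apply: (etrans (der_expR N2 oU1 su Up)).
  by have [_ ->] := du p Up; rewrite mulrC.
have N1s' p : U1 p -> der N1 s p = - ((a1 p * Q p + der N1 Q p) / Q p) * s p.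
  move=> Up; rewrite (N1s p Up); congr (- _ * _).
  exact: eq_ratio_alg (N2a2_neq0 p) (N1a2_neq0 p) (rel1_alg (rel1 p)).
have N2s' p : U1 p -> der N2 s p = - ((a1 p * P p + der N2 Q p) / Q p) * s p.
  move=> Up; rewrite (N2s p Up); congr (- _ * _).
  exact: eq_ratio_alg (N2a2_neq0 p) (N1a2_neq0 p) (rel2_alg (rel2 p)).
have sub1 : U1 `<=` setT by [].
have sQ1 := smooth_fun_sub sub1 sQ.
have ssQ := smooth_funM oU1 ss sQ1.
have sQ0 q : U1 q -> s q * Q q != 0 by move=> _; rewrite mulf_neq0.
have sV := smooth_funV oU1 sQ0 ssQ.
have cl' p : U1 p -> der N1 (fun q => - (s q * Q q)^-1) p - der N2 (cst 0) p =
    - a2 p * (cst 0 p) + a1 p * - (s p * Q p)^-1.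
  move=> Up; rewrite (der_cst N2 oU1 0 Up) (derN N1 oU1 sV Up).
  rewrite (derV N1 oU1 sQ0 ssQ Up) (derM N1 oU1 ss sQ1 Up) (N1s' p Up).
  exact: parameter_closed_alg.
have [U [y [oU Up0 subU sy dy]]] := frame_primitive WF oU1 U1p0
  (@smooth_fun_cst _ _ S U1 0) (smooth_funN oU1 sV) cl'.
exists U, s, y; split=> //; split=> //.
- exact: smooth_fun_sub subU ss.
- by move=> p /subU; exact: N1s.
- by move=> p /subU; exact: N1s'.
- by move=> p /subU; exact: N2s.
- by move=> p /subU; exact: N2s'.
- by move=> p /dy [].
- by move=> p /dy [].
Qed.

(** X s, X P and X Q all vanish: since X a2 = 0 and X commutes with the frame,
   it kills N1 a2 and N2 a2, and s then follows from the equations. *)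
Lemma symmetry_invariants (U : set M) s y p : scaled_symmetry U s y -> U p ->
  [/\ P p * der N1 Q p - Q p * der N2 Q p = 0,
      P p * der N1 P p - Q p * der N2 P p = 0 &
      P p * der N1 s p - Q p * der N2 s p = 0].
Proof.
move=> H Up.
have [h1 h2 h3] := symmetry_invariants_alg (N2a2_neq0 p) (N1a2_neq0 p) (rel1_alg (rel1 p))
  (rel2_alg (rel2 p)) (wf_comm WF oT (I : [set: M] p) sa2).
split; [exact: h1 | exact: h2 |].
apply: (etrans _ (h3 (s p))); congr (_ * _ - _ * _).
  exact: (ss_N1s H Up).
exact: (ss_N2s H Up).
Qed.

End Solution.

Section Restriction.
Context {R : realType} {M : topologicalType} (S : smooth_surface R M).
Variables (N1 N2 : vector_field S) (a1 a2 : M -> R).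

Lemma scaled_symmetry_sub (U V : set M) (s y : M -> R) : open V -> V `<=` U ->
  scaled_symmetry N1 N2 a1 a2 U s y -> scaled_symmetry N1 N2 a1 a2 V s y.
Proof.
move=> oV VU [oU ss sy s0 h1 h2 h3 h4 h5 h6].
split; first exact: oV.
- exact: smooth_fun_sub VU ss.
- exact: smooth_fun_sub VU sy.
- exact: s0.
- by move=> p /VU; exact: h1.
- by move=> p /VU; exact: h2.
- by move=> p /VU; exact: h3.
- by move=> p /VU; exact: h4.
- by move=> p /VU; exact: h5.
- by move=> p /VU; exact: h6.
Qed.

End Restriction.

(** * The flow in rectifying coordinates *)

Section Rectified.
Context {R : realType}.
Local Notation E := 'rV[R]_2.

Lemma ball_connected (V : normedModType R) (z : V) r : 0 < r -> connected (ball z r).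
Proof.
move=> r0.
have -> : ball z r = \bigcup_(v in ball z r)
    ((fun t : R => z + t *: (v - z)) @` `[0, 1]).
  apply/seteqP; split=> [v Bv|w [v Bv [t]]].
    exists v => //; exists 1; first by rewrite /= in_itv /= ler01 lexx.
    by rewrite scale1r addrC subrK.
  rewrite /= in_itv /= => /andP[t0 t1] <-.
  move: Bv; rewrite -ball_normE /= opprD addNKr normrN normrZ distrC ger0_norm //.
  by apply: le_lt_trans; rewrite ler_piMl.
apply: bigcup_connected.
  exists z => v _; exists 0; first by rewrite /= in_itv /= lexx ler01.
  by rewrite scale0r addr0.
move=> v _; apply: connected_continuous_connected; first exact: segment_connected.
apply: continuous_subspaceT => t.
apply: (@continuousD _ _ _ (fun t : R => z) (fun t : R => t *: (v - z))).
  exact: cst_continuous.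
exact: scalel_continuous.
Qed.

Context {M : topologicalType} (S : smooth_surface R M).

Lemma chart_change_open (Z : normedModType R) (A : set Z) (ka : Z -> E) (c c' : chart S) :
  open A -> (forall z, A z -> img c setT (ka z)) -> smooth_on A ka ->
  open (A `&` [set z | dom c' (param c (ka z))]).
Proof.
move=> oA Aka ska.
have -> : A `&` [set z | dom c' (param c (ka z))] = A `&` ka @^-1` img c (dom c').
  apply/seteqP; split=> z [Az h]; split=> //.
    have [_ h1 h2] := iffLR (imgP _ _ _) (Aka z Az).
    by apply/imgP.
  by have [h1 _ _] := iffLR (imgP _ _ _) h.
apply: smooth_open_preimage => //; apply: open_img; exact: open_dom.
Qed.

Lemma chart_change_smooth (Z : normedModType R) (A : set Z) (ka : Z -> E) (c c' : chart S) :
  open A -> (forall z, A z -> img c setT (ka z)) -> smooth_on A ka ->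
  smooth_on (A `&` [set z | dom c' (param c (ka z))])
    (fun z => coord c' (param c (ka z))).
Proof.
move=> oA Aka ska.
have oA' := chart_change_open c' oA Aka ska.
apply: (smooth_comp oA' _ _ (@tr_smooth R M S c c')).
  move=> z [Az h]; have [_ h1 h2] := iffLR (imgP _ _ _) (Aka z Az).
  by apply/imgP.
by apply: smooth_sub ska => z [].
Qed.

End Rectified.

Section Flow.
Context {R : realType} {M : topologicalType} (S : smooth_surface R M) (W : web3 S).
Variables (k : M -> R) (N1 N2 : vector_field S) (a1 a2 : M -> R).
Hypothesis WF : web_frame W k N1 N2 a1 a2.
Hypotheses (N1a2_neq0 : forall p, der N1 a2 p != 0)
  (N2a2_neq0 : forall p, der N2 a2 p != 0)
  (rel1 : forall p,
     a2 p * der N1 a2 p ^+ 2 + der N1 (der N2 a2) p * der N1 a2 p =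
     a1 p * der N1 a2 p * der N2 a2 p + der N1 (der N1 a2) p * der N2 a2 p)
  (rel2 : forall p,
     a2 p * der N2 a2 p * der N1 a2 p + der N2 (der N2 a2) p * der N1 a2 p =
     a1 p * der N2 a2 p ^+ 2 + der N2 (der N1 a2) p * der N2 a2 p).
Variables (U : set M) (s y : M -> R).
Hypothesis SS : scaled_symmetry N1 N2 a1 a2 U s y.
Local Notation E := 'rV[R]_2.
Implicit Types (p q : M) (f : M -> R).

Local Notation P := (der N2 a2).
Local Notation Q := (der N1 a2).

Let oT : open [set: M]. Proof. exact: openT. Qed.
Let sN1 := wf_N1 WF.
Let sN2 := wf_N2 WF.
Let sa2 := wf_a2 WF.
Let sP : smooth_fun S setT P. Proof. exact: smooth_der. Qed.
Let sQ : smooth_fun S setT Q. Proof. exact: smooth_der. Qed.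
Let oU : open U := ss_open SS.
Let subT : U `<=` setT. Proof. by []. Qed.

Definition symmetry : vector_field S :=
  fun p => s p *: (P p *: N1 p - Q p *: N2 p).
(** The field along which a2 grows at unit rate with y fixed: transversal and
   symmetry are the coordinate fields of (a2, y). *)
Definition transversal : vector_field S :=
  fun p => (Q p)^-1 *: N1 p + 0 *: N2 p.

Lemma symmetryE p : symmetry p = (s p * P p) *: N1 p + (- (s p * Q p)) *: N2 p.
Proof. by rewrite /symmetry scalerBr !scalerA scaleNr. Qed.

Lemma der_symmetry f p :
  der symmetry f p = s p * (P p * der N1 f p - Q p * der N2 f p).
Proof.
apply: (etrans (der_comb f (symmetryE p))).
by rewrite mulrBr !mulrA mulNr.
Qed.

Lemma der_transversal f p : der transversal f p = (Q p)^-1 * der N1 f p.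
Proof.
apply: (etrans (@der_comb _ _ _ N1 N2 f _ _ p _ erefl)).
by rewrite mul0r addr0.
Qed.

Lemma smooth_symmetry : smooth_vf U symmetry.
Proof.
have ss := ss_s SS.
have h1 := smooth_funM oU ss (smooth_fun_sub subT sP).
have h2 := smooth_funN oU (smooth_funM oU ss (smooth_fun_sub subT sQ)).
have := smooth_vf_comb oU (smooth_vf_sub subT sN1) (smooth_vf_sub subT sN2) h1 h2.
by congr (smooth_vf _ _); apply/funext => p; rewrite -symmetryE.
Qed.

Lemma smooth_transversal : smooth_vf U transversal.
Proof.
have h1 := smooth_funV oU (fun q _ => N1a2_neq0 q) (smooth_fun_sub subT sQ).
exact: (smooth_vf_comb oU (smooth_vf_sub subT sN1) (smooth_vf_sub subT sN2) h1
  (@smooth_fun_cst _ _ S U 0)).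
Qed.

Variable c : chart S.
Hypothesis Uc : U `<=` dom c.

(** The rectifying coordinates, read in the chart c: X a2 = 0 and X y = 1. *)
Definition rect (x : E) : E := pt (a2 (param c x)) (y (param c x)).

Let oI : open (img c U). Proof. exact: open_img. Qed.

Lemma smooth_rect : smooth_on (img c U) rect.
Proof.
have h1 := smooth_fun_sub subT sa2 c.
have h2 := ss_y SS c.
have t1 := smoothZ oI h1 (@smooth_cst R E E (img c U) e0).
have t2 := smoothZ oI h2 (@smooth_cst R E E (img c U) e1).
exact: smoothD oI t1 t2.
Qed.

Lemma diff_rect (X : vector_field S) p : U p ->
  'd rect (coord c p) (vf_rep c X (coord c p)) = pt (der X a2 p) (der X y p).
Proof.
move=> Up; have Ip : img c U (coord c p) by apply: img_coord => //; exact: Uc.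
have d1 := smooth_is_diff (smooth_fun_sub subT sa2 c) Ip.
have d2 := smooth_is_diff (ss_y SS c) Ip.
have D := is_diffD (is_diff_Zvec d1 (is_diff_cst (e0 : E) _))
                   (is_diff_Zvec d2 (is_diff_cst (e1 : E) _)).
have [_ HE] := D.
have := congr1 (fun L : E -> E => L (vf_rep c X (coord c p))) HE.
rewrite (der_rep X oU (smooth_fun_sub subT sa2) Up (Uc Up)).
rewrite (der_rep X oU (ss_y SS) Up (Uc Up)).
by move=> ->; rewrite !fctE !scaler0 !add0r.
Qed.

Lemma diff_rect_frame x : img c U x ->
  'd rect x (vf_rep c transversal x) = e0 /\ 'd rect x (vf_rep c symmetry x) = e1.
Proof.
move=> /imgP [Up cp <-]; move: (param c x) Up cp => p Up cp.
rewrite !diff_rect // !der_transversal !der_symmetry.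
rewrite (ss_N1y SS Up) (ss_N2y SS Up) mulVf // mulr0 mulr0 sub0r.
have -> : s p * (P p * Q p - Q p * P p) = 0 by rewrite mulrC [Q p * _]mulrC subrr mul0r.
have -> : s p * - (Q p * - (s p * Q p)^-1) = 1.
  by rewrite !mulrN opprK mulrA divff // mulf_neq0 //; exact: ss_s0 SS p.
by rewrite /pt !scale0r !scale1r addr0 add0r.
Qed.

Variables (B : set E) (z0 : E) (r : R) (Psi : E -> E).
Local Notation D := (ball z0 r).
Hypotheses (r0 : 0 < r) (oB : open B) (BU : B `<=` img c U)
  (rectB : forall x, B x -> D (rect x) /\ Psi (rect x) = x)
  (PsiD : forall z, D z -> B (Psi z) /\ rect (Psi z) = z)
  (sPsi : smooth_on D Psi)
  (dPsi : forall z, D z -> is_diff z Psi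
     (comb (vf_rep c transversal (Psi z)) (vf_rep c symmetry (Psi z)))).

Definition flow_box : set M := dom c `&` coord c @^-1` B.
Definition kappa (t : R) (x : E) : E := Psi (rect x + t *: e1).
Definition phi (t : R) (q : M) : M := param c (kappa t (coord c q)).

Let oD : open D. Proof. exact: ball_open. Qed.

Lemma open_flow_box : open flow_box.
Proof.
apply: open_setI_preimage => //; first exact: open_dom.
by move=> p cp; exact: coord_continuous.
Qed.

Lemma flow_box_sub : flow_box `<=` U.
Proof. by move=> p [cp /BU /imgP [h _ _]]; move: h; rewrite coordK. Qed.

Lemma flow_box_param x : B x -> [/\ flow_box (param c x), dom c (param c x) &
  coord c (param c x) = x].
Proof.
move=> Bx; have [h1 h2 h3] := iffLR (imgP _ _ _) (BU Bx).
by split=> //; split=> //; rewrite /= h3.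
Qed.

Lemma flow_box_connected : connected flow_box.
Proof.
have -> : flow_box = (param c \o Psi) @` D.
  apply/seteqP; split=> [p [cp Bp]|p [z Dz <-]].
    have [h1 h2] := rectB Bp; exists (rect (coord c p)) => //=.
    by rewrite h2 coordK.
  by have [h _] := PsiD Dz; have [] := flow_box_param h.
apply: connected_continuous_connected; first exact: ball_connected.
apply: continuous_in_subspaceT => z; rewrite inE => Dz.
apply: (@continuous_comp _ _ _ Psi (param c)).
  exact: smooth_continuous sPsi Dz.
have [/BU h _] := PsiD Dz; exact: img_continuous h.
Qed.

(** The translate by t stays in the disc where Psi inverts rect, so that phi t q
   is the point reached from q. *)
Definition inflow t q := D (rect (coord c q) + t *: e1).

Lemma phiP t q : inflow t q ->
  [/\ flow_box (phi t q), coord c (phi t q) = kappa t (coord c q) &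
      rect (coord c (phi t q)) = rect (coord c q) + t *: e1].
Proof.
move=> Dq; have [h1 h2] := PsiD Dq.
by have [h3 h4 h5] := flow_box_param h1; split=> //; rewrite /phi h5.
Qed.

Lemma phi0 q : flow_box q -> phi 0 q = q.
Proof.
move=> [cq Bq]; rewrite /phi /kappa scale0r addr0.
by have [_ ->] := rectB Bq; rewrite coordK.
Qed.

Lemma phiD t t' q : inflow t' q -> phi t (phi t' q) = phi (t + t') q.
Proof.
move=> /phiP [h1 h2 h3]; rewrite {1}/phi /kappa h3 -addrA -scalerDl.
by rewrite [t' + t]addrC.
Qed.

(** The flow translates rect, hence carries a slab onto the translated slab; so
   the images under the flow, which have to be open, are explicit. *)
Definition slab (w : E) (rho : R) : set M :=
  flow_box `&` [set q | ball w rho (rect (coord c q))].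

Lemma box_rect_continuous q : flow_box q ->
  {for q, continuous (fun q => rect (coord c q))}.
Proof.
move=> [cq Bq]; apply: (@continuous_comp _ _ _ (coord c) rect).
  exact: coord_continuous.
exact: smooth_continuous smooth_rect (BU Bq).
Qed.

Lemma open_slab w rho : open (slab w rho).
Proof.
apply: (@open_setI_preimage _ _ flow_box (ball w rho) (fun q => rect (coord c q))).
- exact: open_flow_box.
- exact: ball_open.
- exact: box_rect_continuous.
Qed.

Lemma kappa_is_diff t q : inflow t q ->
  is_diff t (fun r => kappa r (coord c q))
    (fun r : R => r *: vf_rep c symmetry (kappa t (coord c q))).
Proof.
move=> Dq.
have dl : is_diff t (fun r : R => rect (coord c q) + r *: e1) (fun r : R => r *: e1).
  apply: eq_is_diff (is_diffD (is_diff_cst (rect (coord c q)) t)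
    (is_diff_scalel t (e1 : E))) _ _ => // v.
  by rewrite fctE add0r.
apply: eq_is_diff (is_diff_comp dl (dPsi Dq)) _ _ => // v.
rewrite /= /comb; have -> : (v *: e1 : E) 0 0 = 0 by rewrite !mxE mulr0.
have -> : (v *: e1 : E) 0 1 = v by rewrite !mxE mulr1.
by rewrite scale0r add0r.
Qed.

Lemma phi_is_derive t q : inflow t q ->
  is_derive t (1 : R) (fun r => coord (chart_at S (phi t q)) (phi r q))
            (symmetry (phi t q)).
Proof.
move=> Dq; have [hb hc hr] := phiP Dq.
set p := phi t q in hb hc hr *; have cp : dom c p by case: hb.
have It : img c (dom (chart_at S p)) (kappa t (coord c q)).
  by rewrite -hc; exact: img_at.
have dt := is_diff_comp (kappa_is_diff Dq) (tr_is_diff It).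
have := @is_diff_is_derive _ _ _ _ _ (1 : R) _ dt.
congr (is_derive _ _ _ _).
rewrite /= scale1r -hc; exact: vf_repK.
Qed.

Lemma phi_invariant f t q : smooth_fun S U f ->
  (forall p, U p -> der symmetry f p = 0) ->
  (forall t', `|t'| <= `|t| -> inflow t' q) -> flow_box q -> f (phi t q) = f q.
Proof.
move=> sf f0 Dq bq.
have dg (t' : R) : `|t'| <= `|t| -> is_derive t' 1 (fun r => f (phi r q)) 0.
  move=> /Dq Dt'; have [hb hc hr] := phiP Dt'.
  set p := phi t' q in hb hc hr *; have cp : dom c p by case: hb.
  have Up : U p by exact: flow_box_sub.
  have df : is_diff (kappa t' (coord c q)) (f \o param c)
      ('d (f \o param c) (coord c p)).
    by rewrite -hc; exact: smooth_fun_is_diff.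
  have := @is_diff_is_derive _ _ _ _ _ (1 : R) _ (is_diff_comp (kappa_is_diff Dt') df).
  congr (is_derive _ _ _ _); rewrite /= scale1r -hc.
  apply: (etrans _ (f0 p Up)); apply/esym; exact: (der_rep symmetry oU sf Up cp).
have [t' _ /eqP] := mean_value_0 dg.
by rewrite mulr0 subr_eq0 phi0 // => /eqP.
Qed.

Lemma vf_rep_comb (X Y Z : vector_field S) a b p : dom c p ->
  Z p = a *: X p + b *: Y p ->
  vf_rep c Z (coord c p) = a *: vf_rep c X (coord c p) + b *: vf_rep c Y (coord c p).
Proof. by move=> cp HZ; rewrite !vf_repE // HZ linearD !linearZ. Qed.

Let inv_alg (P0 Q0 s0 n m : R) : Q0 != 0 -> s0 != 0 ->
  P0 * (Q0^-1 * n + 0 * m) + - (s0 * Q0)^-1 * ((s0 * P0) * n + - (s0 * Q0) * m) = m.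
Proof. by move=> h1 h2; field; rewrite h1 h2. Qed.

(** In rectifying coordinates the flow is a translation and the frame has
   coefficients depending on P, Q and s only, which are constant along it. *)
Lemma phi_frame t q : flow_box q -> (forall t', `|t'| <= `|t| -> inflow t' q) ->
  is_diff (coord c q) (kappa t) ('d (kappa t) (coord c q)) /\
  ('d (kappa t) (coord c q) (vf_rep c N1 (coord c q)) =
     vf_rep c N1 (coord c (phi t q)) /\
   'd (kappa t) (coord c q) (vf_rep c N2 (coord c q)) =
     vf_rep c N2 (coord c (phi t q))).
Proof.
move=> bq Dq; have Uq := flow_box_sub bq; have cq : dom c q by case: bq.
have Dt : inflow t q by apply: Dq.
have [hb hc hr] := phiP Dt.
have inv f : smooth_fun S U f ->
    (forall p, U p -> P p * der N1 f p - Q p * der N2 f p = 0) -> f (phi t q) = f q.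
  move=> sf f0; apply: phi_invariant => // p Up.
  by rewrite der_symmetry f0 ?mulr0.
have EQ : Q (phi t q) = Q q.
  apply: inv; first exact: smooth_fun_sub subT sQ.
  by move=> p Up; have [] := symmetry_invariants WF N1a2_neq0 N2a2_neq0 rel1 rel2 SS Up.
have EP : P (phi t q) = P q.
  apply: inv; first exact: smooth_fun_sub subT sP.
  by move=> p Up; have [] := symmetry_invariants WF N1a2_neq0 N2a2_neq0 rel1 rel2 SS Up.
have ES : s (phi t q) = s q.
  apply: inv; first exact: ss_s SS.
  by move=> p Up; have [] := symmetry_invariants WF N1a2_neq0 N2a2_neq0 rel1 rel2 SS Up.
set p := phi t q in hb hc hr EQ EP ES *; have cp : dom c p by case: hb.
have Iq : img c U (coord c q) by exact: img_coord.
have dG := smooth_is_diff smooth_rect Iq.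
have dl : is_diff (coord c q) (fun x => rect x + t *: e1) ('d rect (coord c q)).
  apply: eq_is_diff (is_diffD dG (is_diff_cst (t *: e1 : E) (coord c q))) _ _.
    by move=> x; rewrite fctE.
  by move=> v; rewrite fctE addr0.
pose x' := kappa t (coord c q).
have dP : is_diff ((fun x => rect x + t *: e1) (coord c q)) Psi
    (comb (vf_rep c transversal x') (vf_rep c symmetry x')) by exact: (dPsi Dt).
have dk : is_diff (coord c q) (kappa t)
    (comb (vf_rep c transversal x') (vf_rep c symmetry x') \o 'd rect (coord c q)).
  exact: (is_diff_comp dl dP).
have [dk1 HE] := dk.
have dK : is_diff (coord c q) (kappa t) ('d (kappa t) (coord c q)).
  exact: (differentiableP dk1).
have T0 : vf_rep c transversal x' =
    (Q q)^-1 *: vf_rep c N1 (coord c p) + 0 *: vf_rep c N2 (coord c p).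
  by rewrite /x' -hc -EQ; exact: vf_rep_comb.
have T1 : vf_rep c symmetry x' =
    (s q * P q) *: vf_rep c N1 (coord c p) + (- (s q * Q q)) *: vf_rep c N2 (coord c p).
  rewrite /x' -hc -EQ -EP -ES.
  exact: (vf_rep_comb cp (symmetryE p)).
have HEv v := congr1 (fun L : E -> E => L v) HE.
have G1 := etrans (diff_rect N1 Uq) (congr1 (pt (Q q)) (ss_N1y SS Uq)).
have G2 := etrans (diff_rect N2 Uq) (congr1 (pt (P q)) (ss_N2y SS Uq)).
have Q0 := N1a2_neq0 q; have s0 := ss_s0 SS q.
move: T0 T1 G1 G2 HEv Q0 s0.
move: (vf_rep c transversal x') (vf_rep c symmetry x').
move: (P q) (Q q) (s q) => Pq Qq sq Tx Xx T0 T1 G1 G2 HEv Q0 s0.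
split; first exact: dK.
split; apply: (etrans (HEv _)).
  apply: (etrans (congr1 (comb Tx Xx) G1)).
  apply: (etrans (comb_pt _ _ _ _)).
  rewrite T0 T1.
  move: (vf_rep c N1 _) (vf_rep c N2 _) => n m.
  apply/rowP => i; rewrite !mxE.
  by field.
apply: (etrans (congr1 (comb Tx Xx) G2)).
apply: (etrans (comb_pt _ _ _ _)).
rewrite T0 T1.
move: (vf_rep c N1 _) (vf_rep c N2 _) => n m.
apply/rowP => i; rewrite !mxE.
exact: inv_alg.
Qed.

Let linear3 (f g h : {linear E -> E}) a b u w :
  f (g (h (a *: u + b *: w))) = a *: f (g (h u)) + b *: f (g (h w)).
Proof. by rewrite !linearD !linearZ. Qed.

(** By phi_frame the flow sends the frame to the frame, so it even preserves the
   values of theta1 and theta2. *)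
Lemma phi_tangent t q v : flow_box q -> (forall t', `|t'| <= `|t| -> inflow t' q) ->
  tangent_map S (phi t) q v =
  pairing (theta1 W k q) v *: N1 (phi t q) + pairing (theta2 W k q) v *: N2 (phi t q).
Proof.
move=> bq Dq; have cq : dom c q by case: bq.
have Dt : inflow t q by apply: Dq.
have [hb hc hr] := phiP Dt.
have [dK [K1 K2]] := phi_frame bq Dq.
set p := phi t q in hb hc hr K1 K2 *; have cp : dom c p by case: hb.
have It : img c (dom (chart_at S p)) (kappa t (coord c q)).
  by rewrite -hc; exact: img_at.
have d1 := tr_is_diff (at_img cq).
have d2 : is_diff (tr (chart_at S q) c (at_coord S q)) (kappa t)
    ('d (kappa t) (coord c q)).
  by rewrite tr_at.
have d3 : is_diff (kappa t (tr (chart_at S q) c (at_coord S q)))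
    (tr c (chart_at S p)) ('d (tr c (chart_at S p)) (coord c p)).
  by rewrite tr_at hc; exact: tr_is_diff.
have [_ HE] := is_diff_comp (is_diff_comp d1 d2) d3.
apply: (etrans (congr1 (fun L : E -> E => L v) HE)).
pose dtr := 'd (tr c (chart_at S p)) (coord c p).
pose dka := 'd (kappa t) (coord c q).
pose dtr' := 'd (tr (chart_at S q) c) (at_coord S q).
apply: (etrans (congr1 (fun z => dtr (dka (dtr' z))) (wf_expand WF q v))).
apply: (etrans (linear3 dtr dka dtr' _ _ _ _)).
congr (_ *: _ + _ *: _).
  apply: (etrans (congr1 (fun z => dtr (dka z)) (esym (vf_repE N1 cq)))).
  exact: (etrans (congr1 dtr K1) (vf_repK N1 cp)).
apply: (etrans (congr1 (fun z => dtr (dka z)) (esym (vf_repE N2 cq)))).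
exact: (etrans (congr1 dtr K2) (vf_repK N2 cp)).
Qed.

Lemma phi_continuous (Z : topologicalType) (f : Z -> R) (g : Z -> M) z :
  {for z, continuous f} -> {for z, continuous g} ->
  flow_box (g z) -> inflow (f z) (g z) ->
  {for z, continuous (fun z => phi (f z) (g z))}.
Proof.
move=> cf cg bq Dq.
apply: (@continuous_comp _ _ _ (fun z => kappa (f z) (coord c (g z))) (param c)).
  apply: (@continuous_comp _ _ _ (fun z => rect (coord c (g z)) + f z *: e1) Psi).
    apply: (@continuousD _ _ _ (fun z => rect (coord c (g z))) (fun z => f z *: e1)).
      apply: (@continuous_comp _ _ _ g (fun q => rect (coord c q))) => //.
      exact: box_rect_continuous.
    by apply: continuousZr_tmp; exact: cf.
  exact: smooth_continuous sPsi Dq.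
apply: (@img_continuous _ _ _ c U).
by apply: BU; have [] := PsiD Dq.
Qed.

Lemma smooth_kappa (Z : normedModType R) (A : set Z) (c' : chart S)
    (f : Z -> R) (g : Z -> E) : open A ->
  smooth_on A f -> smooth_on A g ->
  (forall z, A z -> [/\ img c' setT (g z), flow_box (param c' (g z)) &
     inflow (f z) (param c' (g z))]) ->
  (forall z, A z -> img c setT (kappa (f z) (tr c' c (g z)))) /\
  smooth_on A (fun z => kappa (f z) (tr c' c (g z))).
Proof.
move=> oA sf sg HA; split.
  move=> z /HA [h1 h2 h3]; have [/BU h _] := PsiD h3.
  exact: img_sub h.
have s1 : smooth_on A (fun z => tr c' c (g z)).
  apply: (smooth_comp oA _ sg (@tr_smooth _ _ S c' c)) => z /HA [h1 [h2 _] _].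
  by apply/imgP; have [] := iffLR (imgP _ _ _) h1.
have s2 : smooth_on A (fun z => rect (tr c' c (g z))).
  apply: (smooth_comp oA _ s1 smooth_rect) => z /HA [_ [_ h2] _].
  exact: BU.
have s3 : smooth_on A (fun z => rect (tr c' c (g z)) + f z *: e1).
  exact: smoothD oA s2 (smoothZ oA sf (@smooth_cst R Z E A e1)).
apply: (smooth_comp oA _ s3 sPsi) => z /HA [_ _]; exact.
Qed.

Lemma phi_smooth_map (V : set M) t : open V ->
  (forall q, V q -> flow_box q /\ inflow t q) -> smooth_map S V (phi t).
Proof.
move=> oV HV; split=> [p /HV [bp Dp]|c1 c2].
  have cid : {for p, continuous (id : M -> M)} by move=> A hA; exact: hA.
  have ct : {for p, continuous ((fun=> t) : M -> R)} by exact: cst_continuous.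
  exact: phi_continuous ct cid bp Dp.
have oA : open (img c1 V) by exact: open_img.
have HA x : img c1 V x -> [/\ img c1 setT x, flow_box (param c1 x) &
     inflow t (param c1 x)].
  move=> h; have [/HV [h1 h2] _ _] := iffLR (imgP _ _ _) h.
  by split=> //; exact: img_sub h.
have [h1 h2] := smooth_kappa oA (@smooth_cst R E R (img c1 V) t)
  (@smooth_id R E (img c1 V)) HA.
apply: smooth_sub (chart_change_smooth c2 oA h1 h2).
move=> x [p [[Vp cp] c2p] <-]; split; first exact: img_coord.
by rewrite /= /tr /= coordK.
Qed.

Lemma phi_local_flow (V : set M) (eps : R) : open V -> 0 < eps ->
  (forall t q, `|t| < eps -> V q -> flow_box q /\ inflow t q) ->
  local_flow flow_box symmetry V eps phi.
Proof.
move=> oV eps0 HV; split.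
- by move=> t q /HV h /h [_ /phiP []].
- move=> t q te Vq; have [h1 h2] := HV t q te Vq.
  have cf : {for (t, q), continuous (fst : R * M -> R)} by exact: cvg_fst.
  have cg : {for (t, q), continuous (snd : R * M -> M)} by exact: cvg_snd.
  exact: phi_continuous cf cg h1 h2.
- move=> c1 c2.
  pose A : set (R * E) := (setT `&` fst @^-1` ball 0 eps) `&` snd @^-1` img c1 V.
  have oA : open A.
    apply: open_setI_preimage; last by move=> z _; exact: cvg_snd.
      apply: open_setI_preimage; [exact: openT | exact: ball_open |].
      by move=> z _; exact: cvg_fst.
    exact: open_img.
  have sfst : smooth_on A (fst : R * E -> R).
    by apply: smooth_linear => // z; exact: cvg_fst.
  have ssnd : smooth_on A (snd : R * E -> E).
    by apply: smooth_linear => // z; exact: cvg_snd.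
  have HA z : A z -> [/\ img c1 setT z.2, flow_box (param c1 z.2) &
     inflow z.1 (param c1 z.2)].
    move=> [[_ h1] h2]; have te : `|z.1| < eps.
      by move: h1; rewrite /= -ball_normE /= sub0r normrN.
    have [Vp _ _] := iffLR (imgP _ _ _) h2.
    by have [h3 h4] := HV _ _ te Vp; split=> //; exact: img_sub h2.
  have [h1 h2] := smooth_kappa oA sfst ssnd HA.
  apply: smooth_sub (chart_change_smooth c2 oA h1 h2).
  move=> z [h3 h4 h5]; split=> //; split=> //; split=> //.
  by rewrite /= -ball_normE /= sub0r normrN.
- move=> q Vq; have [h1 _] := HV 0 q (eq_ind_r (fun x => x < eps) eps0 (normr0 _)) Vq.
  exact: phi0.
- move=> t t' q te t'e _ Vq _; have [_ h] := HV t' q t'e Vq.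
  by rewrite phiD.
- by move=> t q te Vq; have [_ h] := HV t q te Vq; exact: phi_is_derive.
Qed.

Lemma phi_preserves_web (V : set M) t :
  (forall q, V q -> flow_box q) ->
  (forall t' q, `|t'| <= `|t| -> V q -> inflow t' q) ->
  preserves_web W V (phi t).
Proof.
move=> bV DV w Hw q v Vq wv0.
rewrite (phi_tangent v (bV q Vq) (fun t' ht => DV t' q ht Vq)) pairing_comb.
have [h11 h21 h12 h22] := wf_dual WF (phi t q).
rewrite !pairingZl.
case: Hw wv0 => ->.
- by move=> ->; rewrite h12 mulr0 mul0r mulr0 addr0.
- by move=> ->; rewrite h21 mulr0 mulr0 mul0r addr0.
- rewrite !web_form3 h11 h21 h12 h22 add0r addr0 => /eqP; rewrite oppr_eq0 addr_eq0 => /eqP ->.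
  by rewrite !mulrN !mulNr opprK subrr.
Qed.

Lemma slab_image w rho t :
  (forall q, slab w rho q -> inflow t q) ->
  (forall q, slab (w + t *: e1) rho q -> inflow (- t) q) ->
  phi t @` slab w rho = slab (w + t *: e1) rho.
Proof.
move=> H1 H2; apply/seteqP; split=> [p [q Vq <-]|p Vp].
  have [h1 h2 h3] := phiP (H1 q Vq); split=> //=.
  move: Vq => [_ /=]; rewrite h3 -!ball_normE /=.
  by move: (rect _) (t *: e1) => g h; rewrite opprD addrACA subrr addr0.
exists (phi (- t) p).
  have [h1 h2 h3] := phiP (H2 p Vp); split=> //=.
  move: Vp => [_ /=]; rewrite h3 -!ball_normE /= scaleNr.
  by move: (rect _) (t *: e1) => g h; rewrite opprB addrA.
rewrite (phiD t (H2 p Vp)) subrr phi0 //.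
by case: Vp.
Qed.

Lemma symmetry_automorphism : inf_automorphism W flow_box symmetry.
Proof.
split; first exact: smooth_vf_sub flow_box_sub smooth_symmetry.
move=> p bp; set z := rect (coord c p).
have Dz : D z by case: bp => _ /rectB [].
(* half of the room around z is for the slab, the other half for the motion *)
have [rho0 /= rho00 Hrho] := iffLR (nbhs_ballP _ _) (open_nbhs_nbhs (conj oD Dz)).
pose rho := rho0 / 2; have rhop : 0 < rho by rewrite divr_gt0.
have rhoE : rho0 = rho + rho by rewrite /rho; lra.
have n1 : `|e1 : E| <= 1.
  apply: norm_row_le => // j; rewrite mxE /=.
  by case: (j == 1); rewrite ?normr1 ?normr0.
have DV t q : `|t| < rho -> slab z rho q -> inflow t q.
  move=> te [_ /=]; rewrite -ball_normE /= => hq; apply: Hrho; move: hq.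
  move: (rect _) => g hq.
  rewrite -ball_normE /= opprD addrA rhoE (le_lt_trans (ler_normB _ _)) //.
  by rewrite ltrD // normrZ (le_lt_trans _ te) // ler_piMr.
exists (slab z rho), rho, phi; split.
  split=> //.
  - exact: open_slab.
  - by split=> //; exact: ballxx.
  - by move=> q [].
  - apply: phi_local_flow => //; first exact: open_slab.
    by move=> t q te Vq; split; [case: Vq | exact: DV].
move=> t te; have DVt q : slab z rho q -> inflow t q by exact: DV.
have DVt' q : slab (z + t *: e1) rho q -> inflow (- t) q.
  move=> [_ /=]; rewrite -ball_normE /= => hq; apply: Hrho; move: hq.
  move: (rect _) => g hq.
  rewrite -ball_normE /= scaleNr opprB addrA rhoE.
  by rewrite (lt_trans hq) // ltrDl.
split; last first.
  apply: phi_preserves_web; first by move=> q [].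
  by move=> t' q ht; apply: DV; exact: le_lt_trans te.
split.
- apply: phi_smooth_map; first exact: open_slab.
  by move=> q Vq; split; [case: Vq | exact: DVt].
- by rewrite (slab_image DVt DVt'); exact: open_slab.
- rewrite (slab_image DVt DVt'); exists (phi (- t)).
    apply: phi_smooth_map; first exact: open_slab.
    by move=> q Vq; split; [case: Vq | exact: DVt'].
  move=> q Vq; rewrite (phiD (- t) (DVt q Vq)) addNr phi0 //.
  by case: Vq.
Qed.

End Flow.

(** * Infinitesimal automorphisms *)

(** diff_sym is about real functions; the flow in a chart takes values in the
   plane. *)
Lemma diff_sym_row (R : realType) (V : normedModType R) n (A : set V)
    (f : V -> 'rV[R]_n) x u v : open A -> smooth_on A f -> A x ->
  'd (fun y => 'd f y u) x v = 'd (fun y => 'd f y v) x u.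
Proof.
move=> oA sf Ax; apply/rowP => j.
have sfj : smooth_on A (fun y => f y 0 j : R) by exact: smooth_coord.
have E w : forall y, A y -> 'd f y w 0 j = 'd (fun y => f y 0 j : R) y w.
  move=> y Ay; have [_ HE] := is_diff_coord 0 j (smooth_is_diff sf Ay).
  exact: esym (congr1 (fun L : V -> R => L w) HE).
have F a b : 'd (fun y => 'd f y a) x b 0 j =
    'd (fun y => 'd (fun y => f y 0 j : R) y a) x b.
  have d1 := is_diff_coord 0 j (smooth_is_diff (smooth_diff a sf) Ax).
  have near_x : \forall y \near x, 'd f y a 0 j = 'd (fun y => f y 0 j : R) y a.
    have : \forall y \near x, A y by exact: open_nbhs_nbhs.
    by apply: filterS => y; exact: E.
  have [_ HE] := near_eq_is_diff near_x d1.
  exact: esym (congr1 (fun L : V -> R => L b) HE).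
apply: (etrans (F u v)); apply: (etrans _ (esym (F v u))).
exact: diff_sym oA (sfj 2%N) Ax.
Qed.

Section LieCondition.
Context {R : realType} {M : topologicalType} (S : smooth_surface R M) (W : web3 S).
Local Notation E := 'rV[R]_2.
Variables (U V : set M) (Y : vector_field S) (eps : R) (psi : R -> M -> M) (p : M).
Hypotheses (oV : open V) (Vp : V p) (eps0 : 0 < eps)
  (FL : local_flow U Y V eps psi).

Let c := chart_at S p.
Let x : E := at_coord S p.
(* the flow in the preferred chart of p, a function of time and place *)
Let Phi (z : R * E) : E := coord c (psi z.1 (param c z.2)).
Let A : set (R * E) := (setT `&` fst @^-1` ball 0 eps) `&` snd @^-1` img c V.
Let D : set (R * E) := A `&` (fun z => psi z.1 (param c z.2)) @^-1` dom c.

Let AP z : A z <-> `|z.1| < eps /\ img c V z.2.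
Proof.
rewrite /A /= -ball_normE /= sub0r normrN; split=> [[[_ ?] ?]|[? ?]] //.
Qed.

Let oA : open A.
Proof.
apply: open_setI_preimage; last by move=> z _; exact: cvg_snd.
  apply: open_setI_preimage; [exact: openT | exact: ball_open |].
  by move=> z _; exact: cvg_fst.
exact: open_img.
Qed.

Let oD : open D.
Proof.
apply: open_setI_preimage => //; first exact: open_dom.
move=> z /AP [te Iz].
have [Vq _ _] := iffLR (imgP _ _ _) Iz.
have cq := flow_continuous FL te Vq.
apply: (@continuous_comp _ _ _ (fun z : R * E => (z.1, param c z.2))
  (fun z : R * M => psi z.1 z.2)) => //.
have cs : {for z, continuous (fun z : R * E => param c z.2)}.
  apply: (@continuous_comp _ _ _ snd (param c)); first exact: cvg_snd.
  exact: img_continuous Iz.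
have cf : {for z, continuous (fst : R * E -> R)} by exact: cvg_fst.
exact: (cvg_pair cf cs).
Qed.

Let sPhi : smooth_on D Phi.
Proof.
apply: smooth_sub (flow_smooth FL c c) => z [/AP [h1 h2] h3].
by split.
Qed.

Let cp : dom c p. Proof. exact: dom_chart_at. Qed.
Let Ix : img c V x. Proof. exact: img_coord. Qed.

Let n0 : `|0 : R| < eps. Proof. by rewrite normr0. Qed.

Let D0 z : img c V z -> D (0, z).
Proof.
move=> Iz; have [Vq h2 _] := iffLR (imgP _ _ _) Iz.
by split; [apply/AP | rewrite /= (flow0 FL)].
Qed.

Let Phi0 z : img c V z -> Phi (0, z) = z.
Proof.
move=> Iz; have [Vq h2 h3] := iffLR (imgP _ _ _) Iz.
by rewrite /Phi /= (flow0 FL).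
Qed.

Let dPhi z : D z -> is_diff z Phi ('d Phi z).
Proof. exact: smooth_is_diff sPhi. Qed.

Let near_img z : img c V z -> \forall z' \near z, img c V z'.
Proof. by move=> Iz; apply: open_nbhs_nbhs; split=> //; exact: open_img. Qed.

Let is_diff_pairL (t : R) (z : E) :
  is_diff z (fun z : E => (t, z)) (fun v : E => (0 : R, v)).
Proof. exact: (is_diff_pair (is_diff_cst t z) (is_diff_id z)). Qed.

Let is_diff_pairR (t : R) (z : E) :
  is_diff t (fun t : R => (t, z)) (fun v : R => (v, 0 : E)).
Proof. exact: (is_diff_pair (is_diff_id t) (is_diff_cst z t)). Qed.

Let dPhi_space v : 'd Phi (0, x) (0, v) = v.
Proof.
have dc := is_diff_comp (is_diff_pairL 0 x) (dPhi (D0 Ix)).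
have near_x : \forall z \near x, id z = (Phi \o (fun z => (0, z))) z.
  by apply: filterS (near_img Ix) => z Iz /=; rewrite Phi0.
have [_ E1] := near_eq_is_diff near_x (is_diff_id x).
have [_ E2] := dc.
have H1 := congr1 (fun L : E -> E => L v) E1.
have H2 := congr1 (fun L : E -> E => L v) E2.
exact: (etrans (esym H2) H1).
Qed.

Let dPhi_time z : img c V z -> 'd Phi (0, z) (1, 0) = vf_rep c Y z.
Proof.
move=> Iz; have [Vq cq Ez] := iffLR (imgP _ _ _) Iz.
set q := param c z in Vq cq Ez.
have vel := flow_velocity FL n0 Vq.
have E0 : psi 0 q = q by exact: (flow0 FL).
rewrite E0 in vel.
have d1 := is_derive_is_diff vel.
have d2 : is_diff (coord (chart_at S q) (psi 0 q)) (tr (chart_at S q) c)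
    ('d (tr (chart_at S q) c) (at_coord S q)).
  by rewrite E0; apply: tr_is_diff; exact: at_img.
have near0 : \forall t \near (0 : R),
   (tr (chart_at S q) c \o (fun t => coord (chart_at S q) (psi t q))) t =
   (Phi \o (fun t => (t, z))) t.
  have ct : {for (0 : R), continuous (fun t : R => psi t q)}.
    apply: (@continuous_comp _ _ _ (fun t : R => (t, q)) (fun z : R * M => psi z.1 z.2)).
      have cid : {for (0 : R), continuous (fun t : R => t)} by exact: cvg_id.
      have cc : {for (0 : R), continuous (fun t : R => q)} by exact: cst_continuous.
      exact: (cvg_pair cid cc).
    exact: (flow_continuous FL n0 Vq).
  have : nbhs (psi 0 q) (dom (chart_at S q)).
    apply: open_nbhs_nbhs; split; first exact: open_dom.
    by rewrite E0; exact: dom_chart_at.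
  move=> /ct H0.
  have H1 : \forall t \near (0 : R), dom (chart_at S q) (psi t q) by exact: H0.
  apply: filterS H1 => t h.
  by rewrite /tr /= coordK.
have [_ E1] := near_eq_is_diff near0 (is_diff_comp d1 d2).
have [_ E2] := is_diff_comp (is_diff_pairR 0 z) (dPhi (D0 Iz)).
have H1 := congr1 (fun L : R -> E => L 1) E1.
have H2 := congr1 (fun L : R -> E => L 1) E2.
apply: (etrans (esym H2)); apply: (etrans H1) => /=.
rewrite scale1r -(vf_repE Y cq).
by congr (vf_rep c Y _).
Qed.

Let near_t : \forall t \near (0 : R), D (t, x).
Proof.
have cR : {for (0 : R), continuous (fun t : R => (t, x))}.
  by case: (is_diff_pairR 0 x) => /differentiable_continuous.
have : nbhs ((fun t : R => (t, x)) 0) D.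
  by apply: open_nbhs_nbhs; split; [exact: oD | exact: D0].
by move=> /cR.
Qed.

Let near_z t : D (t, x) -> \forall z \near x, D (t, z).
Proof.
move=> Dt; have cL : {for x, continuous (fun z : E => (t, z))}.
  by case: (is_diff_pairL t x) => /differentiable_continuous.
have : nbhs ((fun z : E => (t, z)) x) D.
  by apply: open_nbhs_nbhs; split; [exact: oD | exact: Dt].
by move=> /cL.
Qed.

Let tangent_rep t v (w : one_form S) : D (t, x) ->
  pairing (w (psi t p)) (tangent_map S (psi t) p v) =
  pairing (form_rep c w (Phi (t, x))) ('d Phi (t, x) (0, v)).
Proof.
move=> Dt; have [_ ct] := Dt; rewrite /= coordK // in ct.
have PE : Phi (t, x) = coord c (psi t p) by rewrite /Phi /= coordK.
have d1 := is_diff_comp (is_diff_pairL t x) (dPhi Dt).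
have d2 : is_diff (Phi (t, x)) (tr c (chart_at S (psi t p)))
    ('d (tr c (chart_at S (psi t p))) (coord c (psi t p))).
  by rewrite PE; apply: tr_is_diff; exact: img_at.
have near_x : \forall z \near x,
    (tr c (chart_at S (psi t p)) \o (Phi \o (fun z : E => (t, z)))) z =
    (coord (chart_at S (psi t p)) \o psi t \o param c) z.
  by apply: filterS (near_z Dt) => z [_ h]; rewrite /tr /= coordK.
have [_ HE] := near_eq_is_diff near_x (is_diff_comp d1 d2).
apply: (etrans (congr1 (pairing (w (psi t p))) (congr1 (fun L : E -> E => L v) HE))).
rewrite PE; apply: esym; exact: form_rep_pairing.
Qed.

(** Differentiating in t, at t = 0, the vanishing of w (psi t p) on the image of
   v under the flow; the mixed derivative of the flow is that of Y. *)
Lemma flow_lie_condition (w : one_form S) v : smooth_form setT w ->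
  (forall t, `|t| < eps -> pairing (w (psi t p)) (tangent_map S (psi t) p v) = 0) ->
  'd (fun z => pairing (form_rep c w z) v) x (Y p) +
  pairing (w p) ('d (vf_rep c Y) x v) = 0.
Proof.
move=> sw Hw.
have oT : open (img c setT) by apply: open_img; exact: openT.
have IT : img c setT x by exact: img_coord.
have P0 := Phi0 Ix.
have D0x := D0 Ix.
pose wi i (z : E) : R := form_rep c w z i 0.
have swi i : smooth_on (img c setT) (wi i) by apply: smooth_coord => //; exact: sw.
have dwi i : is_diff (Phi (0, x)) (wi i) ('d (wi i) x).
  by rewrite P0; exact: smooth_is_diff (swi i) IT.
have dW i := is_diff_comp (dPhi D0x) (dwi i).
pose Yz (z : R * E) : E := 'd Phi z (0, v).
have sYz : smooth_on D Yz by exact: smooth_diff.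
have dYz := smooth_is_diff sYz D0x.
have dH := is_diff_comp (is_diff_pairR 0 x) (is_diff_lincomb dYz (dW 0) (dW 1)).
have near0 : \forall t \near (0 : R), ((fun z => Yz z 0 0 * (wi 0 \o Phi) z +
    Yz z 0 1 * (wi 1 \o Phi) z) \o (fun t : R => (t, x))) t = cst 0 t.
  apply: filterS near_t => t Dt.
  have te : `|t| < eps by have [/AP [h _] _] := Dt.
  rewrite -[RHS](Hw t te) (tangent_rep v w Dt).
  by rewrite pairingE.
have [_ E1] := near_eq_is_diff near0 dH.
have E1' := congr1 (fun L : R -> R => L 1) E1.
have E2 : 'd (cst (0 : R) : R -> R) 0 1 = 0.
  have [_ E2] := is_diff_cst (0 : R) (0 : R).
  exact: (congr1 (fun L : R -> R => L 1) E2).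
have mixed : 'd Yz (0, x) (1, 0) = 'd (vf_rep c Y) x v.
  apply: (etrans (diff_sym_row (0 : R, v) (1 : R, 0 : E) oD sPhi D0x)).
  have d1 := smooth_is_diff (smooth_diff (1 : R, 0 : E) sPhi) D0x.
  have near_x : \forall z \near x,
      ((fun z => 'd Phi z (1, 0)) \o (fun z : E => (0 : R, z))) z = vf_rep c Y z.
    by apply: filterS (near_img Ix) => z Iz; exact: dPhi_time.
  have [_ HE] := near_eq_is_diff near_x (is_diff_comp (is_diff_pairL 0 x) d1).
  exact: esym (congr1 (fun L : E -> E => L v) HE).
have time : 'd Phi (0, x) (1, 0) = Y p.
  by rewrite dPhi_time //; exact: vf_rep_at.
have E3 := etrans (esym E1') E2.
have dwv : 'd (fun z => pairing (form_rep c w z) v) x (Y p) =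
    v 0 0 * 'd (wi 0) x (Y p) + v 0 1 * 'd (wi 1) x (Y p).
  have d0 := smooth_is_diff (swi 0) IT.
  have d1 := smooth_is_diff (swi 1) IT.
  have DD := is_diff_lincomb (is_diff_cst v x) d0 d1.
  have [_ HE] := eq_is_diff DD (fun z => esym (pairingE (form_rep c w z) v)) (fun=> erefl).
  apply: (etrans (congr1 (fun L : E -> R => L (Y p)) HE)).
  have -> : (0 : E -> E) (Y p) = 0 by [].
  by rewrite ![(0 : E) _ _]mxE !mul0r !addr0.
have E4 : Yz (0, x) 0 0 * 'd (wi 0) x ('d Phi (0, x) (1, 0)) +
    Yz (0, x) 0 1 * 'd (wi 1) x ('d Phi (0, x) (1, 0)) +
   ('d Yz (0, x) (1, 0) 0 0 * wi 0 (Phi (0, x)) +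
    'd Yz (0, x) (1, 0) 0 1 * wi 1 (Phi (0, x))) = 0 by exact: E3.
have S0 : Yz (0, x) = v by exact: dPhi_space.
have subst4 (a u d z : E) : a = v -> u = Y p -> d = 'd (vf_rep c Y) x v -> z = x ->
    a 0 0 * 'd (wi 0) x u + a 0 1 * 'd (wi 1) x u + (d 0 0 * wi 0 z + d 0 1 * wi 1 z) = 0 ->
    v 0 0 * 'd (wi 0) x (Y p) + v 0 1 * 'd (wi 1) x (Y p) +
    ('d (vf_rep c Y) x v 0 0 * wi 0 x + 'd (vf_rep c Y) x v 0 1 * wi 1 x) = 0.
  by move=> -> -> -> ->.
apply: (etrans _ (subst4 _ _ _ _ S0 time mixed P0 E4)); apply: (congr2 +%R dwv).
apply: (etrans (esym (form_rep_at w p ('d (vf_rep c Y) x v)))).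
exact: (pairingE (form_rep c w x) ('d (vf_rep c Y) x v)).
Qed.

End LieCondition.

Section Algebra.
Variable R : realType.

Fact lie_condition_alg (L11 L12 L21 L22 : R) : L12 = 0 -> L21 = 0 ->
  - (L11 + L21) - - (L12 + L22) = 0 -> L11 = L22.
Proof. by move=> -> ->; lra. Qed.

Fact lie_form3_alg (v0 v1 b0 b1 c0 c1 d0 d1 g1 g2 : R) :
  d0 = - (b0 + c0) -> d1 = - (b1 + c1) ->
  v0 * d0 + v1 * d1 + - (g1 + g2) =
  - ((v0 * b0 + v1 * b1 + g1) + (v0 * c0 + v1 * c1 + g2)).
Proof. by move=> -> ->; ring. Qed.

End Algebra.

Section AutomorphismLie.
Context {R : realType} {M : topologicalType} (S : smooth_surface R M) (W : web3 S).
Variables (k : M -> R) (N1 N2 : vector_field S) (a1 a2 : M -> R).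
Hypothesis WF : web_frame W k N1 N2 a1 a2.
Local Notation E := 'rV[R]_2.
Implicit Types (p q : M) (f : M -> R).

Let oT : open [set: M]. Proof. exact: openT. Qed.

(** The Lie derivative of w along Y. *)
Definition lie_form (Y : vector_field S) (w : one_form S) p (v : E) : R :=
  'd (fun z => pairing (form_rep (chart_at S p) w z) v) (at_coord S p) (Y p) +
  pairing (w p) ('d (vf_rep (chart_at S p) Y) (at_coord S p) v).

Let sF (w : one_form S) p i : smooth_form setT w ->
  is_diff (at_coord S p) (fun z => form_rep (chart_at S p) w z i 0 : R)
    ('d (fun z => form_rep (chart_at S p) w z i 0 : R) (at_coord S p)).
Proof.
move=> sw; apply: (@smooth_is_diff _ _ _ (img (chart_at S p) setT)).
  apply: smooth_coord; last exact: sw.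
  exact: open_img.
by apply: img_coord => //; exact: dom_chart_at.
Qed.

Lemma lie_formE Y w p v : smooth_form setT w -> lie_form Y w p v =
  v 0 0 * 'd (fun z => form_rep (chart_at S p) w z 0 0 : R) (at_coord S p) (Y p) +
  v 0 1 * 'd (fun z => form_rep (chart_at S p) w z 1 0 : R) (at_coord S p) (Y p) +
  pairing (w p) ('d (vf_rep (chart_at S p) Y) (at_coord S p) v).
Proof.
move=> sw; congr (_ + _).
have DD := is_diff_lincomb (is_diff_cst v (at_coord S p)) (sF p 0 sw) (sF p 1 sw).
have [_ HE] := eq_is_diff DD (fun z => esym (pairingE (form_rep _ w z) v)) (fun=> erefl).
apply: (etrans (congr1 (fun L : E -> R => L (Y p)) HE)).
have -> : (0 : E -> E) (Y p) = 0 by [].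
by rewrite ![(0 : E) _ _]mxE !mul0r !addr0.
Qed.

Let sub_alg (u0 u1 v0 v1 a b du0 du1 dv0 dv1 w0 w1 : R) :
  (u0 - v0) * a + (u1 - v1) * b + ((du0 - dv0) * w0 + (du1 - dv1) * w1) =
  u0 * a + u1 * b + (du0 * w0 + du1 * w1) - (v0 * a + v1 * b + (dv0 * w0 + dv1 * w1)).
Proof. by ring. Qed.

Lemma lie_formB Y w p u v : smooth_form setT w ->
  lie_form Y w p (u - v) = lie_form Y w p u - lie_form Y w p v.
Proof.
move=> sw; rewrite !lie_formE // linearB !pairingE.
have EB (a b : E) j : (a - b) 0 j = a 0 j - b 0 j by rewrite !mxE.
by rewrite !EB sub_alg.
Qed.

Lemma lie_form3 Y p v : lie_form Y (form3 W) p v =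
  - (lie_form Y (form1 W) p v + lie_form Y (form2 W) p v).
Proof.
have s1 := form1_smooth W; have s2 := form2_smooth W; have s3 := form3_smooth W.
rewrite !lie_formE // web_form3.
have H i : 'd (fun z => form_rep (chart_at S p) (form3 W) z i 0 : R) (at_coord S p) (Y p) =
   - ('d (fun z => form_rep (chart_at S p) (form1 W) z i 0 : R) (at_coord S p) (Y p)
    + 'd (fun z => form_rep (chart_at S p) (form2 W) z i 0 : R) (at_coord S p) (Y p)).
  have D := is_diffN (is_diffD (sF p i s1) (sF p i s2)).
  have FE z : (- ((fun z => form_rep (chart_at S p) (form1 W) z i 0 : R) +
      (fun z => form_rep (chart_at S p) (form2 W) z i 0 : R))) z =
      form_rep (chart_at S p) (form3 W) z i 0.
    by rewrite !fctE !mxE web_form3.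
  have [_ HE] := eq_is_diff D FE (fun=> erefl).
  exact: (congr1 (fun L : E -> R => L (Y p)) HE).
exact: lie_form3_alg (H 0) (H 1).
Qed.

(** The Leibniz rule for the Lie derivative of the function w(N). *)
Lemma lie_form_frame (V : set M) (Y N : vector_field S) w p : open V -> V p ->
  smooth_form setT w -> smooth_vf setT N -> smooth_vf V Y ->
  lie_form Y w p (N p) =
  der Y (fun q => pairing (w q) (N q)) p - pairing (w p) (lie Y N p).
Proof.
move=> oV Vp sw sN sY.
rewrite (der_pairing Y oV Vp (smooth_form_sub (@subsetT _ V) sw)
  (smooth_vf_sub (@subsetT _ V) sN)) /lie_form /lie.
by rewrite pairingB opprB addrA addrAC addrK addrC.
Qed.

(** [Y, N2] is tangent to the first foliation and [Y, N1] to the second one, so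
   each Ni is multiplied by a function; the third foliation, to which N1 - N2 is
   tangent, forces the two functions to be equal. *)
Lemma automorphism_lie (V : set M) Y p : open V -> V p -> inf_automorphism W V Y ->
  [/\ pairing (form1 W p) (lie Y N2 p) = 0, pairing (form2 W p) (lie Y N1 p) = 0 &
      pairing (form1 W p) (lie Y N1 p) = pairing (form2 W p) (lie Y N2 p)].
Proof.
move=> oV Vp [sY HY]; have [V' [eps [psi [[oV' V'p V'V eps0 FL] Hpsi]]]] := HY p Vp.
have s1 := form1_smooth W; have s2 := form2_smooth W; have s3 := form3_smooth W.
have [h11 h21 h12 h22] := wf_dual WF p.
have L w v : [\/ w = form1 W, w = form2 W | w = form3 W] -> smooth_form setT w ->
    pairing (w p) v = 0 -> lie_form Y w p v = 0.
  move=> Hw sw wv; have Ht t : `|t| < eps ->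
      pairing (w (psi t p)) (tangent_map S (psi t) p v) = 0.
    by move=> te; have [_ Hp] := Hpsi t te; exact: Hp.
  exact: (flow_lie_condition oV' V'p eps0 FL sw Ht).
have dz f : (forall q, f q = 0) -> der Y f p = 0.
  move=> f0; apply: (etrans (eq_der Y oT (fun q _ => esym (f0 q)) (@smooth_fun_cst _ _ S setT 0) I)).
  exact: (der_cst Y oT 0 I).
have K12 := L (form1 W) (N2 p) (Or31 _ _ erefl) s1 h12.
have K21 := L (form2 W) (N1 p) (Or32 _ _ erefl) s2 h21.
have K3 : lie_form Y (form3 W) p (N1 p - N2 p) = 0.
  apply: L => //; first exact: Or33.
  by rewrite pairingB !web_form3 h11 h21 h12 h22 addr0 add0r subrr.
rewrite lie_formB // !lie_form3 in K3.
have K := lie_condition_alg K12 K21 K3.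
rewrite (lie_form_frame oV Vp s1 (wf_N2 WF) sY) dz in K12; last first.
  by move=> q; case: (wf_dual WF q).
rewrite (lie_form_frame oV Vp s2 (wf_N1 WF) sY) dz in K21; last first.
  by move=> q; case: (wf_dual WF q).
move: K12 K21; rewrite !sub0r => /eqP; rewrite oppr_eq0 => /eqP -> /eqP.
rewrite oppr_eq0 => /eqP ->; split=> //.
rewrite (lie_form_frame oV Vp s1 (wf_N1 WF) sY) (lie_form_frame oV Vp s2 (wf_N2 WF) sY) in K.
have EE : der Y (fun q => pairing (form1 W q) (N1 q)) p =
    der Y (fun q => pairing (form2 W q) (N2 q)) p.
  apply: (eq_der Y oT) => //.
    by move=> q _; have [-> _ _ ->] := wf_dual WF q.
  exact: smooth_pairing oT s2 (wf_N2 WF).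
by move: K; rewrite EE => /addrI /oppr_inj.
Qed.

End AutomorphismLie.

(** * Functions with vanishing frame derivatives *)

Section LocallyConstant.
Context {R : realType} {M : topologicalType} (S : smooth_surface R M) (W : web3 S).
Variables (k : M -> R) (N1 N2 : vector_field S) (a1 a2 : M -> R).
Hypothesis WF : web_frame W k N1 N2 a1 a2.
Local Notation E := 'rV[R]_2.

Lemma frame_constant_near (V : set M) (f : M -> R) q : open V -> smooth_fun S V f ->
  (forall p, V p -> der N1 f p = 0 /\ der N2 f p = 0) -> V q ->
  \forall p \near q, f p = f q.
Proof.
move=> oV sf f0 Vq.
pose c := chart_at S q; have cq : dom c q by exact: dom_chart_at.
have df0 p u : V p -> dom c p -> 'd (f \o param c) (coord c p) u = 0.
  move=> Vp cp.
  pose X : vector_field S := fun=> 'd (tr c (chart_at S p)) (coord c p) u.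
  have XE : vf_rep c X (coord c p) = u.
    apply: (etrans (vf_repE X cp)).
    have := tr_diffK u (img_at cp).
    have -> : tr c (chart_at S p) (coord c p) = at_coord S p by rewrite /tr /= coordK.
    by [].
  have H := der_rep X oV sf Vp cp; rewrite XE in H; rewrite -H.
  apply: (etrans (der_comb f (wf_expand WF p (X p)))).
  by have [-> ->] := f0 p Vp; rewrite !mulr0 addr0.
have oI : open (img c V) by exact: open_img.
have [r /= r0 Hr] := iffLR (nbhs_ballP _ _)
  (open_nbhs_nbhs (conj oI (img_coord Vq cq))).
have const y : ball (coord c q) r y -> (f \o param c) y = f q.
  move=> By.
  have dl (t : R) : `|t| <= `|1 : R| ->
      is_derive (coord c q + t *: (y - coord c q)) (y - coord c q) (f \o param c) 0.
    rewrite normr1 => t1.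
    have Bt : ball (coord c q) r (coord c q + t *: (y - coord c q)).
      move: By; rewrite -!ball_normE /= opprD addNKr normrN normrZ distrC.
      by apply: le_lt_trans; rewrite ler_piMl.
    have [Vt ct Et] := iffLR (imgP _ _ _) (Hr _ Bt).
    have D := smooth_is_diff (sf c) (Hr _ Bt).
    have := is_diff_is_derive (y - coord c q) D.
    by rewrite -[in 'd _ _]Et df0.
  have [t _] := mean_value_line dl.
  have -> : coord c q + 1 *: (y - coord c q) = y by rewrite scale1r addrC subrK.
  rewrite mulr0 => /eqP; rewrite subr_eq0 => /eqP ->.
  by rewrite /= coordK.
have : \forall p \near q, (dom c `&` coord c @^-1` ball (coord c q) r) p.
  apply: open_nbhs_nbhs; split; last by split=> //; exact: ballxx.
  apply: open_setI_preimage; [exact: open_dom | exact: ball_open |].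
  by move=> p cp; exact: coord_continuous.
apply: filterS => p [cp Bp].
by rewrite -(const _ Bp) /= coordK.
Qed.

(** The sets where f takes, and does not take, the value f q are both open. *)
Lemma frame_constant (V : set M) (f : M -> R) q : open V -> connected V ->
  smooth_fun S V f -> (forall p, V p -> der N1 f p = 0 /\ der N2 f p = 0) -> V q ->
  forall p, V p -> f p = f q.
Proof.
move=> oV cV sf f0 Vq.
have loc p : V p -> \forall p' \near p, V p' /\ f p' = f p.
  move=> Vp; apply: filterI; first exact: open_nbhs_nbhs.
  exact: frame_constant_near oV sf f0 Vp.
have o1 : open [set p | V p /\ f p = f q].
  rewrite openE => p [Vp fp]; rewrite /interior.
  by apply: filterS (loc p Vp) => p' [V' E]; split=> //; rewrite E.
have o2 : open [set p | V p /\ f p <> f q].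
  rewrite openE => p [Vp fp]; rewrite /interior.
  by apply: filterS (loc p Vp) => p' [V' E]; split=> //; rewrite E.
have E : [set p | V p /\ f p = f q] = V.
  apply: cV; first by exists q.
    exists [set p | V p /\ f p = f q] => //.
    by apply/seteqP; split=> p /= [h1]; [split | case].
  exists (~` [set p | V p /\ f p <> f q]); first exact: open_closedC.
  apply/seteqP; split=> p /= [h1 h2]; split=> //; first by case.
  by apply: contrapT => h; apply: h2.
by move=> p; rewrite -{1}E => -[].
Qed.

(** Tangent vectors are separated by the coordinate functions. *)
Lemma dfun_coord p u j :
  pairing (dfun S (fun q => coord (chart_at S p) q 0 j) p) u = u 0 j.
Proof.
pose X : vector_field S := fun=> u.
have [H _] := vf_rep_coord X j (dom_chart_at S p).
exact: (etrans H (congr1 (fun v : E => v 0 j) (vf_rep_at X p))).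
Qed.

End LocallyConstant.

(** * Uniqueness of the automorphism *)

Section Algebra.
Variable R : realType.

(* fi = Ni f and fij = Ni Nj f for a function f, yij = Ni yj for the components yi
   of a field, l is the common factor and li = Ni l; P = N2 a2, Q = N1 a2,
   Bi = Ni a1, and double indices are second derivatives as for f. *)
Fact lie_N1_alg (y1 y2 A1 A2 f1 f2 f11 f12 f21 y11 y12 : R) :
  f12 - f21 = - A2 * f1 + A1 * f2 ->
  y1 * f11 + y2 * f21 - ((y1 * f11 + y11 * f1) + (y2 * f12 + y12 * f2)) =
  (A2 * y2 - y11) * f1 + (- (A1 * y2) - y12) * f2.
Proof.
move=> C; have -> : f12 = f21 + (- A2 * f1 + A1 * f2) by rewrite -C addrC subrK.
by ring.
Qed.

Fact lie_N2_alg (y1 y2 A1 A2 f1 f2 f12 f21 f22 y21 y22 : R) :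
  f12 - f21 = - A2 * f1 + A1 * f2 ->
  y1 * f12 + y2 * f22 - ((y1 * f21 + y21 * f1) + (y2 * f22 + y22 * f2)) =
  (- (A2 * y1) - y21) * f1 + (A1 * y1 - y22) * f2.
Proof.
move=> C; have -> : f12 = f21 + (- A2 * f1 + A1 * f2) by rewrite -C addrC subrK.
by ring.
Qed.

Fact mult_N2_alg (y1 y2 A1 A2 P Q l l2 y11 y21 y22 : R) :
  y11 = A2 * y2 - l -> y21 = - (A2 * y1) -> y22 = A1 * y1 - l ->
  - (A2 * y11 + Q * y1) - ((A2 * y22 + P * y2) - l2) = - A2 * y11 + A1 * y21 ->
  l2 = Q * y1 + P * y2 - A2 * l.
Proof.
move=> -> -> -> H; apply/eqP; rewrite -subr_eq0; apply/eqP.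
move/eqP: H; rewrite -subr_eq0 => /eqP <-; ring.
Qed.

Fact mult_N1_alg (y1 y2 A1 A2 B1 B2 l l1 y11 y12 y22 : R) :
  y11 = A2 * y2 - l -> y12 = - (A1 * y2) -> y22 = A1 * y1 - l ->
  ((A1 * y11 + B1 * y1) - l1) - - (A1 * y22 + B2 * y2) = - A2 * y12 + A1 * y22 ->
  l1 = B1 * y1 + B2 * y2 - A1 * l.
Proof.
move=> -> -> -> H; apply/eqP; rewrite -subr_eq0; apply/eqP.
apply: oppr_inj; rewrite oppr0.
move/eqP: H; rewrite -subr_eq0 => /eqP <-; ring.
Qed.

Fact mult_zero_alg (y1 y2 A1 A2 P Q B1 B2 l l1 l2 y11 y12 y21 y22
    Q1 Q2 P1 B12 B21 B22 : R) :
  y11 = A2 * y2 - l -> y12 = - (A1 * y2) -> y21 = - (A2 * y1) -> y22 = A1 * y1 - l ->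
  Q = 1 + B2 -> Q1 = B12 -> Q2 = B22 ->
  B12 - B21 = - A2 * B1 + A1 * B2 -> P1 - Q2 = - A2 * Q + A1 * P ->
  ((Q * y11 + Q1 * y1) + (P * y12 + P1 * y2) - (A2 * l1 + Q * l)) -
  ((B1 * y21 + B21 * y1) + (B2 * y22 + B22 * y2) - (A1 * l2 + B2 * l)) =
  - A2 * l1 + A1 * l2 -> l = 0.
Proof.
move=> -> -> -> -> EQ -> E2 C1 C2.
have -> : P1 = Q2 + (- A2 * Q + A1 * P) by rewrite -C2 addrC subrK.
have -> : B12 = B21 + (- A2 * B1 + A1 * B2) by rewrite -C1 addrC subrK.
rewrite E2 EQ => H.
set L := (X in X = _) in H; set D := (X in _ = X) in H.
have -> : l = (D - L) / 2 by rewrite /L /D; field.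
by rewrite H subrr mul0r.
Qed.

Fact ratio_constant_alg (y1 A2 s P P2 : R) : s != 0 -> P != 0 ->
  y1 * (- (s * P2 + - ((A2 * P + P2) / P) * s * P) / (s * P) ^+ 2) +
  - (A2 * y1) * (s * P)^-1 = 0.
Proof. by move=> s0 P0; field; rewrite s0 P0. Qed.

Fact ratio_eq_alg (y1 y2 s P Q : R) : s != 0 -> P != 0 -> Q != 0 ->
  Q * y1 + P * y2 = 0 -> - (y2 * (s * Q)^-1) = y1 * (s * P)^-1.
Proof.
move=> s0 P0 Q0 H; have -> : y1 = - (P * y2) / Q.
  by apply: (mulIf Q0); rewrite divfK // mulrC; apply/eqP; rewrite -addr_eq0 H.
by field; rewrite s0 P0 Q0.
Qed.


Fact coef1_alg (A B z w k : R) : k != 0 -> z = k^-1 -> w = 0 ->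
  A * z + B * w = 0 -> A = 0.
Proof.
move=> k0 -> ->; rewrite mulr0 addr0 => /eqP.
by rewrite mulf_eq0 invr_eq0 (negPf k0) orbF => /eqP.
Qed.

Fact coef2_alg (A B z w k : R) : k != 0 -> z = 0 -> w = k^-1 ->
  A * z + B * w = 0 -> B = 0.
Proof. by move=> k0 hz hw; rewrite addrC => /(coef1_alg k0 hw hz). Qed.

Fact coef_eq_alg (A B A' B' z w z' w' k : R) : k != 0 ->
  z = k^-1 -> w = 0 -> z' = 0 -> w' = k^-1 ->
  A * z + B * w = A' * z' + B' * w' -> A = B'.
Proof.
move=> k0 -> -> -> ->; rewrite !mulr0 addr0 add0r => H.
by apply: (mulIf _ H); rewrite invr_eq0.
Qed.

End Algebra.

Section Rigidity.
Context {R : realType} {M : topologicalType} (S : smooth_surface R M) (W : web3 S).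
Variables (k : M -> R) (N1 N2 : vector_field S) (a1 a2 : M -> R).
Hypothesis WF : web_frame W k N1 N2 a1 a2.
Variables (V : set M) (Y : vector_field S).
Hypotheses (oV : open V) (HY : inf_automorphism W V Y).
Local Notation E := 'rV[R]_2.
Implicit Types (p q : M) (f : M -> R).

Local Notation P := (der N2 a2).
Local Notation Q := (der N1 a2).
Local Notation B1 := (der N1 a1).
Local Notation B2 := (der N2 a1).

Let oT : open [set: M]. Proof. exact: openT. Qed.
Let subT : V `<=` setT. Proof. by []. Qed.
Let sN1 : smooth_vf V N1 := smooth_vf_sub subT (wf_N1 WF).
Let sN2 : smooth_vf V N2 := smooth_vf_sub subT (wf_N2 WF).
Let sa1 : smooth_fun S V a1 := smooth_fun_sub subT (wf_a1 WF).
Let sa2 : smooth_fun S V a2 := smooth_fun_sub subT (wf_a2 WF).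
Let sP : smooth_fun S V P := smooth_der oV sN2 sa2.
Let sQ : smooth_fun S V Q := smooth_der oV sN1 sa2.
Let sB1 : smooth_fun S V B1 := smooth_der oV sN1 sa1.
Let sB2 : smooth_fun S V B2 := smooth_der oV sN2 sa1.
Let sY : smooth_vf V Y. Proof. by case: HY. Qed.

Definition comp1 p : R := k p * pairing (form1 W p) (Y p).
Definition comp2 p : R := k p * pairing (form2 W p) (Y p).
Local Notation y1 := comp1.
Local Notation y2 := comp2.

Lemma smooth_comp1 : smooth_fun S V y1.
Proof.
exact: (smooth_funM oV (smooth_fun_sub subT (wf_k WF))
  (smooth_pairing oV (smooth_form_sub subT (form1_smooth W)) sY)).
Qed.

Lemma smooth_comp2 : smooth_fun S V y2.
Proof.
exact: (smooth_funM oV (smooth_fun_sub subT (wf_k WF))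
  (smooth_pairing oV (smooth_form_sub subT (form2_smooth W)) sY)).
Qed.

Let sy1 := smooth_comp1.
Let sy2 := smooth_comp2.

Lemma comp_expand p : Y p = y1 p *: N1 p + y2 p *: N2 p.
Proof. by rewrite {1}(wf_expand WF p (Y p)) !pairingZl. Qed.

Let derY f p : der Y f p = y1 p * der N1 f p + y2 p * der N2 f p.
Proof. exact: der_comb (comp_expand p). Qed.

Let der_derY (N : vector_field S) (U : set M) f p : open U -> U `<=` V -> U p ->
  smooth_vf U N -> smooth_fun S U f ->
  der N (der Y f) p =
    (y1 p * der N (der N1 f) p + der N y1 p * der N1 f p) +
    (y2 p * der N (der N2 f) p + der N y2 p * der N2 f p).
Proof.
move=> oU UV Up sN sf.
have s1 := smooth_der oU (smooth_vf_sub UV sN1) sf.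
have s2 := smooth_der oU (smooth_vf_sub UV sN2) sf.
have t1 := smooth_fun_sub UV sy1; have t2 := smooth_fun_sub UV sy2.
have u1 := smooth_funM oU t1 s1; have u2 := smooth_funM oU t2 s2.
apply: (etrans (eq_der N oU (fun q _ => esym (derY f q)) (smooth_funD oU u1 u2) Up)).
apply: (etrans (derD N oU u1 u2 Up)).
exact: (congr2 +%R (derM N oU t1 s1 Up) (derM N oU t2 s2 Up)).
Qed.

(** Both sides are compared through their action on coordinate functions, where
   the bracket is a commutator of derivations. *)
Lemma comp_lie p : V p ->
  lie Y N1 p = (a2 p * y2 p - der N1 y1 p) *: N1 p +
               (- (a1 p * y2 p) - der N1 y2 p) *: N2 p /\
  lie Y N2 p = (- (a2 p * y1 p) - der N2 y1 p) *: N1 p +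
               (a1 p * y1 p - der N2 y2 p) *: N2 p.
Proof.
move=> Vp; pose U := V `&` dom (chart_at S p).
have oU : open U by apply: openI => //; exact: open_dom.
have UV : U `<=` V by move=> ? [].
have Up : U p by split=> //; exact: dom_chart_at.
have sc j : smooth_fun S U (fun q => coord (chart_at S p) q 0 j).
  have [_ h] := vf_rep_coord N1 j (dom_chart_at S p).
  by apply: smooth_fun_sub h => ? [].
have sN1' := smooth_vf_sub UV sN1; have sN2' := smooth_vf_sub UV sN2.
have sY' := smooth_vf_sub UV sY.
split; apply/rowP => j; rewrite -[LHS](dfun_coord S p) -[RHS](dfun_coord S p).
- rewrite -(lie_der oU Up (sc j) sY' sN1') pairing_comb derY.
  rewrite (der_derY oU UV Up sN1' (sc j)).
  exact: (lie_N1_alg _ _ _ _ _ (wf_comm WF oU Up (sc j))).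
- rewrite -(lie_der oU Up (sc j) sY' sN2') pairing_comb derY.
  rewrite (der_derY oU UV Up sN2' (sc j)).
  exact: (lie_N2_alg _ _ _ _ _ (wf_comm WF oU Up (sc j))).
Qed.

(** The function with [Y, Ni] = mult Ni for i = 1 and i = 2. *)
Definition mult p : R := a2 p * y2 p - der N1 y1 p.

Lemma comp_equations p : V p ->
  [/\ der N1 y1 p = a2 p * y2 p - mult p, der N1 y2 p = - (a1 p * y2 p),
      der N2 y1 p = - (a2 p * y1 p) & der N2 y2 p = a1 p * y1 p - mult p].
Proof.
move=> Vp; have [h1 h2 h3] := automorphism_lie WF oV Vp HY.
have [l1 l2] := comp_lie Vp.
have [d11 d21 d12 d22] := wf_dual WF p.
have k0 := wf_k0 WF p.
have pl w := etrans (congr1 (pairing w) l1) (pairing_comb w _ _ (N1 p) (N2 p)).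
have pl' w := etrans (congr1 (pairing w) l2) (pairing_comb w _ _ (N1 p) (N2 p)).
have E2 := coef2_alg k0 d21 d22 (etrans (esym (pl (form2 W p))) h2).
have E1 := coef1_alg k0 d11 d12 (etrans (esym (pl' (form1 W p))) h1).
have E3 := coef_eq_alg k0 d11 d12 d21 d22
  (etrans (esym (pl (form1 W p))) (etrans h3 (pl' (form2 W p)))).
split.
- exact: esym (subKr _ _).
- exact: esym (subr0_eq E2).
- exact: esym (subr0_eq E1).
- exact: etrans (esym (subKr _ _)) (congr1 (fun z => a1 p * y1 p - z) (esym E3)).
Qed.

Let smult : smooth_fun S V mult.
Proof. exact: (smooth_funB oV (smooth_funM oV sa2 sy2) (smooth_der oV sN1 sy1)). Qed.

(** The commutator identity for y1 and for y2, after substituting comp_equations: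
   the derivatives of mult are Y a1 - a1 mult and Y a2 - a2 mult. *)
Lemma mult_equations p : V p ->
  der N1 mult p = B1 p * y1 p + B2 p * y2 p - a1 p * mult p /\
  der N2 mult p = Q p * y1 p + P p * y2 p - a2 p * mult p.
Proof.
move=> Vp; have [e11 e12 e21 e22] := comp_equations Vp.
have s21 := smooth_funM oV sa2 sy1; have s12 := smooth_funM oV sa1 sy2.
have s11 := smooth_funM oV sa2 sy2; have s22 := smooth_funM oV sa1 sy1.
split.
- have c := wf_comm WF oV Vp sy2.
  have H1 : der N1 (der N2 y2) p = (a1 p * der N1 y1 p + B1 p * y1 p) - der N1 mult p.
    apply: (etrans (@eq_der _ _ _ V N1 oV (fun q => a1 q * y1 q - mult q) _ p _ (smooth_funB oV s22 smult) Vp)).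
      by move=> q Vq; have [_ _ _ e] := comp_equations Vq; exact: esym e.
    apply: (etrans (derB N1 oV s22 smult Vp)).
    exact: (congr1 (fun z => z - _) (derM N1 oV sa1 sy1 Vp)).
  have H2 : der N2 (der N1 y2) p = - (a1 p * der N2 y2 p + B2 p * y2 p).
    apply: (etrans (@eq_der _ _ _ V N2 oV (fun q => - (a1 q * y2 q)) _ p _ (smooth_funN oV s12) Vp)).
      by move=> q Vq; have [_ e _ _] := comp_equations Vq; exact: esym e.
    apply: (etrans (derN N2 oV s12 Vp)).
    exact: (congr1 (fun z => - z) (derM N2 oV sa1 sy2 Vp)).
  exact: (mult_N1_alg e11 e12 e22 (etrans (esym (congr2 (fun z w => z - w) H1 H2)) c)).
- have c := wf_comm WF oV Vp sy1.
  have H1 : der N1 (der N2 y1) p = - (a2 p * der N1 y1 p + Q p * y1 p).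
    apply: (etrans (@eq_der _ _ _ V N1 oV (fun q => - (a2 q * y1 q)) _ p _ (smooth_funN oV s21) Vp)).
      by move=> q Vq; have [_ _ e _] := comp_equations Vq; exact: esym e.
    apply: (etrans (derN N1 oV s21 Vp)).
    exact: (congr1 (fun z => - z) (derM N1 oV sa2 sy1 Vp)).
  have H2 : der N2 (der N1 y1) p = (a2 p * der N2 y2 p + P p * y2 p) - der N2 mult p.
    apply: (etrans (@eq_der _ _ _ V N2 oV (fun q => a2 q * y2 q - mult q) _ p _ (smooth_funB oV s11 smult) Vp)).
      by move=> q Vq; have [e _ _ _] := comp_equations Vq; exact: esym e.
    apply: (etrans (derB N2 oV s11 smult Vp)).
    exact: (congr1 (fun z => z - _) (derM N2 oV sa2 sy2 Vp)).
  exact: (mult_N2_alg e11 e21 e22 (etrans (esym (congr2 (fun z w => z - w) H1 H2)) c)).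
Qed.

Let der_linear (N : vector_field S) (f g h a : M -> R) p : V p ->
  smooth_fun S V f -> smooth_fun S V g -> smooth_fun S V h -> smooth_fun S V a ->
  der N (fun q => f q * y1 q + g q * y2 q - a q * h q) p =
  ((f p * der N y1 p + der N f p * y1 p) + (g p * der N y2 p + der N g p * y2 p))
   - (a p * der N h p + der N a p * h p).
Proof.
move=> Vp sf sg sh sa.
have s1 := smooth_funM oV sf sy1; have s2 := smooth_funM oV sg sy2.
have s3 := smooth_funM oV sa sh.
apply: (etrans (derB N oV (smooth_funD oV s1 s2) s3 Vp)).
apply: (congr2 (fun z w => z - w) _ (derM N oV sa sh Vp)).
apply: (etrans (derD N oV s1 s2 Vp)).
exact: (congr2 +%R (derM N oV sf sy1 Vp) (derM N oV sg sy2 Vp)).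
Qed.

(** The common factor by which an automorphism scales the forms is zero: its
   derivatives are those of a1, a2 along Y corrected by a1, a2 times itself, and
   the commutator identity for it reads 2 mult = 0. *)
Lemma mult0 p : V p -> mult p = 0.
Proof.
move=> Vp; have [e11 e12 e21 e22] := comp_equations Vp.
have EQ q : Q q = 1 + B2 q by have := wf_structure WF q => <-; rewrite subrK.
have EQd (N : vector_field S) : der N Q p = der N B2 p.
  apply: (etrans (eq_der N oV (fun q _ => esym (EQ q))
    (smooth_funD oV (@smooth_fun_cst _ _ S V 1) sB2) Vp)).
  apply: (etrans (derD N oV (@smooth_fun_cst _ _ S V 1) sB2 Vp)).
  by rewrite (der_cst N oV 1 Vp) add0r.
have c1 := wf_comm WF oV Vp sa1.
have c2 := wf_comm WF oV Vp sa2.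
have c := wf_comm WF oV Vp smult.
have H1 : der N1 (der N2 mult) p = ((Q p * der N1 y1 p + der N1 Q p * y1 p) +
    (P p * der N1 y2 p + der N1 P p * y2 p)) - (a2 p * der N1 mult p + Q p * mult p).
  apply: (etrans _ (der_linear N1 Vp sQ sP smult sa2)).
  apply: (@eq_der _ _ _ V N1 oV (fun q => Q q * y1 q + P q * y2 q - a2 q * mult q)) => //.
    by move=> q Vq; have [_ e] := mult_equations Vq; exact: esym e.
  exact: (smooth_funB oV (smooth_funD oV (smooth_funM oV sQ sy1) (smooth_funM oV sP sy2))
    (smooth_funM oV sa2 smult)).
have H2 : der N2 (der N1 mult) p = ((B1 p * der N2 y1 p + der N2 B1 p * y1 p) +
    (B2 p * der N2 y2 p + der N2 B2 p * y2 p)) - (a1 p * der N2 mult p + B2 p * mult p).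
  apply: (etrans _ (der_linear N2 Vp sB1 sB2 smult sa1)).
  apply: (@eq_der _ _ _ V N2 oV (fun q => B1 q * y1 q + B2 q * y2 q - a1 q * mult q)) => //.
    by move=> q Vq; have [e _] := mult_equations Vq; exact: esym e.
  exact: (smooth_funB oV (smooth_funD oV (smooth_funM oV sB1 sy1) (smooth_funM oV sB2 sy2))
    (smooth_funM oV sa1 smult)).
exact: (mult_zero_alg e11 e12 e21 e22 (EQ p) (EQd N1) (EQd N2) c1 c2
  (etrans (esym (congr2 (fun z w => z - w) H1 H2)) c)).
Qed.

(** With mult = 0, its derivative along N2 reduces to Y a2. *)
Lemma comp_tangent p : V p -> Q p * y1 p + P p * y2 p = 0.
Proof.
move=> Vp; have [_ E2] := mult_equations Vp.
have Z : der N2 mult p = 0.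
  apply: (etrans (eq_der N2 oV (fun q Vq => esym (mult0 Vq)) (@smooth_fun_cst _ _ S V 0) Vp)).
  exact: (der_cst N2 oV 0 Vp).
by move: E2; rewrite Z (mult0 Vp) mulr0 subr0 => /esym.
Qed.

Hypotheses (N1a2_neq0 : forall p, der N1 a2 p != 0)
  (N2a2_neq0 : forall p, der N2 a2 p != 0).
Variables (U : set M) (s y : M -> R).
Hypothesis SS : scaled_symmetry N1 N2 a1 a2 U s y.
Hypothesis VU : V `<=` U.

Let ss : smooth_fun S V s := smooth_fun_sub VU (ss_s SS).

(** Y / X, read off the components along N1; by comp_tangent the components along
   N2 have the same ratio. *)
Definition ratio p : R := y1 p * (s p * P p)^-1.

Let s0 q : s q != 0. Proof. exact: ss_s0 SS q. Qed.
Let sP0 q : V q -> s q * P q != 0. Proof. by move=> _; rewrite mulf_neq0. Qed.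
Let sQ0 q : V q -> s q * Q q != 0. Proof. by move=> _; rewrite mulf_neq0. Qed.

Let ssP := smooth_funM oV ss sP.
Let ssQ := smooth_funM oV ss sQ.

(** Each derivative is computed with the component whose equation does not contain
   the other one: y2 along N1 and y1 along N2. *)
Lemma ratio_constant p : V p -> der N1 ratio p = 0 /\ der N2 ratio p = 0.
Proof.
move=> Vp; have [e11 e12 e21 e22] := comp_equations Vp.
split.
- have sV := smooth_funV oV sQ0 ssQ.
  have smv := smooth_funM oV sy2 sV.
  apply: (etrans (@eq_der _ _ _ V N1 oV (fun q => - (y2 q * (s q * Q q)^-1)) _ p _
     (smooth_funN oV smv) Vp)).
    move=> q Vq; exact: (ratio_eq_alg (s0 q) (N2a2_neq0 q) (N1a2_neq0 q) (comp_tangent Vq)).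
  apply: (etrans (derN N1 oV smv Vp)).
  rewrite (derM N1 oV sy2 sV Vp) (derV N1 oV sQ0 ssQ Vp) (derM N1 oV ss sQ Vp).
  rewrite e12 (ss_N1s' SS (VU Vp)).
  by rewrite (ratio_constant_alg _ _ _ (s0 p) (N1a2_neq0 p)) oppr0.
- have sV := smooth_funV oV sP0 ssP.
  apply: (etrans (derM N2 oV sy1 sV Vp)).
  rewrite (derV N2 oV sP0 ssP Vp) (derM N2 oV ss sP Vp).
  rewrite e21 (ss_N2s SS (VU Vp)).
  exact: (ratio_constant_alg _ _ _ (s0 p) (N2a2_neq0 p)).
Qed.

Lemma ratio_symmetry p : V p -> Y p = ratio p *: symmetry N1 N2 a2 s p.
Proof.
move=> Vp; rewrite (comp_expand p) symmetryE scalerDr !scalerA.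
have E1 : ratio p * (s p * P p) = y1 p by rewrite /ratio mulfVK // sP0.
have E2 : ratio p * - (s p * Q p) = y2 p.
  rewrite /ratio -(ratio_eq_alg (s0 p) (N2a2_neq0 p) (N1a2_neq0 p) (comp_tangent Vp)).
  by rewrite mulrNN mulfVK // sQ0.
by rewrite E1 E2.
Qed.

Lemma automorphism_unique : connected V ->
  exists c : R, forall p, V p -> Y p = c *: symmetry N1 N2 a2 s p.
Proof.
move=> cV; have [[q Vq]|V0] := pselect (V !=set0); last first.
  by exists 0 => p Vp; exfalso; apply: V0; exists p.
have sr : smooth_fun S V ratio by exact: (smooth_funM oV sy1 (smooth_funV oV sP0 ssP)).
exists (ratio q) => p Vp.
by rewrite (ratio_symmetry Vp) (frame_constant WF oV cV sr ratio_constant Vq Vp).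
Qed.

End Rigidity.

(** * The infinitesimal automorphism near a point *)

Theorem theorem5p4 (R : realType) (M : topologicalType)
  (S : smooth_surface R M) (W : web3 S)
  (gamma : one_form S) (K k : M -> R)
  (N1 N2 : vector_field S) (a1 a2 : M -> R)
  (gammaP : is_connection W gamma)
  (KP : is_curvature W gamma K)
  (K_gt0 : forall p, 0 < K p)
  (k_smooth : smooth_fun S setT k)
  (k_gt0 : forall p, 0 < k p)
  (kP : forall p, K p = k p ^+ 2)
  (NP : is_dual_frame W k N1 N2)
  (aP : are_absolute_invariants W gamma k a1 a2)
  (N1a2_neq0 : forall p, der N1 a2 p != 0)
  (N2a2_neq0 : forall p, der N2 a2 p != 0)
  (J_eq0 : forall p,
     \det (\matrix_(i < 2, j < 2)
        der (if i == 0 then N1 else N2) (if j == 0 then a1 else a2) p) = 0)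
  (rel1 : forall p,
     a2 p * der N1 a2 p ^+ 2 + der N1 (der N2 a2) p * der N1 a2 p =
     a1 p * der N1 a2 p * der N2 a2 p + der N1 (der N1 a2) p * der N2 a2 p)
  (rel2 : forall p,
     a2 p * der N2 a2 p * der N1 a2 p + der N2 (der N2 a2) p * der N1 a2 p =
     a1 p * der N2 a2 p ^+ 2 + der N2 (der N1 a2) p * der N2 a2 p)
  (rel3 : forall p,
     der N2 (der N1 (der N2 a2)) p + a2 p * der N1 (der N2 a2) p =
     a1 p * der N2 (der N2 a2) p + a2 p * der N1 a2 p * der N2 a2 p +
     der N1 (der N2 (der N2 a2)) p) :
  forall p0 : M,
  exists (U : set M) (X : vector_field S) (s : M -> R),
    [/\ open U, connected U & U p0] /\
    [/\ inf_automorphism W U X,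
        exists2 p, U p & X p != 0,
        (forall (V : set M) (Y : vector_field S),
           open V -> connected V -> V `<=` U -> inf_automorphism W V Y ->
           exists c : R, forall p, V p -> Y p = c *: X p),
        smooth_fun S U s &
        forall p, U p ->
          X p = s p *: (der N2 a2 p *: N1 p - der N1 a2 p *: N2 p) /\
          [/\ der N1 s p =
                - ((a2 p * der N1 a2 p + der N1 (der N2 a2) p) / der N2 a2 p) * s p,
              der N1 s p =
                - ((a1 p * der N1 a2 p + der N1 (der N1 a2) p) / der N1 a2 p) * s p,
              der N2 s p =
                - ((a2 p * der N2 a2 p + der N2 (der N2 a2) p) / der N2 a2 p) * s p &
              der N2 s p =
                - ((a1 p * der N2 a2 p + der N2 (der N1 a2) p) / der N1 a2 p) * s p]].
Proof.
move=> p0.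
have k0 p : k p != 0 by rewrite gt_eqF.
have WF : web_frame W k N1 N2 a1 a2.
  have [sN1 sN2 _] := NP; have [sa1 sa2 _] := aP.
  split=> //.
  - by move=> p; exact: (web_form_frame k_gt0 NP).
  - by move=> p v; exact: (frame_expand NP).
  - by move=> U f p oU Up sf; exact: (commutator gammaP k_smooth k_gt0 NP aP oU Up sf).
  - by move=> p; exact: (invariant_structure gammaP KP k_smooth k_gt0 kP NP aP).
have [U0 [s [y [U0p0 SS0]]]] :=
  scaled_symmetry_exists WF N1a2_neq0 N2a2_neq0 rel1 rel2 p0.
pose c := chart_at S p0; have cp0 : dom c p0 by exact: dom_chart_at.
pose U1 := U0 `&` dom c.
have oU1 : open U1 by apply: openI; [exact: ss_open SS0 | exact: open_dom].
have U1c : U1 `<=` dom c by move=> ? [].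
have SS : scaled_symmetry N1 N2 a1 a2 U1 s y.
  by apply: scaled_symmetry_sub SS0 => // ? [].
have Ip0 : img c U1 (coord c p0) by exact: img_coord.
have oI : open (img c U1) by exact: open_img.
have sG := smooth_rect WF SS c.
have sT0 := smooth_transversal WF N1a2_neq0 SS c.
have sT1 := smooth_symmetry WF SS c.
have dG x (h : img c U1 x) := diff_rect_frame WF N1a2_neq0 SS U1c h.
have [B [r [Psi [[r0 oB Bp0 BU] rectB PsiD sPsi dPsi]]]] :=
  local_inverse oI Ip0 sG sT0 sT1 dG.
set X := symmetry N1 N2 a2 s.
have boxU := flow_box_sub BU.
have oBox : open (flow_box c B) by exact: open_flow_box.
exists (flow_box c B), X, s; split; first split.
- exact: oBox.
- exact: (flow_box_connected r0 BU rectB PsiD sPsi).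
- by split.
split.
- exact: (symmetry_automorphism WF N1a2_neq0 N2a2_neq0 rel1 rel2 SS U1c oB BU
    rectB PsiD sPsi dPsi).
- exists p0; first by split.
  apply/eqP => X0.
  have : pairing (form1 W p0) (X p0) = 0 by rewrite X0 pairingE !mxE !mul0r addr0.
  rewrite /X symmetryE pairing_comb; have [-> _ -> _] := wf_dual WF p0.
  rewrite mulr0 addr0 => /eqP; rewrite !mulf_eq0 invr_eq0 (negPf (k0 p0)).
  by rewrite (negPf (N2a2_neq0 p0)) (negPf (ss_s0 SS p0)).
- move=> V Y oV cV VU HY.
  have VU1 : V `<=` U1 by move=> p /VU /boxU.
  exact: (automorphism_unique WF oV HY N1a2_neq0 N2a2_neq0 SS VU1 cV).
- exact: smooth_fun_sub boxU (ss_s SS).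
- move=> p /boxU Up; split; first by [].
  split.
  + exact: (ss_N1s SS Up).
  + exact: (ss_N1s' SS Up).
  + exact: (ss_N2s SS Up).
  + exact: (ss_N2s' SS Up).
Qed.
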